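(* Let $p\in(0,1)$ be fixed, $q=1-p$, and let $\widehat{\Upsilon}_n$ be the random Patricia trie built from $n$ independent random strings with i.i.d. $\mathrm{Be}(p)$ bits. Let $t$ be a full binary tree with $|t|_{\mathsf e}=m>1$. Then, as $n\to\infty$, $$\mathbb{P}(\widehat{\Upsilon}^*_n=t\mid\widehat{\Upsilon}_n)=\frac{1}{2H}\psi_{\mathsf E}(\log n)+o_{\mathrm p}(1),\qquad \mathbb{P}(\widehat{\Upsilon}^*_n=t)=\frac{1}{2H}\psi_{\mathsf E}(\log n)+o(1).$$ In particular, in the aperiodic case ($\log p/\log q\notin\mathbb{Q}$), $$\mathbb{P}(\widehat{\Upsilon}^*_n=t\mid\widehat{\Upsilon}_n)\overset{\mathrm p}{\longrightarrow}\frac{\pi_t}{2m(m-1)H},\qquad \mathbb{P}(\widehat{\Upsilon}^*_n=t)\longrightarrow\frac{\pi_t}{2m(m-1)H}.$$ Furthermore, if $|t|=1$, i.e., $t=\bullet$, then, for any $p$, $$\mathbb{P}(\widehat{\Upsilon}^*_n=t\mid\widehat{\Upsilon}_n)=\mathbb{P}(\widehat{\Upsilon}^*_n=t)=\frac{n}{2n-1}\to\frac12.$$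
   Context: Trees. A binary tree is a (finite, non-empty) rooted tree in which each child is labelled left or right and each node has at most one left and at most one right child. It is full if each node has outdegree 0 or 2. $|T|$ is the number of nodes and $|T|_{\mathsf e}$ the number of leaves of $T$; $\bullet$ is the tree with one node. For $v\in T$, the fringe tree $T^v$ consists of $v$ and all its descendants. The random fringe tree $T^*$ of a tree $T$ is $T^v$ for a uniformly random node $v$ of $T$ (if $T$ is random, first condition on $T$). The compression $\widehat T$ of a binary tree $T$ is the full binary tree obtained by deleting all nodes of outdegree 1 and connecting the remaining nodes in the obvious way. For a full binary tree $t$, $\check{\mathfrak T}_t$ is the set of binary trees $T$ with $\widehat T=t$ whose root does not have outdegree 1. Tries. Given $n$ distinct infinite strings in $\{0,1\}^\infty$, the trie is built recursively: for $n=0$ it is empty; otherwise put all strings in a root; if $n=1$ stop; if $n\ge2$ pass all strings beginning with 0 (if any) to a left child and all strings beginning with 1 (if any) to a right child, and continue recursively at each child using the next letter. $\Upsilon_n$ is the random trie defined by $n$ independent strings whose letters are independent with $\mathbb{P}(1)=p$, $\mathbb{P}(0)=q=1-p$. The Patricia trie $\widehat{\Upsilon}_n$ is the compression of $\Upsilon_n$; $\widehat{\Upsilon}^*_n$ is its random fringe tree. Constants and functions. $\pi_t:=\mathbb{P}(\Upsilon_m\in\check{\mathfrak T}_t)$ with $m=|t|_{\mathsf e}$; $H:=-p\log p-q\log q$; $f^*_{\mathsf E}(s):=\pi_t\Gamma(m+s)/m!$ for $\operatorname{Re}s>-m$. If $\log p/\log q\notin\mathbb{Q}$ (aperiodic case),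 $\psi_{\mathsf E}(x):=f^*_{\mathsf E}(-1)=\pi_t/(m(m-1))$ for all $x$. If $\log p/\log q=a/b$ in lowest terms with $a,b\in\mathbb{N}$, let $d:=(-\log p)/a=(-\log q)/b$ and $\psi_{\mathsf E}(x):=\sum_{k=-\infty}^\infty f^*_{\mathsf E}\bigl(-1-\frac{2\pi k}{d}\mathrm i\bigr)e^{2\pi\mathrm i kx/d}$. $o_{\mathrm p}(1)$ denotes random variables converging to 0 in probability. *)

(* Defs.v *)
From HB Require Import structures.
From mathcomp Require Import all_boot all_order all_algebra.
From mathcomp Require Import complex.
From mathcomp Require Import all_classical all_reals all_analysis.
Set Implicit Arguments.
Unset Strict Implicit.
Unset Printing Implicit Defensive.
Import Order.TTheory GRing.Theory Num.Theory.
Import numFieldNormedType.Exports.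

Local Open Scope classical_set_scope.
Local Open Scope ring_scope.

(** ** Binary trees *)

(* The two fields are the optional left and right children, so a [btree] is
   never empty; the empty tree is [None : option btree]. *)
Inductive btree : Type := Node of option btree & option btree.

Definition bullet : btree := Node None None.

Fixpoint nnodes (T : btree) : nat :=
  let: Node l r := T in (oapp nnodes 0 l + oapp nnodes 0 r).+1.

Fixpoint nleaves (T : btree) : nat :=
  match T with
  | Node None None => 1
  | Node l r => oapp nleaves 0 l + oapp nleaves 0 r
  end.

Definition outdegree (T : btree) : nat :=
  let: Node l r := T in isSome l + isSome r.

Fixpoint full (T : btree) : bool :=
  match T with
  | Node None None => true
  | Node (Some l) (Some r) => full l && full r
  | _ => false
  end.

Fixpoint compress (T : btree) : btree :=
  match T with
  | Node None None => bullet
  | Node (Some c) None | Node None (Some c) => compress c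
  | Node (Some l) (Some r) => Node (Some (compress l)) (Some (compress r))
  end.

Definition child (T : btree) (b : bool) : option btree :=
  let: Node l r := T in if b then r else l.

(* A node is named by its path from the root ([false] = left, [true] = right);
   [fringe T v] is [Some (T^v)] if [v] is a node of [T], and [None] if not. *)
Fixpoint fringe (T : btree) (v : seq bool) : option btree :=
  if v is b :: v' then obind (fringe^~ v') (child T b) else Some T.

Definition precompressions (t : btree) : set btree :=
  [set T | compress T = t /\ outdegree T <> 1%N].

(** ** Tries *)

Definition branch (b : bool) (S : seq (nat -> bool)) : seq (nat -> bool) :=
  [seq (fun j => s j.+1) | s <- S & s 0%N == b].

(* The recursion ends iff the strings are pairwise distinct, so it is given as
   an inductive relation. *)
Inductive is_trie : seq (nat -> bool) -> option btree -> Prop :=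
| trie_empty : is_trie [::] None
| trie_single s : is_trie [:: s] (Some bullet)
| trie_split S T0 T1 : (1 < size S)%N ->
    is_trie (branch false S) T0 -> is_trie (branch true S) T1 ->
    is_trie S (Some (Node T0 T1)).

(* The value is [bullet], which has no meaning, if n = 0 or if two of the
   strings coincide (for random strings, a null event). *)
Definition random_trie (Omega : Type) (n : nat)
    (X : 'I_n -> nat -> Omega -> bool) (w : Omega) : btree :=
  let S := [seq (fun j => X i j w) | i <- enum 'I_n] in
  if pselect (exists T, is_trie S (Some T)) is left h then sval (cid h)
  else bullet.

Definition patricia (Omega : Type) (n : nat)
    (X : 'I_n -> nat -> Omega -> bool) (w : Omega) : btree :=
  compress (random_trie X w).

(** ** Probability *)

Definition mutually_independent_events d (Omega : measurableType d)
    (R : realType) (P : probability Omega R) (I : eqType)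
    (E : I -> set Omega) : Prop :=
  forall s : seq I, uniq s ->
    fine (P (\bigcap_(i in [set` s]) E i)) = \prod_(i <- s) fine (P (E i)).

Definition mutually_independent d (Omega : measurableType d)
    (R : realType) (P : probability Omega R) (I : eqType)
    (X : I -> Omega -> bool) : Prop :=
  forall B : I -> set bool,
    mutually_independent_events P (fun i => X i @^-1` B i).

Definition iid_Be d (Omega : measurableType d) (R : realType)
    (P : probability Omega R) (p : R) (n : nat)
    (X : 'I_n -> nat -> {RV P >-> bool}) : Prop :=
  (forall i j, P [set w | X i j w = true] = p%:E) /\
  mutually_independent P (fun (ij : 'I_n * nat) => X ij.1 ij.2 : Omega -> bool).

Definition cprob d (Omega : measurableType d) (R : realType)
    (P : probability Omega R) (A B : set Omega) : R :=
  fine (P (A `&` B)) / fine (P B).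

(* Conditional probability of A given a random variable Y with countably many
   values, as a random variable; it is 0 where P (Y = Y w) = 0. *)
Definition cprob_given d (Omega : measurableType d) (R : realType)
    (P : probability Omega R) (A : set Omega) (U : Type) (Y : Omega -> U)
    (w : Omega) : R :=
  cprob P A [set w' | Y w' = Y w].

(* Conditionally on T, V is a uniformly random node of T. *)
Definition uniform_node d (Omega : measurableType d) (R : realType)
    (P : probability Omega R) (T : Omega -> btree) (V : Omega -> seq bool) :
    Prop :=
  (forall v, measurable [set w | V w = v]) /\
  (forall (T0 : btree) (v : seq bool), fringe T0 v <> None ->
    (0 < P [set w | T w = T0])%E ->
    cprob P [set w | V w = v] [set w | T w = T0] = (nnodes T0)%:R^-1).

Definition fringe_event (Omega : Type) (T : Omega -> btree)
    (V : Omega -> seq bool) (t : btree) : set Omega :=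
  [set w | fringe (T w) (V w) = Some t].

(* Convergence in probability to a constant; the variables may live on
   different probability spaces. *)
Definition cvg_in_prob (R : realType) (d : nat -> measure_display)
    (Omega : forall n, measurableType (d n))
    (P : forall n, probability (Omega n) R)
    (Y : forall n, Omega n -> R) (c : R) : Prop :=
  forall e : R, 0 < e ->
    (fun n => P n [set w | e < `|Y n w - c|]) @ \oo --> 0%E.

(** ** Constants and functions *)

Local Open Scope complex_scope.

Section Functions.
Variable R : realType.

Definition cmod (z : R[i]) : R := ComplexField.Normc.normc z.

Definition cexpi (x : R) : R[i] := cos x +i* sin x.

(* x ^ z for x > 0 *)
Definition cpow (x : R) (z : R[i]) : R[i] :=
  (x `^ complex.Re z)%:C * cexpi (complex.Im z * ln x).

(* Euler's integral, for z with positive real part. *)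
Definition cGamma (z : R[i]) : R[i] :=
  let f x := cpow x (z - 1) * (expR (- x))%:C in
  (\int[lebesgue_measure]_(x in `]0, +oo[) complex.Re (f x)) +i*
  (\int[lebesgue_measure]_(x in `]0, +oo[) complex.Im (f x)).

Definition cseries (u : nat -> R[i]) : R[i] :=
  limn (series (fun n => complex.Re (u n))) +i*
  limn (series (fun n => complex.Im (u n))).

(* The two halves are summed separately, so that convergence is not merely that
   of the symmetric partial sums. *)
Definition csumZ (u : int -> R[i]) : R[i] :=
  u 0 + cseries (fun n => u (Posz n.+1)) + cseries (fun n => u (- Posz n.+1)).

Definition entropy (p : R) : R := - p * ln p - (1 - p) * ln (1 - p).

(* Here and in [psiE], c stands for pi_t and m for the number of leaves of t. *)
Definition fE (c : R) (m : nat) (s : R[i]) : R[i] :=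
  c%:C * cGamma (m%:R + s) / (m`!)%:R.

Definition log_ratio_rational (p : R) : Prop :=
  exists r : rat, ln p / ln (1 - p) = ratr r.

(* The numerator of the ratio in lowest terms is a; it is positive when
   0 < p < 1. *)
Definition psiE (p c : R) (m : nat) (x : R) : R[i] :=
  if pselect (log_ratio_rational p) is left h then
    let a : R := (numq (sval (cid h)))%:~R in
    let d := - ln p / a in
    csumZ (fun k => fE c m (- 1 - (2 * pi * k%:~R / d)%:C * 'i)
                    * cexpi (2 * pi * k%:~R * x / d))
  else fE c m (- 1).

End Functions.

(* The definition does not depend on how the m random strings are realised. *)
Definition pi_t d (Omega : measurableType d) (R : realType)
    (P : probability Omega R) (m : nat) (X : 'I_m -> nat -> {RV P >-> bool})
    (t : btree) : R :=
  fine (P [set w | precompressions t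
    (random_trie (fun i j => X i j : Omega -> bool) w)]).

(* Main.v *)
Require Import Defs.
From HB Require Import structures.
From mathcomp Require Import all_boot all_order all_algebra.
From mathcomp Require Import complex.
From mathcomp Require Import all_classical all_reals all_analysis.
From mathcomp Require Import zify ring lra.
Set Implicit Arguments.
Unset Strict Implicit.
Unset Printing Implicit Defensive.
Import Order.TTheory GRing.Theory Num.Theory.
Import numFieldNormedType.Exports.
Local Open Scope classical_set_scope.
Local Open Scope ring_scope.
Local Open Scope complex_scope.

(* Given the trie, P(fringe tree = t) is the number of copies of t divided by
   the number 2n - 1 of nodes. A copy of t corresponds to a binary word alpha
   such that the strings beginning with alpha are m in number and form a trie in
   the class of t. Replacing one of the n strings changes the number of copies by
   a bounded amount, so by the Efron-Stein inequality and Chebyshev's inequality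
   it suffices to treat the mean. Everything is computed on the first K letters,
   with K -> oo: the strings coincide there with probability at most n^2 rho^K,
   rho = p^2 + q^2.

   The mean is the sum over alpha of pi_t times a binomial probability with
   parameter P(alpha), which is asymptotically pi_t n / m! times
   Z(log n), Z(x) = sum_alpha P(alpha) g(x + log P(alpha)) with
   g(x) = exp((m-1) x - e^x). This Z solves the renewal equation
   Z(x) = g(x) + p Z(x + log p) + q Z(x + log q). An energy estimate gives
   Z(x + log p) - Z(x + log q) -> 0, so the set of h with Z(x) - Z(x + h) -> 0 is
   a subgroup containing log p and log q: it is dense in the aperiodic case, where
   H Z tends to the integral of g, and contains d in the periodic case, where H Z
   is asymptotic to d sum_k g(x - k d). Poisson summation, proved with the Fejer
   kernel, turns the latter into the Fourier series defining psi. *)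

(** The limits are taken in this order: K -> oo with n fixed, which removes collisions and
    truncation, then n -> oo. At finite K every expectation is a nested average over finitely many
    bits, so measure theory enters only when such averages are translated into events. The 2 in
    1/(2H) comes from the 2n - 1 nodes, H is the mean length of a step of the walk, and the integral
    of g is Gamma(m - 1) = (m - 2)!, whence (m - 2)!/m! = 1/(m(m - 1)). The energy estimate rests on
    strict convexity: p u^2 + q v^2 exceeds (p u + q v)^2 by pq (u - v)^2, so energy is dissipated
    unless Z(x + log p) and Z(x + log q) agree. Integrals over the line are handled through
    primitives bounded by a multiple of e^x; this decay at -oo fixes the constant of integration. In
    the analytic part the tree has [m.+2] leaves, so that g is [expE m.+1] and no truncated
    subtraction appears. *)

Section SequenceLimits.
Context {R : realType}.

Lemma cvgnP (u : nat -> R) (l : R) : u @ \oo --> l <->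
  forall e, 0 < e -> exists N, forall n, (N <= n)%N -> `|u n - l| < e.
Proof.
split=> [/cvgrPdist_lt h e e0|h].
  by have [N _ hN] := h e e0; exists N => n Nn; rewrite distrC; exact: hN.
apply/cvgrPdist_lt => e e0; have [N hN] := h e e0.
by exists N => // n /= Nn; rewrite distrC; exact: hN.
Qed.

Lemma cvg0_le (u : nat -> R) (x : R) : u @ \oo --> (0 : R) ->
  (forall n, x <= u n) -> x <= 0.
Proof.
move=> /cvgnP h hx; rewrite leNgt; apply/negP => /h [N /(_ N (leqnn N))].
rewrite subr0 ltr_norml => /andP[_]; by rewrite ltNge hx.
Qed.

End SequenceLimits.

(** * Expectations over random words *)

Section BernoulliStrings.
Context {R : realType}.
Implicit Types (p x y c : R) (n m K : nat).

Definition pbit p (b : bool) : R := if b then p else 1 - p.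

(** A nested average rather than an integral, so that it computes by recursion on the letters;
    [Pr_truncs] later identifies such averages with probabilities. *)
Fixpoint Eword p K (phi : seq bool -> R) : R :=
  if K is K'.+1 then
    (1 - p) * Eword p K' (fun s => phi (false :: s)) +
    p * Eword p K' (fun s => phi (true :: s))
  else phi [::].

Fixpoint Estrs p n K (phi : seq (seq bool) -> R) : R :=
  if n is n'.+1 then Eword p K (fun s => Estrs p n' K (fun S => phi (s :: S)))
  else phi [::].

Definition wordsK K (S : seq (seq bool)) : bool := all (fun s => size s == K) S.

Lemma eq_Eword p K phi psi : (forall s, size s = K -> phi s = psi s) ->
  Eword p K phi = Eword p K psi.
Proof.
elim: K phi psi => [|K IH] phi psi h /=; first exact: h.
by congr (_ * _ + _ * _); apply: IH => s hs; apply: h; rewrite /= hs.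
Qed.

Lemma Eword_lin p K x phi psi :
  Eword p K (fun s => x * phi s + psi s) = x * Eword p K phi + Eword p K psi.
Proof. by elim: K phi psi => [|K IH] phi psi //=; rewrite !IH; ring. Qed.

Lemma Eword_cst p K x : Eword p K (fun=> x) = x.
Proof. by elim: K => [|K IH] //=; rewrite IH; ring. Qed.

Lemma EwordD p K phi psi :
  Eword p K (fun s => phi s + psi s) = Eword p K phi + Eword p K psi.
Proof.
rewrite -[Eword p K phi]mul1r -Eword_lin; apply: eq_Eword => s _.
by rewrite mul1r.
Qed.

Lemma EwordZ p K x phi : Eword p K (fun s => x * phi s) = x * Eword p K phi.
Proof.
rewrite -[RHS]addr0 -(Eword_cst p K 0) -Eword_lin.
by apply: eq_Eword => s _; rewrite addr0.
Qed.

Lemma EwordB p K phi psi :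
  Eword p K (fun s => phi s - psi s) = Eword p K phi - Eword p K psi.
Proof.
rewrite addrC -[- Eword _ _ _]mulN1r -Eword_lin; apply: eq_Eword => s _.
by rewrite mulN1r addrC.
Qed.

Lemma le_Eword p K phi psi : 0 <= p <= 1 ->
  (forall s, size s = K -> phi s <= psi s) -> Eword p K phi <= Eword p K psi.
Proof.
move=> /andP[p0 p1]; elim: K phi psi => [|K IH] phi psi h /=; first exact: h.
by apply: lerD; (apply: ler_wpM2l; first lra); apply: IH => s hs;
  apply: h; rewrite /= hs.
Qed.

Lemma Eword_cat p K L phi :
  Eword p (K + L) phi = Eword p K (fun s => Eword p L (fun s' => phi (s ++ s'))).
Proof. by elim: K phi => [|K IH] phi //=; rewrite !IH. Qed.

Lemma eq_Estrs p n K phi psi :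
  (forall S, size S = n -> wordsK K S -> phi S = psi S) ->
  Estrs p n K phi = Estrs p n K psi.
Proof.
elim: n phi psi => [|n IH] phi psi h /=; first exact: h.
apply: eq_Eword => s hs; apply: IH => S hS wS; apply: h; first by rewrite /= hS.
by rewrite /= hs eqxx.
Qed.

Lemma Estrs_lin p n K x phi psi :
  Estrs p n K (fun S => x * phi S + psi S) =
  x * Estrs p n K phi + Estrs p n K psi.
Proof.
elim: n phi psi => [|n IH] phi psi //=; rewrite -Eword_lin.
by apply: eq_Eword => s _; rewrite IH.
Qed.

Lemma Estrs_cst p n K x : Estrs p n K (fun=> x) = x.
Proof.
elim: n => [|n IH] //=; rewrite -[RHS](Eword_cst p K).
by apply: eq_Eword => s _; rewrite IH.
Qed.

Lemma EstrsD p n K phi psi :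
  Estrs p n K (fun S => phi S + psi S) = Estrs p n K phi + Estrs p n K psi.
Proof.
rewrite -[Estrs p n K phi]mul1r -Estrs_lin; apply: eq_Estrs => S _ _.
by rewrite mul1r.
Qed.

Lemma EstrsZ p n K x phi :
  Estrs p n K (fun S => x * phi S) = x * Estrs p n K phi.
Proof.
rewrite -[RHS]addr0 -(Estrs_cst p n K 0) -Estrs_lin.
by apply: eq_Estrs => s _ _; rewrite addr0.
Qed.

Lemma EstrsB p n K phi psi :
  Estrs p n K (fun S => phi S - psi S) = Estrs p n K phi - Estrs p n K psi.
Proof.
rewrite addrC -[- Estrs _ _ _ _]mulN1r -Estrs_lin; apply: eq_Estrs => s _ _.
by rewrite mulN1r addrC.
Qed.

Lemma le_Estrs p n K phi psi : 0 <= p <= 1 ->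
  (forall S, size S = n -> wordsK K S -> phi S <= psi S) ->
  Estrs p n K phi <= Estrs p n K psi.
Proof.
move=> p01; elim: n phi psi => [|n IH] phi psi h /=; first exact: h.
apply: le_Eword => // s hs; apply: IH => S hS wS; apply: h.
  by rewrite /= hS.
by rewrite /= hs eqxx.
Qed.

(** Concatenating the n words gives a single word of independent bits, the form in which [Pr_bits]
    delivers a probability. *)
Lemma Estrs_words p n K phi :
  Estrs p n K phi = Eword p (n * K) (fun s => phi (reshape (nseq n K) s)).
Proof.
elim: n phi => [|n IH] phi //=; rewrite mulSn Eword_cat.
apply: eq_Eword => s hs; rewrite IH; apply: eq_Eword => s' hs'.
by rewrite take_size_cat // drop_size_cat.
Qed.

(* The Efron-Stein bound: peel off one string, Var f = E Var(f | s) + Var E(f | s). *)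
Lemma variance_bounded_differences p n K phi c : 0 <= p <= 1 ->
  (forall S1 S2 s s', wordsK K (S1 ++ S2) -> size s = K -> size s' = K ->
     `|phi (S1 ++ s :: S2) - phi (S1 ++ s' :: S2)| <= c) ->
  Estrs p n K (fun S => (phi S - Estrs p n K phi) ^+ 2) <= n%:R * c ^+ 2.
Proof.
move=> p01; elim: n phi => [|n IH] phi lip.
  by rewrite /= subrr expr0n mul0r.
set ev := Estrs p n.+1 K phi.
pose h s := Estrs p n K (fun S => phi (s :: S)).
have c0 : 0 <= c.
  apply: le_trans (lip [::] [::] (nseq K true) (nseq K true) isT _ _) => //;
  by rewrite size_nseq.
have hlip s s' : size s = K -> size s' = K -> `|h s - h s'| <= c.
  move=> hs hs'; rewrite /h -EstrsB ler_norml.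
  rewrite -{1}(Estrs_cst p n K (- c)) -[X in _ && (_ <= X)](Estrs_cst p n K c).
  apply/andP; split; apply: le_Estrs => // S _ wS;
    by move: (lip [::] S s s' wS hs hs'); rewrite ler_norml => /andP[].
(* [ev] is the average of [h] over an independent word, so [h s - ev] is an average of differences
   bounded by [hlip]. *)
have hev s : size s = K -> (h s - ev) ^+ 2 <= c ^+ 2.
  move=> hs; rewrite -[leRHS]ger0_norm ?sqr_ge0// -[leLHS]ger0_norm ?sqr_ge0//.
  rewrite !normrX ler_pXn2r ?nnegrE ?normr_ge0// (ger0_norm c0).
  rewrite -(Eword_cst p K (h s)) -EwordB ler_norml.
  rewrite -{1}(Eword_cst p K (- c)) -[X in _ && (_ <= X)](Eword_cst p K c).
  by apply/andP; split; apply: le_Eword => // s' hs';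
    move: (hlip s s' hs hs'); rewrite ler_norml => /andP[].
change (Eword p K (fun s => Estrs p n K (fun S => (phi (s :: S) - ev) ^+ 2))
  <= n.+1%:R * c ^+ 2).
rewrite -(Eword_cst p K (n.+1%:R * c ^+ 2)); apply: le_Eword => // s hs.
(* The cross term vanishes because [h s] is the mean of [phi (s :: _)]. *)
have -> : Estrs p n K (fun S => (phi (s :: S) - ev) ^+ 2) =
   Estrs p n K (fun S => (phi (s :: S) - h s) ^+ 2) + (h s - ev) ^+ 2.
  transitivity (Estrs p n K (fun S => (phi (s :: S) - h s) ^+ 2 +
     ((2 * (h s - ev)) * (phi (s :: S) - h s) + (h s - ev) ^+ 2))).
    by apply: eq_Estrs => S _ _; ring.
  rewrite EstrsD Estrs_lin Estrs_cst EstrsB Estrs_cst -/(h s); ring.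
rewrite -natr1 mulrDl mul1r lerD ?hev//; apply: IH => S1 S2 u u' w hu hu'.
by apply: (lip (s :: S1)) => //=; rewrite hs eqxx.
Qed.

Lemma chebyshev_Estrs p n K phi c v (e : R) : 0 <= p <= 1 -> 0 < e ->
  Estrs p n K (fun S => (phi S - c) ^+ 2) <= v ->
  Estrs p n K (fun S => (e < `|phi S - c|)%R%:R) <= v / e ^+ 2.
Proof.
move=> p01 e0 hv; rewrite ler_pdivlMr ?exprn_gt0// mulrC -EstrsZ.
apply: le_trans hv; apply: le_Estrs => // S _ _.
case: ltP => h; last by rewrite mulr0 sqr_ge0.
by rewrite mulr1 -[leRHS]ger0_norm ?sqr_ge0// normrX lerXn2r// ?nnegrE ltW.
Qed.

(* Binomial thinning: the strings passing through a node of probability x. *)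
Fixpoint Ethin p n x K (phi : seq (seq bool) -> R) : R :=
  if n is n'.+1 then
    x * Eword p K (fun s => Ethin p n' x K (fun S => phi (s :: S))) +
    (1 - x) * Ethin p n' x K phi
  else phi [::].

Lemma eq_Ethin p n x K phi psi :
  (forall S, wordsK K S -> phi S = psi S) ->
  Ethin p n x K phi = Ethin p n x K psi.
Proof.
elim: n phi psi => [|n IH] phi psi h /=; first exact: h.
congr (_ * _ + _ * _); last exact: IH.
by apply: eq_Eword => s hs; apply: IH => S wS; apply: h; rewrite /= hs eqxx.
Qed.

Lemma Ethin1 p n K phi : Ethin p n 1 K phi = Estrs p n K phi.
Proof.
elim: n phi => [|n IH] phi //=; rewrite subrr mul0r addr0 mul1r.
by apply: eq_Eword => s _; rewrite IH.
Qed.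

Lemma EthinD p n x K phi psi :
  Ethin p n x K (fun S => phi S + psi S) =
  Ethin p n x K phi + Ethin p n x K psi.
Proof.
elim: n phi psi => [|n IH] phi psi //=; rewrite IH.
under eq_Eword do rewrite IH.
rewrite EwordD; ring.
Qed.

Definition brw (b : bool) (S : seq (seq bool)) : seq (seq bool) :=
  [seq behead s | s <- S & head false s == b].

(** A string reaches child [b] iff it is retained and starts with [b]; the two independent
    selections compose into one with the product probability. *)
Lemma Ethin_brw p n x K b phi :
  Ethin p n x K.+1 (fun S => phi (brw b S)) = Ethin p n (x * pbit p b) K phi.
Proof.
elim: n phi => [|n IH] phi //=.
have keep : Eword p K (fun s => Ethin p n x K.+1 (fun S => phi (s :: brw b S)))
    = Eword p K (fun s => Ethin p n (x * pbit p b) K (fun S => phi (s :: S))).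
  by apply: eq_Eword => s _; rewrite -IH.
have drop : Eword p K (fun=> Ethin p n x K.+1 (fun S => phi (brw b S))) =
    Ethin p n (x * pbit p b) K phi by rewrite Eword_cst IH.
by case: b IH keep drop => IH keep drop;
  rewrite /brw /= -/(brw _ _) in keep drop *; rewrite keep drop IH /pbit; ring.
Qed.

(** The number of retained strings is binomial, and given this number they are again independent
    random words; only the value m contributes. *)
Lemma Ethin_supp p n m x K phi :
  (forall S, size S != m -> phi S = 0) ->
  Ethin p n x K phi =
  'C(n, m)%:R * x ^+ m * (1 - x) ^+ (n - m) * Estrs p m K phi.
Proof.
elim: n m phi => [|n IH] [|m] phi h /=.
- by rewrite bin0 !expr0; ring.
- by rewrite bin0n !mul0r h.
- rewrite bin0 expr0 mul1r subn0.
  have -> : Eword p K (fun s => Ethin p n x K (fun S => phi (s :: S))) = 0.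
    rewrite -[RHS](Eword_cst p K); apply: eq_Eword => s _.
    rewrite (IH 0%N); last by move=> S _; apply: h.
    by rewrite /= h ?mulr0.
  by rewrite mulr0 add0r (IH 0%N) // bin0 expr0 mul1r subn0 exprS /=; ring.
- have -> : Eword p K (fun s => Ethin p n x K (fun S => phi (s :: S))) =
    'C(n, m)%:R * x ^+ m * (1 - x) ^+ (n - m) * Estrs p m.+1 K phi.
    rewrite -EwordZ; apply: eq_Eword => s _.
    by rewrite (IH m) // => S hS; apply: h.
  rewrite (IH m.+1) // binS natrD subSS /= exprS.
  case: (ltnP m n) => hmn.
    have -> : (n - m = (n - m.+1).+1)%N by lia.
    by rewrite exprS; ring.
  by rewrite (@bin_small n m.+1) //; ring.
Qed.

(** Two independent letters agree with probability p^2 + (1 - p)^2, and the K places are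
    independent. *)
Lemma Eword_collision p K :
  Eword p K (fun s => Eword p K (fun s' => (s == s')%:R)) =
    (p ^+ 2 + (1 - p) ^+ 2) ^+ K.
Proof.
elim: K => [|K IH] //=; rewrite exprS -IH.
under eq_Eword do rewrite Eword_cst mulr0 addr0.
under [X in _ + p * X]eq_Eword do rewrite Eword_cst mulr0 add0r.
rewrite !EwordZ; under [X in p * (p * X)]eq_Eword => s _ do
  under eq_Eword => s'' _ do rewrite eqseq_cons /=.
under [X in (1 - p) * (_ * X)]eq_Eword => s _ do
  under eq_Eword => s'' _ do rewrite eqseq_cons /=.
ring.
Qed.

Lemma Estrs_not_uniq p n K : 0 <= p <= 1 ->
  Estrs p n K (fun S => (~~ uniq S)%:R) <=
  n%:R ^+ 2 * (p ^+ 2 + (1 - p) ^+ 2) ^+ K.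
Proof.
move=> p01; set rho := _ + _.
have rho0 : 0 <= rho by rewrite addr_ge0 ?sqr_ge0.
(* Union bound for a new word against k earlier ones; over all words this makes fewer than n^2
   pairs. *)
have hmem k : Eword p K (fun s => Estrs p k K (fun S => (s \in S)%:R)) <=
    k%:R * rho ^+ K.
  elim: k => [|k IH]; first by rewrite mul0r Eword_cst.
  apply: (@le_trans _ _ (Eword p K (fun s => Eword p K (fun s' => (s == s')%:R)
     + Estrs p k K (fun S => (s \in S)%:R)))).
    apply: le_Eword => // s _ /=.
    rewrite -[X in _ + X](Eword_cst p K) -EwordD; apply: le_Eword => // s' _.
    rewrite -[X in X + _](Estrs_cst p k K) -EstrsD; apply: le_Estrs => // S _ _.
    by rewrite in_cons; case: (s == s'); case: (s \in S); rewrite /= ?addr0 ?add0r ?lerDl.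
  rewrite EwordD Eword_collision -natr1 mulrDl mul1r addrC; exact: lerD.
elim: n => [|n IH]; first by rewrite /= expr0n mul0r.
apply: (@le_trans _ _ (Eword p K (fun s => Estrs p n K (fun S => (s \in S)%:R)
     + Estrs p n K (fun S => (~~ uniq S)%:R)))).
  apply: le_Eword => // s _.
  rewrite -EstrsD; apply: le_Estrs => // S _ _ /=.
  by case: (s \in S); case: (uniq S); rewrite /= ?addr0 ?add0r ?lerDl.
rewrite EwordD Eword_cst; apply: le_trans (lerD (hmem n) IH) _.
rewrite -mulrDl ler_wpM2r ?exprn_ge0// -!natrX -natrD ler_nat; nia.
Qed.

End BernoulliStrings.

(** * Binary trees *)

Fixpoint occ (t T : btree) : nat :=
  let: Node l r := T in
  (`[< T = t >] + oapp (occ t) 0 l + oapp (occ t) 0 r)%N.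

(* The nodes of [T] that become the root of a copy of [t] in [compress T]. *)
Fixpoint preocc (t T : btree) : nat :=
  let: Node l r := T in
  (`[< precompressions t T >] + oapp (preocc t) 0 l + oapp (preocc t) 0 r)%N.

(** Induction that reaches the children through [option]. *)
Lemma btree_rect2 (Q : btree -> Prop) :
  (forall l r, (if l is Some x then Q x else True) ->
     (if r is Some x then Q x else True) -> Q (Node l r)) ->
  forall T, Q T.
Proof.
move=> h; fix F 1; case=> l r; apply: h.
  by case: l => [x|] //; exact: F.
by case: r => [x|] //; exact: F.
Qed.

(** A node of outdegree 1 fails [precompressions] and disappears in [compress]; at every other node
    the two counts test the same equation. *)
Lemma occ_compress t T : occ t (compress T) = preocc t T.
Proof.
elim/btree_rect2: T => -[l|] [r|] /=.
- move=> -> ->; congr (_ + _ + _)%N; congr nat_of_bool; apply/asbool_equiv_eq.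
  by split=> [<-|[]].
- move=> -> _; rewrite addn0 -[LHS]add0n; congr (_ + _)%N.
  by rewrite asboolF // => -[].
- move=> _ ->; rewrite addn0 -[LHS]add0n; congr (_ + _)%N.
  by rewrite asboolF // => -[].
- by move=> _ _; congr (_ + _ + _)%N; congr nat_of_bool; apply/asbool_equiv_eq;
    split=> [<-|[]].
Qed.

Lemma compress_full T : full (compress T).
Proof. by elim/btree_rect2: T => -[l|] [r|] //= -> ->. Qed.

Lemma nleaves_compress T : nleaves (compress T) = nleaves T.
Proof.
elim/btree_rect2: T => -[l|] [r|] //= ; first by move=> -> ->.
  by move=> -> _; rewrite addn0.
Qed.

Lemma nnodes_full T : full T -> (nnodes T).+1 = (2 * nleaves T)%N.
Proof. elim/btree_rect2: T => -[l|] [r|] //= hl hr /andP[/hl + /hr]; lia. Qed.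

Lemma occ_bullet T : full T -> occ bullet T = nleaves T.
Proof.
elim/btree_rect2: T => -[l|] [r|] //=.
  by move=> hl hr /andP[/hl -> /hr ->]; rewrite asboolF.
by move=> _ _ _; rewrite asboolT.
Qed.

Fixpoint nodes (T : btree) : seq (seq bool) :=
  let: Node l r := T in
  [::] :: [seq false :: v | v <- oapp nodes [::] l] ++
          [seq true :: v | v <- oapp nodes [::] r].

Lemma nodes_uniq T : uniq (nodes T).
Proof.
elim/btree_rect2: T => l r hl hr /=.
have inj b : injective (cons b : seq bool -> seq bool) by move=> x y [].
apply/andP; split.
  by rewrite mem_cat negb_or; apply/andP; split; apply/mapP => -[].
rewrite cat_uniq !map_inj_uniq //.
apply/and3P; split; first by case: l hl.
  by apply/hasP => -[x /mapP[y _ ->] /mapP[z _ ]].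
by case: r hr.
Qed.

Lemma mem_nodes T v : (v \in nodes T) = isSome (fringe T v).
Proof.
have inj b : injective (cons b : seq bool -> seq bool) by move=> x y [].
elim: v T => [|b v IH] [l r] //=; rewrite in_cons /= mem_cat.
have no c c' (s : seq (seq bool)) : c != c' ->
    (c :: v \in [seq c' :: w | w <- s]) = false.
  by move=> cc; apply/negbTE/mapP => -[w _ [e _]]; rewrite e eqxx in cc.
case: b; rewrite mem_map // no //= ?orbF.
  by case: r => [r|] //=; rewrite IH.
by case: l => [l|] //=; rewrite IH.
Qed.

Lemma size_nodes T : size (nodes T) = nnodes T.
Proof.
elim/btree_rect2: T => l r hl hr /=; rewrite size_cat !size_map; congr (_ + _).+1.
  by case: l hl.
by case: r hr.
Qed.

(** Turns the number of copies into a number of node positions, which is what a uniformly random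
    node sees. *)
Lemma count_fringe t T :
  count (fun v => `[< fringe T v = Some t >]) (nodes T) = occ t T.
Proof.
elim/btree_rect2: T => l r hl hr; rewrite /= count_cat !count_map addnA.
congr (_ + _ + _)%N.
- by congr nat_of_bool; apply/asbool_equiv_eq; split=> [[]|->].
- case: l hl => [x|] //= <-; exact: eq_count.
- case: r hr => [x|] //= <-; exact: eq_count.
Qed.

(** * Tries of finitely many letters *)

(* [Some bullet] is a junk value for words that coincide. *)
Fixpoint trieK (K : nat) (S : seq (seq bool)) : option btree :=
  match S with
  | [::] => None
  | [:: _] => Some bullet
  | _ => if K is K'.+1 then
           Some (Node (trieK K' (brw false S)) (trieK K' (brw true S)))
         else Some bullet
  end.

Lemma trieK_node K S : (1 < size S)%N ->
  trieK K.+1 S = Some (Node (trieK K (brw false S)) (trieK K (brw true S))).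
Proof. by case: S => [|s [|s' S]]. Qed.

Lemma trieK0 K : trieK K [::] = None. Proof. by case: K. Qed.

Lemma brw_cat b S1 S2 : brw b (S1 ++ S2) = brw b S1 ++ brw b S2.
Proof. by rewrite /brw filter_cat map_cat. Qed.

Lemma size_brw S : (size (brw false S) + size (brw true S))%N = size S.
Proof.
elim: S => [|s S IH] //=; rewrite -IH /brw /=.
by case: (head false s) => /=; rewrite ?addnS.
Qed.

Lemma wordsK_brw K b S : wordsK K.+1 S -> wordsK K (brw b S).
Proof.
move=> /allP h; apply/allP => s /mapP[u]; rewrite mem_filter => /andP[_ /h].
by case: u => //= c u + ->.
Qed.

Lemma uniq_brw K b S : wordsK K.+1 S -> uniq S -> uniq (brw b S).
Proof.
move=> /allP h u; rewrite map_inj_in_uniq ?filter_uniq // => s s'.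
rewrite !mem_filter => /andP[/eqP hs /h] + /andP[/eqP hs' /h].
by case: s hs => //= c s ->; case: s' hs' => //= c' s' -> _ _ ->.
Qed.

Lemma uniq_of_brw K S : wordsK K.+1 S ->
  uniq (brw false S) -> uniq (brw true S) -> uniq S.
Proof.
elim: S => [|[|c s] S IH] //= /andP[_ w].
have nin b : s \notin brw b S -> b :: s \notin S.
  by apply: contra => h; apply/mapP; exists (b :: s); rewrite // mem_filter /= eqxx.
by case: c; rewrite /brw /= -!/(brw _ _);
  [move=> u0 /andP[/nin -> u1] | move=> /andP[/nin -> u0] u1]; apply: IH.
Qed.

(* The indicator that the whole trie is a copy of [t]; the size condition
   excludes the junk value of [trieK]. *)
Definition okK (t : btree) (K : nat) (S : seq (seq bool)) : bool :=
  (size S == nleaves t) &&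
  (if trieK K S is Some T then `[< precompressions t T >] else false).

(** One test for each word of length at most K, also below the leaves of the trie, where too few
    strings are left for [okK] to hold once t has two leaves. The count thus splits additively over
    the two branches. *)
Fixpoint occK (t : btree) (K : nat) (S : seq (seq bool)) : nat :=
  (okK t K S +
   if K is K'.+1 then occK t K' (brw false S) + occK t K' (brw true S) else 0)%N.

Section OccK.
Variables (t : btree) (ht : (1 < nleaves t)%N).

Lemma precompressions_binary T : precompressions t T ->
  exists l r, T = Node (Some l) (Some r).
Proof.
case: T => -[l|] [r|] [] //= e _; first by exists l, r.
by move: ht; rewrite -e.
Qed.

(** Copies of t use disjoint groups of [nleaves t] strings: a copy at the root sends strings to both
    children, so neither child keeps enough for a copy of its own. *)
Lemma occK_size K S : (nleaves t * occK t K S <= size S)%N.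
Proof.
elim: K S => [|K IH] S /=.
  rewrite /okK; case: eqP => [<-|] /=; last by rewrite muln0.
  by rewrite addn0 -[leqRHS]muln1 leq_mul2l leq_b1 orbT.
move: (IH (brw false S)) (IH (brw true S)) (size_brw S).
case: (boolP (okK t K.+1 S)) => [|_] /=; last by nia.
rewrite /okK => /andP[/eqP hS]; rewrite trieK_node ?hS //.
move=> /asboolP /precompressions_binary [l [r [hl hr]]] h1 h2 h3.
have n0 : (0 < size (brw false S))%N.
  by case E : (brw false S) hl => //; rewrite trieK0.
have n1 : (0 < size (brw true S))%N.
  by case E : (brw true S) hr => //; rewrite trieK0.
have z x y : (nleaves t * x <= y -> y < nleaves t -> x = 0)%N.
  by case: x => // x; rewrite mulnS; lia.
rewrite (z _ _ h1) ?(z _ _ h2); lia.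
Qed.

(** Only nodes on the path of s are affected. While more than m = [nleaves t] other strings are
    present, the node is no copy, with or without s. As soon as at most m remain, [occK_size] allows
    at most one copy from there on, since m + 1 < 2m. *)
Lemma occK_insert K S1 s S2 :
  (occK t K (S1 ++ S2) <= (occK t K (S1 ++ s :: S2)).+1)%N /\
  (occK t K (S1 ++ s :: S2) <= (occK t K (S1 ++ S2)).+1)%N.
Proof.
have small k (S : seq (seq bool)) : (size S <= (nleaves t).+1)%N ->
    (occK t k S <= 1)%N.
  by move=> h; move: (occK_size k S); nia.
elim: K S1 s S2 => [|K IH] S1 s S2.
  by rewrite /=; case: (okK _ _ _); case: (okK _ _ _).
have hs : (size (S1 ++ s :: S2) = (size (S1 ++ S2)).+1)%N.
  by rewrite !size_cat /= addnS.
have [le_m|gt_m] := leqP (size (S1 ++ S2)) (nleaves t).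
  have := small K.+1 (S1 ++ S2) (leqW le_m).
  have := small K.+1 (S1 ++ s :: S2); rewrite hs => /(_ le_m); lia.
have nok (S : seq (seq bool)) : (nleaves t < size S)%N -> okK t K.+1 S = false.
  by move=> h; rewrite /okK gtn_eqF.
rewrite /= !nok ?hs ?(leqW gt_m) //= !add0n !brw_cat.
have hbr b : brw b (s :: S2) =
    if head false s == b then behead s :: brw b S2 else brw b S2.
  by rewrite /brw /=; case: (_ == _).
rewrite !hbr.
case: (head false s) => /=.
  have := IH (brw true S1) (behead s) (brw true S2); lia.
have := IH (brw false S1) (behead s) (brw false S2); lia.
Qed.

(** A deletion and an insertion; this is the difference bound 2 used for the variance. *)
Lemma occK_replace K S1 s s' S2 :
  (occK t K (S1 ++ s :: S2) <= (occK t K (S1 ++ s' :: S2)).+2)%N.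
Proof.
have := occK_insert K S1 s S2; have := occK_insert K S1 s' S2; lia.
Qed.

End OccK.

Lemma nleaves_trieK K S : wordsK K S -> uniq S ->
  oapp nleaves 0%N (trieK K S) = size S.
Proof.
elim: K S => [|K IH] S w u.
  case: S w u => [|s [|s' S]] //= /and3P[/nilP -> /nilP -> _].
  by rewrite in_cons eqxx.
have [|lt1] := leqP (size S) 1; first by case: S w u => [|s [|]].
rewrite trieK_node //=.
have h0 := IH _ (wordsK_brw false w) (uniq_brw false w u).
have h1 := IH _ (wordsK_brw true w) (uniq_brw true w u).
rewrite -(size_brw S) -h0 -h1.
case E0 : (trieK K (brw false S)) h0 => [l|];
  case E1 : (trieK K (brw true S)) h1 => [r|] //= h1 h0.
by move: (size_brw S) lt1; rewrite -h0 -h1 => <-.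
Qed.

(** On distinct words the size test in [okK] is automatic: every string has its own leaf, and
    compression preserves the number of leaves. *)
Lemma occK_preocc t K S : wordsK K S -> uniq S -> (1 < nleaves t)%N ->
  occK t K S = oapp (preocc t) 0%N (trieK K S).
Proof.
move=> + + ht.
have npre : ~ precompressions t bullet.
  by move=> /(precompressions_binary ht) [l [r]].
elim: K S => [|K IH] S w u.
  rewrite /= /okK addn0; case: S w u => [|s [|s' S]] //=.
  - by rewrite andbF.
  - by rewrite asboolF ?andbF.
  - by case/and3P => /nilP -> /nilP -> _; rewrite in_cons eqxx.
have [|lt1] := leqP (size S) 1.
  have e : forall k, occK t k [::] = 0%N.
    by elim=> [|k IHk] /=; rewrite /okK trieK0 andbF //= IHk.
  move=> h; have -> : occK t K.+1 S = 0%N.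
    by have := occK_size ht K.+1 S; nia.
  case: S h w u => [|s [|]] //= _ _ _.
  by rewrite asboolF.
have := nleaves_trieK w u.
have -> : occK t K.+1 S =
  (okK t K.+1 S + (occK t K (brw false S) + occK t K (brw true S)))%N by [].
rewrite /okK trieK_node // => hn.
rewrite !IH ?wordsK_brw ?(uniq_brw _ w) // addnA.
rewrite [RHS]/= ; congr (_ + _ + _)%N.
congr nat_of_bool; apply/andP/idP => [[]//|h]; split=> //.
move: h hn => /asboolP [<- _] <-; rewrite nleaves_compress //=.
Qed.

(** * Tries of infinite strings *)

Definition truncs (K : nat) (S : seq (nat -> bool)) : seq (seq bool) :=
  [seq mkseq s K | s <- S].

Lemma wordsK_truncs K S : wordsK K (truncs K S).
Proof. by apply/allP => s /mapP[u _ ->]; rewrite size_mkseq. Qed.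

Lemma truncs_branch K b S : truncs K (branch b S) = brw b (truncs K.+1 S).
Proof.
elim: S => [|s S IH] //=; rewrite /branch /brw /=.
case: (s 0%N == b) => //=; rewrite -/(branch b S) -/(brw b (truncs K.+1 S)) -IH //.
congr (_ :: _); rewrite /mkseq -[1%N]addn0 iotaDl -map_comp.
by apply: eq_map.
Qed.

(** Distinct prefixes of length K stop the recursion before the letters run out, so the junk value
    of [trieK] is never reached. *)
Lemma is_trie_trieK K S : uniq (truncs K S) -> is_trie S (trieK K (truncs K S)).
Proof.
elim: K S => [|K IH] S u.
  case: S u => [|s [|s' S]] //= u; [exact: trie_empty|exact: trie_single].
have [|lt1] := leqP (size S) 1.
  by case: S u => [|s [|]] //= _ _; [exact: trie_empty|exact: trie_single].
rewrite trieK_node ?size_map // -!truncs_branch; apply: trie_split => //.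
  by apply: IH; rewrite truncs_branch (uniq_brw _ (wordsK_truncs _ _)).
by apply: IH; rewrite truncs_branch (uniq_brw _ (wordsK_truncs _ _)).
Qed.

Lemma is_trie_det S T T' : is_trie S T -> is_trie S T' -> T = T'.
Proof.
move=> h; elim: h T' => {S T} [T'|s T'|S T0 T1 lt1 _ IH0 _ IH1 T'] h.
- by inversion h.
- by inversion h.
inversion h; subst => //; congr (Some (Node _ _)); [exact: IH0|exact: IH1].
Qed.

Lemma uniq_truncs_mono K L S : (K <= L)%N -> uniq (truncs K S) ->
  uniq (truncs L S).
Proof.
move=> KL; elim: S => [|s S IH] //= /andP[nin /IH ->]; rewrite andbT.
apply: contra nin => /mapP[s' s'S e]; apply/mapP; exists s' => //.
have := congr1 (take K) e; rewrite /mkseq -!map_take !take_iota.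
by rewrite (minn_idPl KL).
Qed.

(** A trie is a finite derivation, so a finite prefix length separates its strings: the larger of
    the depths of the two branches, plus one for the letter read at the root. *)
Lemma is_trie_uniq S T : is_trie S T -> exists K, uniq (truncs K S).
Proof.
elim=> {S T} [|s|S T0 T1 _ _ [K0 u0] _ [K1 u1]]; [by exists 0%N|by exists 0%N|].
exists (maxn K0 K1).+1.
have {}u0 := uniq_truncs_mono (leq_maxl K0 K1) u0.
have {}u1 := uniq_truncs_mono (leq_maxr K0 K1) u1.
move: (maxn K0 K1) u0 u1 => K; rewrite !truncs_branch => u0 u1.
exact: uniq_of_brw (wordsK_truncs _ _) u0 u1.
Qed.

(** * Real-valued probabilities of events *)

Section Probabilities.
Context d (Omega : measurableType d) (R : realType) (P : probability Omega R).
Implicit Types A B : set Omega.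

Definition Pr A : R := fine (P A).

Lemma PrE A : measurable A -> P A = (Pr A)%:E.
Proof. by move=> mA; rewrite /Pr fineK // fin_num_measure. Qed.

Lemma PrT : Pr setT = 1.
Proof. by rewrite /Pr probability_setT. Qed.

Lemma Pr_ge0 A : 0 <= Pr A.
Proof. by rewrite /Pr fine_ge0. Qed.

Lemma le_Pr A B : measurable A -> measurable B -> A `<=` B -> Pr A <= Pr B.
Proof.
move=> mA mB AB; rewrite -lee_fin -!PrE //; apply: le_measure => //;
by rewrite inE.
Qed.

Lemma Pr_le1 A : measurable A -> Pr A <= 1.
Proof. by move=> mA; rewrite -PrT le_Pr. Qed.

Lemma PrU A B : measurable A -> measurable B -> A `&` B = set0 ->
  Pr (A `|` B) = Pr A + Pr B.
Proof.
move=> mA mB AB; rewrite /Pr measureU // fineD //; exact: fin_num_measure.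
Qed.

Lemma PrU_le A B : measurable A -> measurable B ->
  Pr (A `|` B) <= Pr A + Pr B.
Proof.
move=> mA mB; rewrite -lee_fin EFinD -!PrE //; last exact: measurableU.
exact: measureU2.
Qed.

Lemma Pr_split A B : measurable A -> measurable B ->
  Pr A = Pr (A `&` B) + Pr (A `&` ~` B).
Proof.
move=> mA mB; rewrite -PrU.
- by rewrite -setIUr setUv setIT.
- exact: measurableI.
- by apply: measurableI => //; exact: measurableC.
- by rewrite setIACA setIid setICr setI0.
Qed.

Lemma measurable_exists_seq (I : eqType) (s : seq I) (F : I -> set Omega) :
  (forall i, i \in s -> measurable (F i)) ->
  measurable [set w | exists2 i, i \in s & F i w].
Proof.
elim: s => [_|i s IH mF].
  by rewrite (_ : [set _ | _] = set0) //; apply/seteqP; split=> w // -[].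
rewrite (_ : [set _ | _] = F i `|` [set w | exists2 i, i \in s & F i w]).
  apply: measurableU; first by apply: mF; rewrite in_cons eqxx.
  by apply: IH => j hj; apply: mF; rewrite in_cons hj orbT.
apply/seteqP; split=> [w [j]|w [Fi|[j hj Fj]]].
- by rewrite in_cons => /orP[/eqP ->|hj] Fj; [left|right; exists j].
- by exists i; rewrite // in_cons eqxx.
- by exists j; rewrite // in_cons hj orbT.
Qed.

Lemma Pr_exists_seq (I : eqType) (s : seq I) (F : I -> set Omega) :
  uniq s -> (forall i, i \in s -> measurable (F i)) ->
  (forall i j w, F i w -> F j w -> i = j) ->
  Pr [set w | exists2 i, i \in s & F i w] = \sum_(i <- s) Pr (F i).
Proof.
move=> + + dF; elim: s => [_ _|i s IH /= /andP[nin u] mF].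
  rewrite big_nil (_ : [set _ | _] = set0) /Pr ?measure0 //.
  by apply/seteqP; split=> w // -[].
have mF' j : j \in s -> measurable (F j).
  by move=> hj; apply: mF; rewrite in_cons hj orbT.
rewrite big_cons -IH // -PrU //.
- congr Pr; apply/seteqP; split=> [w [j]|w [Fi|[j hj Fj]]].
  + by rewrite in_cons => /orP[/eqP ->|hj] Fj; [left|right; exists j].
  + by exists i; rewrite // in_cons eqxx.
  + by exists j; rewrite // in_cons hj orbT.
- by apply: mF; rewrite in_cons eqxx.
- exact: measurable_exists_seq.
- apply/seteqP; split=> [w [Fi [j hj Fj]]|//].
  by move: nin; rewrite (dF _ _ _ Fi Fj) hj.
Qed.

End Probabilities.

(** * The law of the prefixes and of the trie *)

Section RandomStrings.
Context d (Omega : measurableType d) (R : realType) (P : probability Omega R).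
Variables (p : R) (n : nat) (X : 'I_n -> nat -> {RV P >-> bool}).
Hypotheses (hp : 0 < p < 1) (hX : iid_Be p X).

Let p01 : 0 <= p <= 1. Proof. by case/andP: hp => /ltW -> /ltW ->. Qed.

Let bits (L : seq ('I_n * nat)) (w : Omega) : seq bool := [seq X ij.1 ij.2 w | ij <- L].

Lemma measurable_bit ij b : measurable [set w | X ij.1 ij.2 w = b].
Proof.
have mb : measurable [set b] by [].
by have := @measurable_funPT _ _ _ _ (X ij.1 ij.2) measurableT [set b] mb; rewrite setTI.
Qed.

Lemma measurable_bits L (A : set (seq bool)) : measurable [set w | A (bits L w)].
Proof.
elim: L A => [|ij L IH] A /=.
  have [h|h] := pselect (A [::]).
    by rewrite (_ : [set _ | _] = setT) //; apply/seteqP; split.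
  by rewrite (_ : [set _ | _] = set0) //; apply/seteqP; split.
rewrite (_ : [set _ | _] =
  ([set w | X ij.1 ij.2 w = true] `&` [set w | A (true :: bits L w)]) `|`
  ([set w | X ij.1 ij.2 w = false] `&` [set w | A (false :: bits L w)])).
  by apply: measurableU; apply: measurableI;
    [exact: measurable_bit|exact: (IH (fun s => A (true :: s)))
    |exact: measurable_bit|exact: (IH (fun s => A (false :: s)))].
apply/seteqP; split=> w /=.
  by case E : (X ij.1 ij.2 w) => h; [left|right].
by case=> -[->].
Qed.

Lemma Pr_bit ij b : Pr P [set w | X ij.1 ij.2 w = b] = pbit p b.
Proof.
have e : Pr P [set w | X ij.1 ij.2 w = true] = p by rewrite /Pr hX.1.
case: b => //; rewrite /= -e -(PrT P).
rewrite (Pr_split P measurableT (measurable_bit ij true)) !setTI addrAC subrr add0r.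
by congr Pr; apply/seteqP; split=> w /=; case: (X _ _ w).
Qed.

Lemma Pr_cylinder (L : seq ('I_n * nat)) (v : 'I_n * nat -> bool) : uniq L ->
  Pr P [set w | forall ij, ij \in L -> X ij.1 ij.2 w = v ij] =
  \prod_(ij <- L) pbit p (v ij).
Proof.
move=> uL; have := hX.2 (fun ij => [set v ij]) L uL.
under eq_bigr => ij _ do rewrite -/(Pr P _) Pr_bit.
by move=> <-.
Qed.

(** The induction moves bits one at a time from [L], where they are averaged, to [L0], where their
    values are prescribed; at the end only a cylinder is left, which [Pr_cylinder] evaluates. *)
Lemma Pr_bits_cylinder (L0 L : seq ('I_n * nat)) (v : 'I_n * nat -> bool)
    (A : set (seq bool)) : uniq (L0 ++ L) ->
  Pr P ([set w | forall ij, ij \in L0 -> X ij.1 ij.2 w = v ij] `&`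
        [set w | A (bits L w)]) =
  (\prod_(ij <- L0) pbit p (v ij)) *
    Eword p (size L) (fun s => `[< A s >]%:R).
Proof.
have mC (L1 : seq ('I_n * nat)) v1 :
    measurable [set w | forall ij, ij \in L1 -> X ij.1 ij.2 w = v1 ij].
  rewrite (_ : [set _ | _] = [set w | bits L1 w = map v1 L1]).
    exact: (measurable_bits L1 (fun s => s = map v1 L1)).
  apply/seteqP; split=> w /= => [h|/eq_in_map //].
  exact/eq_in_map.
elim: L L0 v A => [|l L IH] L0 v A; first rewrite cats0 => uL /=.
  have [h|h] := pselect (A [::]).
    rewrite asboolT // mulr1 -Pr_cylinder //; congr Pr.
    by apply/seteqP; split=> [w []|].
  rewrite asboolF // mulr0 (_ : _ `&` _ = set0) ?/Pr ?measure0 //.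
  by apply/seteqP; split=> [w []|].
move=> u; have ul : uniq ((l :: L0) ++ L).
  by rewrite -[_ ++ _]/([:: l] ++ L0 ++ L) uniq_catCA.
have lL0 : l \notin L0.
  by move: ul => /=; rewrite mem_cat negb_or => /andP[/andP[]].
pose v' b ij := if ij == l then b else v ij.
pose C b := [set w | forall ij, ij \in l :: L0 -> X ij.1 ij.2 w = v' b ij] `&`
  [set w | A (b :: bits L w)].
have mCb b : measurable (C b).
  by apply: measurableI; [exact: mC|exact: (measurable_bits L (fun s => A (b :: s)))].
have CE b w : C b w <-> [/\ X l.1 l.2 w = b,
    forall ij, ij \in L0 -> X ij.1 ij.2 w = v ij & A (b :: bits L w)].
  rewrite /C /v' /=; split=> [[h Aw]|[hb h Aw]]; split=> //.
  - by rewrite (h l) ?in_cons eqxx.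
  - move=> ij hij; rewrite h ?in_cons ?hij ?orbT // ifN //.
    by apply: contraNneq lL0 => <-.
  - move=> ij; rewrite in_cons; case: eqP => [->//|_ /= hij]; exact: h.
have -> : [set w | forall ij, ij \in L0 -> X ij.1 ij.2 w = v ij] `&`
        [set w | A (bits (l :: L) w)] = C true `|` C false.
  apply/seteqP; split=> w; rewrite /setU /setI /=.
    move=> [h Aw]; case E : (X l.1 l.2 w) Aw => Aw; [left|right]; exact/CE.
  by case=> /CE [Xw h Aw]; split; rewrite // Xw.
rewrite PrU //; last first.
  by apply/seteqP; split=> // w [/CE[+ _ _] /CE[+ _ _]] => ->.
have hC b : Pr P (C b) = (\prod_(ij <- l :: L0) pbit p (v' b ij)) *
    Eword p (size L) (fun s => `[< A (b :: s) >]%:R).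
  exact: (IH (l :: L0) (v' b) (fun s => A (b :: s)) ul).
rewrite !hC !big_cons.
have eL b : \prod_(ij <- L0) pbit p (v' b ij) = \prod_(ij <- L0) pbit p (v ij).
  apply: eq_big_seq => ij hij; rewrite /v' ifN //.
  by apply: contraNneq lL0 => <-.
by rewrite !eL /v' eqxx /=; ring.
Qed.

Lemma Pr_bits (L : seq ('I_n * nat)) (A : set (seq bool)) : uniq L ->
  Pr P [set w | A (bits L w)] = Eword p (size L) (fun s => `[< A s >]%:R).
Proof.
move=> uL; have := @Pr_bits_cylinder [::] L xpredT A uL.
rewrite big_nil mul1r => <-; congr Pr.
by apply/seteqP; split=> [|w []].
Qed.

Definition strs (w : Omega) : seq (nat -> bool) :=
  [seq (fun j => X i j w) | i <- enum 'I_n].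

Let L K : seq ('I_n * nat) := [seq (i, j) | i <- enum 'I_n, j <- iota 0 K].

Let truncsE K w : truncs K (strs w) = reshape (nseq n K) (bits (L K) w).
Proof.
rewrite /L /truncs /strs -map_comp -[X in nseq X K]size_enum_ord.
elim: (enum 'I_n) => [|i s IH] //=.
rewrite /bits map_cat take_size_cat ?drop_size_cat ?size_map ?size_iota //.
by rewrite IH /mkseq -map_comp.
Qed.

Lemma size_strs w : size (strs w) = n.
Proof. by rewrite size_map size_enum_ord. Qed.

Lemma measurable_truncs K (A : set (seq (seq bool))) :
  measurable [set w | A (truncs K (strs w))].
Proof.
under eq_set do rewrite truncsE.
exact: (measurable_bits (L K) (fun s => A (reshape (nseq n K) s))).
Qed.

Lemma Pr_truncs K (A : set (seq (seq bool))) :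
  Pr P [set w | A (truncs K (strs w))] =
  Estrs p n K (fun S => `[< A S >]%:R).
Proof.
under eq_set do rewrite truncsE.
rewrite (@Pr_bits (L K) (fun s => A (reshape (nseq n K) s))).
  by rewrite Estrs_words size_allpairs size_enum_ord size_iota.
by apply: allpairs_uniq; rewrite ?enum_uniq ?iota_uniq // => -[i j] [i' j'].
Qed.

Let rt := random_trie (fun i j => X i j : Omega -> bool).

Definition separated K : set Omega := [set w | uniq (truncs K (strs w))].

(** No prefix length separates the strings, that is, two of them are equal; [random_trie] then takes
    its default [bullet]. *)
Definition coincident : set Omega := ~` \bigcup_K separated K.

Lemma measurable_separated K : measurable (separated K).
Proof. exact: (measurable_truncs K (fun S => uniq S)). Qed.

Lemma measurable_coincident : measurable coincident.
Proof.
apply: measurableC; apply: bigcupT_measurable => K; exact: measurable_separated.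
Qed.

Lemma random_trie_separated K w : (0 < n)%N -> separated K w ->
  trieK K (truncs K (strs w)) = Some (rt w).
Proof.
move=> n0 u; rewrite /rt /random_trie; have h := is_trie_trieK u.
case: pselect => [h'|nh]; last first.
  case: nh; have := nleaves_trieK (wordsK_truncs K _) u.
  case: (trieK _ _) h => [T|] h; first by exists T.
  by rewrite size_map size_strs => e; rewrite -e in n0.
by case: (cid h') => T /= hT; apply: is_trie_det h hT.
Qed.

Lemma random_trie_coincident w : coincident w -> rt w = bullet.
Proof.
rewrite /rt /random_trie; case: pselect => // -[T hT].
by have [K u] := is_trie_uniq hT; case; exists K.
Qed.

(** Where some prefix length separates the strings, the trie is a function of finitely many letters;
    on [coincident] it is constant. For n = 0 it is the default [bullet] everywhere. *)
Lemma measurable_random_trie (A : set btree) : measurable [set w | A (rt w)].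
Proof.
case: (posnP n) => [n0|n0].
  have e w : rt w = bullet.
    rewrite /rt /random_trie; case: pselect => // -[T].
    have -> : [seq (fun j => X i j w) | i <- enum 'I_n] = [::].
      by apply: size0nil; rewrite size_map size_enum_ord.
    by move=> hT; exfalso; inversion hT.
  under eq_set do rewrite e.
  have [h|h] := pselect (A bullet).
    by rewrite (_ : [set _ | _] = setT) //; apply/seteqP; split.
  by rewrite (_ : [set _ | _] = set0) //; apply/seteqP; split.
pose B K : set (seq (seq bool)) := [set S | uniq S /\
  exists2 T, trieK K S = Some T & A T].
rewrite (_ : [set _ | _] = (\bigcup_K [set w | B K (truncs K (strs w))]) `|`
    (coincident `&` [set w | A bullet])).
  apply: measurableU.
    by apply: bigcupT_measurable => K; exact: measurable_truncs.
  apply: measurableI; first exact: measurable_coincident.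
  have [h|h] := pselect (A bullet).
    by rewrite (_ : [set _ | _] = setT) //; apply/seteqP; split.
  by rewrite (_ : [set _ | _] = set0) //; apply/seteqP; split.
apply/seteqP; split=> w /=.
  move=> h; have [c|] := pselect (coincident w).
    by right; split=> //=; rewrite -(random_trie_coincident c).
  move=> /contrapT [K _ u]; left; exists K => //; split=> //.
  by exists (rt w) => //; exact: random_trie_separated.
case=> [[K _ [u [T]]]|[c]]; last by rewrite random_trie_coincident.
by rewrite (random_trie_separated n0 u) => -[->].
Qed.

Lemma Pr_not_separated K : Pr P (~` separated K) <=
  n%:R ^+ 2 * (p ^+ 2 + (1 - p) ^+ 2) ^+ K.
Proof.
rewrite (Pr_truncs K (fun S => ~ uniq S)).
apply: le_trans (Estrs_not_uniq n K p01); apply: le_Estrs => // S _ _.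
by rewrite (_ : `[< ~ uniq S >] = ~~ uniq S) //; apply/asboolP/idP => /negP.
Qed.

(** Ensures that an observed trie has positive probability, so that [cprob_given] is not the default
    0 of a null event. *)
Lemma Pr_atom K w : (0 < n)%N -> separated K w ->
  0 < Pr P [set w' | truncs K (strs w') = truncs K (strs w)].
Proof.
move=> n0 u.
under eq_set do rewrite truncsE.
have uL : uniq (L K).
  by apply: allpairs_uniq; rewrite ?enum_uniq ?iota_uniq // => -[i j] [i' j'].
apply: lt_le_trans (_ : 0 < \prod_(ij <- L K) pbit p (X ij.1 ij.2 w)) _.
  apply: prodr_gt0 => /= ij _.
  by case/andP: hp => p0 p1; case: (X _ _ _) => /=; lra.
rewrite -(@Pr_cylinder (L K) (fun ij => X ij.1 ij.2 w)) //.
apply: le_Pr.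
- rewrite (_ : [set _ | _] = [set w' | bits (L K) w' = bits (L K) w]).
    exact: (measurable_bits (L K) (fun s => s = bits (L K) w)).
  apply/seteqP; split=> w' /= => [h|/eq_in_map //]; exact/eq_in_map.
- exact: (measurable_bits (L K) (fun s => reshape _ s = truncs K (strs w))).
- by move=> w' /= h; rewrite truncsE; congr reshape; apply/eq_in_map => ij /h.
Qed.

End RandomStrings.

HB.instance Definition _ := gen_eqMixin btree.

(** * The random fringe tree of the Patricia trie *)

Section FringeTrees.
Context d (Omega : measurableType d) (R : realType) (P : probability Omega R).
Variables (p : R) (n : nat) (X : 'I_n -> nat -> {RV P >-> bool}).
Hypotheses (hp : 0 < p < 1) (hX : iid_Be p X).

Let p01 : 0 <= p <= 1. Proof. by case/andP: hp => /ltW -> /ltW ->. Qed.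

Let rho := p ^+ 2 + (1 - p) ^+ 2.
Let rt := random_trie (fun i j => X i j : Omega -> bool).
Let Ups := patricia (fun i j => X i j : Omega -> bool).

Lemma measurable_patricia (A : set btree) : measurable [set w | A (Ups w)].
Proof. exact: (measurable_random_trie X (fun T => A (compress T))). Qed.

Lemma collision_cvg0 (c : R) : (fun K => c * rho ^+ K) @ \oo --> (0 : R).
Proof.
rewrite -[X in _ --> X](mulr0 c); apply: cvgMr; apply: cvg_expr.
rewrite ger0_norm /rho ?addr_ge0 ?sqr_ge0 //.
case/andP: hp => p0 p1; nra.
Qed.

Lemma Pr_coincident : Pr P (coincident X) = 0.
Proof.
apply/eqP; rewrite eq_le Pr_ge0 andbT.
apply: (cvg0_le (collision_cvg0 (n%:R ^+ 2))) => K.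
apply: le_trans (Pr_not_separated hp hX K); apply: le_Pr.
- exact: measurable_coincident.
- by apply: measurableC; exact: measurable_separated.
- by move=> w h u; apply: h; exists K.
Qed.

(** The two events agree on [separated X K], where the trie is read off the first K letters. *)
Lemma pi_t_approx (t : btree) K : (1 < nleaves t)%N -> nleaves t = n ->
  `|pi_t X t - Estrs p n K (fun S => (okK t K S)%:R)| <= n%:R ^+ 2 * rho ^+ K.
Proof.
move=> t1 tn; have n0 : (0 < n)%N by rewrite -tn; lia.
rewrite (_ : Estrs _ _ _ _ = Estrs p n K (fun S => `[< okK t K S >]%:R)); last first.
  by apply: eq_Estrs => S _ _; rewrite asboolb.
rewrite -(Pr_truncs hX K (fun S => okK t K S)) /pi_t -/(Pr P _).
set A := [set w | precompressions _ _]; set B := [set w | okK _ _ _].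
have mA : measurable A := measurable_random_trie X (precompressions t).
have mB : measurable B := measurable_truncs X K (fun S => okK t K S).
have mS := measurable_separated X K.
have AB : A `&` separated X K = B `&` separated X K.
  apply/seteqP; split=> w [] + u; rewrite /A /B /= /okK;
    rewrite (random_trie_separated n0 u) size_map size_strs tn eqxx /= => h;
    split=> //=; by move: h => /asboolP.
rewrite (Pr_split P mA mS) (Pr_split P mB mS) AB opprD addrACA subrr add0r.
have hC E : measurable E -> Pr P (E `&` ~` separated X K) <= n%:R ^+ 2 * rho ^+ K.
  move=> mE; apply: le_trans (Pr_not_separated hp hX K); apply: le_Pr.
  - by apply: measurableI => //; exact: measurableC.
  - exact: measurableC.
  - by move=> w [].
have := Pr_ge0 P (A `&` ~` separated X K); have := Pr_ge0 P (B `&` ~` separated X K).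
have := hC _ mA; have := hC _ mB; rewrite ler_norml; lra.
Qed.

Hypothesis n0 : (0 < n)%N.

Lemma nleaves_patricia K w : separated X K w -> nleaves (Ups w) = n.
Proof.
move=> u; rewrite /Ups /patricia nleaves_compress.
have := nleaves_trieK (wordsK_truncs K _) u.
by rewrite (random_trie_separated n0 u) /= size_map size_strs.
Qed.

Lemma nnodes_patricia K w : separated X K w -> (nnodes (Ups w))%:R = 2 * n%:R - 1 :> R.
Proof.
move=> u; have := nnodes_full (compress_full (rt w)); rewrite (nleaves_patricia u).
by move=> /(congr1 (fun k => k%:R : R)); rewrite -natr1 natrM => <-; rewrite addrK.
Qed.

Lemma occ_patricia t K w : (1 < nleaves t)%N -> separated X K w ->
  occ t (Ups w) = occK t K (truncs K (strs X w)).
Proof.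
move=> t1 u; rewrite (occK_preocc (wordsK_truncs K _) u t1).
by rewrite (random_trie_separated n0 u) /= -occ_compress.
Qed.

Variables (V : Omega -> seq bool).
Hypothesis hV : uniform_node P Ups V.

Definition freq (t T : btree) : R := (occ t T)%:R / (nnodes T)%:R.

Lemma freq_itv t T : 0 <= freq t T <= 1.
Proof.
rewrite /freq divr_ge0 ?ler0n //= ler_pdivrMr ?mul1r ?ltr0n ?ler_nat //; last by case: T.
by rewrite -count_fringe -size_nodes count_size.
Qed.

Let F t := fringe_event Ups V t.
Let at_ T0 := [set w | Ups w = T0].

Let measurable_at T0 : measurable (at_ T0).
Proof. exact: (measurable_patricia (fun T => T = T0)). Qed.

Let F_at t T0 : F t `&` at_ T0 =
  [set w | exists2 v, v \in [seq v <- nodes T0 | `[< fringe T0 v = Some t >]] &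
    ([set w' | V w' = v] `&` at_ T0) w].
Proof.
apply/seteqP; split=> w.
  rewrite /F /fringe_event /at_ /= => -[+ e]; rewrite e => h.
  exists (V w) => //; rewrite mem_filter; apply/andP; split; first exact/asboolP.
  by rewrite mem_nodes h.
case=> v; rewrite mem_filter => /andP[/asboolP h _] [/= e e'].
by split; rewrite /F /fringe_event /= ?e ?e'.
Qed.

Lemma measurable_fringe_at t T0 : measurable (F t `&` at_ T0).
Proof.
rewrite F_at; apply: measurable_exists_seq => v _.
by apply: measurableI => //; exact: hV.1.
Qed.

Lemma Pr_fringe_at t T0 : Pr P (F t `&` at_ T0) = freq t T0 * Pr P (at_ T0).
Proof.
have mat := measurable_at T0.
(* [uniform_node] says nothing when the value T0 has probability 0; both sides then vanish. *)
have [pos|npos] := ltP 0 (Pr P (at_ T0)); last first.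
  have z : Pr P (at_ T0) = 0 by apply/eqP; rewrite eq_le npos Pr_ge0.
  rewrite z mulr0; apply/eqP; rewrite eq_le Pr_ge0 andbT -z.
  by apply: le_Pr => //; exact: measurable_fringe_at.
rewrite F_at Pr_exists_seq.
- rewrite (eq_big_seq (fun=> (nnodes T0)%:R^-1 * Pr P (at_ T0))); last first.
    move=> v; rewrite mem_filter mem_nodes => /andP[_ hv].
    have /= := hV.2 T0 v; rewrite /cprob -/(Pr P _) => <-.
    + by rewrite -/(Pr P _) -/(at_ T0) -mulrA mulVf ?mulr1 // gt_eqF.
    + by case: (fringe T0 v) hv.
    + by rewrite -/(at_ T0) PrE // lte_fin.
  rewrite big_const_seq iter_addr_0 count_predT size_filter count_fringe.
  by rewrite /freq -mulrA mulr_natl.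
- by rewrite filter_uniq ?nodes_uniq.
- by move=> v _; apply: measurableI => //; exact: hV.1.
- by move=> v v' w [/= -> _] [/= -> _].
Qed.

(** Outcomes with the same separating prefixes have the same trie, so by [Pr_atom] the conditioning
    event is not null and [Pr_fringe_at] can be divided by its probability. *)
Lemma cprob_given_freq t w : ~ coincident X w ->
  cprob_given P (F t) Ups w = freq t (Ups w).
Proof.
move=> /contrapT [K _ u]; rewrite /cprob_given /cprob -!/(Pr P _) Pr_fringe_at mulfK //.
rewrite gt_eqF //; apply: lt_le_trans (Pr_atom hp hX n0 u) _; apply: le_Pr => //.
  exact: (measurable_truncs X K (fun S => S = truncs K (strs X w))).
move=> w' /= e; rewrite /at_ /= /Ups /patricia; congr compress.
have u' : separated X K w' by rewrite /separated /= e.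
apply: Some_inj; rewrite -(random_trie_separated n0 u).
by rewrite -(random_trie_separated n0 u') e.
Qed.

(* All values of the Patricia trie on [separated K]. *)
Let trees K : seq btree := undup
  [seq compress (odflt bullet (trieK K (reshape (nseq n K) (val s))))
     | s <- enum {: (n * K).-tuple bool}].

Let seen K := [set w | exists2 T0, T0 \in trees K & at_ T0 w].

Let measurable_seen K : measurable (seen K).
Proof. by apply: measurable_exists_seq => T0 _. Qed.

Let separated_seen K : separated X K `<=` seen K.
Proof.
move=> w u; exists (Ups w) => //; rewrite mem_undup; apply/mapP.
have sz : size (flatten (truncs K (strs X w))) == (n * K)%N.
  rewrite size_flatten /shape -map_comp (eq_map (g := fun=> K)); last first.
    by move=> s /=; rewrite size_mkseq.
  have -> (s : seq (nat -> bool)) : [seq K | _ <- s] = nseq (size s) K.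
    by elim: s => //= ? ? ->.
  by rewrite size_strs sumn_nseq mulnC.
exists (Tuple sz); first by rewrite mem_enum.
rewrite /= (_ : nseq n K = shape (truncs K (strs X w))) ?flattenK.
  by rewrite (random_trie_separated n0 u).
rewrite /shape -map_comp (eq_map (g := fun=> K)); last first.
  by move=> s /=; rewrite size_mkseq.
rewrite -[in LHS](size_strs X w).
by elim: (strs X w) => //= ? ? ->.
Qed.

Let F_seen t K : F t `&` seen K =
  [set w | exists2 T0, T0 \in trees K & (F t `&` at_ T0) w].
Proof.
by apply/seteqP; split=> w => [[Fw [T0 h e]]|[T0 h [Fw e]]];
  [exists T0|split=> //; exists T0].
Qed.

(** On [seen K] only finitely many tries occur, and on [coincident] the trie is [bullet]; for a
    fixed trie the event is a finite union over the values of V. *)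
Let measurable_F t : measurable (F t).
Proof.
rewrite (_ : F t = (\bigcup_K (F t `&` seen K)) `|` (F t `&` at_ bullet)).
  apply: measurableU; last exact: measurable_fringe_at.
  apply: bigcupT_measurable => K; rewrite F_seen.
  by apply: measurable_exists_seq => T0 _; exact: measurable_fringe_at.
apply/seteqP; split=> w; last by move=> [[K _ []]|[]].
move=> Fw; have [c|] := pselect (coincident X w).
  by right; split=> //; rewrite /at_ /Ups /= /patricia (random_trie_coincident c).
by move=> /contrapT [K _ /separated_seen u]; left; exists K.
Qed.

(** The probability of the fringe event is the mean of [freq], computed as a finite sum over
    [trees K]. There [freq] is within delta of c except on B, where the error is at most 1 + |c|;
    the same bound serves outside [seen K]. *)
Lemma Pr_fringe_approx t (c delta : R) K : 0 <= delta ->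
  `|Pr P (F t) - c| <= delta + (1 + `|c|) *
     (Pr P [set w | delta < `|freq t (Ups w) - c|] + Pr P (~` separated X K)).
Proof.
move=> d0; set B := [set w | _ < _].
have mB : measurable B := measurable_patricia (fun T => delta < `|freq t T - c|).
have mS := measurable_seen K.
have nS : Pr P (~` seen K) <= Pr P (~` separated X K).
  apply: le_Pr; [exact: measurableC| |by apply: subsetC; exact: separated_seen].
  by apply: measurableC; exact: measurable_separated.
have dj T0 T1 w : at_ T0 w -> at_ T1 w -> T0 = T1 by rewrite /at_ /= => <-.
have EF : Pr P (F t `&` seen K) = \sum_(T0 <- trees K) freq t T0 * Pr P (at_ T0).
  rewrite F_seen Pr_exists_seq ?undup_uniq //.
  - by apply: eq_bigr => T0 _; rewrite Pr_fringe_at.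
  - by move=> T0 _; exact: measurable_fringe_at.
  - by move=> T0 T1 w [_ h] [_ h']; exact: dj h h'.
have ES : Pr P (seen K) = \sum_(T0 <- trees K) Pr P (at_ T0).
  by rewrite Pr_exists_seq ?undup_uniq.
have EB : Pr P (B `&` seen K) =
    \sum_(T0 <- trees K) (delta < `|freq t T0 - c|)%R%:R * Pr P (at_ T0).
  rewrite (_ : _ `&` _ = [set w | exists2 T0, T0 \in trees K & (B `&` at_ T0) w]).
    rewrite Pr_exists_seq ?undup_uniq //.
    - apply: eq_bigr => T0 _; case: ltP => h; rewrite ?mul1r ?mul0r.
        congr Pr; apply/seteqP; split=> [w []//|w e]; split=> //.
        by rewrite /B /= (e : Ups w = T0).
      rewrite (_ : _ `&` _ = set0) /Pr ?measure0 //.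
      apply/seteqP; split=> // w [+ e]; rewrite /B /= (e : Ups w = T0).
      by rewrite ltNge h.
    - by move=> T0 _; exact: measurableI.
    - by move=> T0 T1 w [_ h] [_ h']; exact: dj h h'.
  by apply/seteqP; split=> w => [[Fw [T0 h e]]|[T0 h [Fw e]]];
    [exists T0|split=> //; exists T0].
have main : `|Pr P (F t `&` seen K) - c * Pr P (seen K)| <=
    delta + (1 + `|c|) * Pr P B.
  rewrite EF ES mulr_sumr -sumrB.
  apply: (@le_trans _ _ (\sum_(T0 <- trees K) (delta * Pr P (at_ T0) +
     (1 + `|c|) * ((delta < `|freq t T0 - c|)%R%:R * Pr P (at_ T0))))).
    apply: le_trans (ler_norm_sum _ _ _) _; apply: ler_sum => T0 _.
    rewrite -mulrBl normrM (ger0_norm (Pr_ge0 _ _)) mulrA -mulrDl.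
    apply: ler_wpM2r; first exact: Pr_ge0.
    case: ltP => h; rewrite ?mulr1 ?mulr0 ?addr0 //.
    apply: le_trans (ler_normB _ _) _.
    have /andP[f0 f1] := freq_itv t T0; rewrite (ger0_norm f0).
    by rewrite -[leLHS]add0r lerD // lerD2r.
  rewrite big_split /= -!mulr_sumr -ES -EB; apply: lerD.
    by rewrite ler_piMr // Pr_le1.
  apply: ler_wpM2l; first by rewrite addr_ge0.
  by apply: le_Pr => //; exact: measurableI.
rewrite (Pr_split P (measurable_F t) mS).
have Ec : c = c * Pr P (seen K) + c * Pr P (~` seen K).
  rewrite -mulrDr -[LHS]mulr1 -(PrT P); congr (_ * _).
  by rewrite (Pr_split P measurableT mS) !setTI.
rewrite {1}Ec opprD addrACA; apply: le_trans (ler_normD _ _) _.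
rewrite mulrDr addrA; apply: lerD => //; apply: le_trans (ler_normB _ _) _.
rewrite normrM !(ger0_norm (Pr_ge0 _ _)) mulrDl mul1r.
have h1 : Pr P (F t `&` ~` seen K) <= Pr P (~` seen K).
  by apply: le_Pr => //; [apply: measurableI => //; exact: measurableC|exact: measurableC].
by apply: lerD; [exact: le_trans h1 nS|exact: ler_wpM2l].
Qed.

(** Half of delta is spent on the bias of the mean and half on the deviation. The difference bound 2
    gives variance at most 4n, and Chebyshev at deviation delta N / 2, with N = 2n - 1 >= n, gives
    16 n / (delta N)^2. *)
Lemma Pr_freq_approx t (c delta : R) K : (1 < nleaves t)%N -> 0 < delta ->
  `|Estrs p n K (fun S => (occK t K S)%:R) / (2 * n%:R - 1) - c| <= delta / 2 ->
  Pr P [set w | delta < `|freq t (Ups w) - c|] <=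
  n%:R ^+ 2 * rho ^+ K + 16 / (delta ^+ 2 * n%:R).
Proof.
move=> t1 d0 hmu; set B := [set w | _ < _].
have mB : measurable B := measurable_patricia (fun T => delta < `|freq t T - c|).
have mS := measurable_separated X K.
have n1 : 1 <= n%:R :> R by rewrite ler1n.
have N0 : 0 < 2 * n%:R - 1 :> R by lra.
set N := 2 * n%:R - 1 in hmu N0 *; set mu := Estrs _ _ _ _ in hmu *.
pose far (S : seq (seq bool)) := delta / 2 * N < `|(occK t K S)%:R - mu|.
rewrite (Pr_split P mB mS) addrC; apply: lerD.
  apply: le_trans (Pr_not_separated hp hX K); apply: le_Pr.
  - by apply: measurableI => //; exact: measurableC.
  - exact: measurableC.
  - by move=> w [].
apply: (@le_trans _ _ (Pr P [set w | far (truncs K (strs X w))])).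
  apply: le_Pr; [exact: measurableI|exact: (measurable_truncs X K far)|].
  move=> w [+ u]; rewrite /B /far /= /freq (occ_patricia t1 u) (nnodes_patricia u) -/N.
  move=> h; rewrite -ltr_pdivlMr // -[X in _ < _ / X](ger0_norm (ltW N0)) -normf_div.
  rewrite mulrBl; have := ler_normD ((occK t K (truncs K (strs X w)))%:R / N - mu / N)
    (mu / N - c).
  rewrite addrA subrK => h2; lra.
rewrite (Pr_truncs hX K far).
have -> : Estrs p n K (fun S => `[< far S >]%:R) =
    Estrs p n K (fun S => (delta / 2 * N < `|(occK t K S)%:R - mu|)%R%:R).
  by apply: eq_Estrs => S _ _; rewrite asboolb.
have var := @variance_bounded_differences R p n K (fun S => (occK t K S)%:R) 2 p01.
have e0 : 0 < delta / 2 * N by rewrite mulr_gt0 // divr_gt0.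
apply: le_trans (chebyshev_Estrs p01 e0 (var _)) _.
  move=> S1 S2 s s' _ _ _; have := occK_replace t1 K S1 s s' S2.
  have := occK_replace t1 K S1 s' s S2; rewrite -2!(ler_nat R) -!natr1 => h1 h2.
  rewrite ler_norml; lra.
rewrite ler_pdivrMr ?exprn_gt0 // mulrAC ler_pdivlMr ?mulr_gt0 ?exprn_gt0 //; last lra.
rewrite !exprMn exprVn.
have nN : n%:R <= N by rewrite /N; lra.
have : n%:R * n%:R <= N ^+ 2 by rewrite expr2 ler_pM.
have d2 : 0 <= delta ^+ 2 by rewrite sqr_ge0.
move=> /(ler_wpM2l d2); rewrite (_ : (2 : R) ^+ 2 = 4) //; nra.
Qed.

End FringeTrees.

(** * Renewal theory *)

Section RealDerivatives.
Context {R : realType}.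
Implicit Types (f g F G : R -> R) (x y u v c : R).

Lemma is_derive1D f g x (df dg : R) : is_derive x 1 f df -> is_derive x 1 g dg ->
  is_derive x 1 (fun y => f y + g y) (df + dg).
Proof. by move=> hf hg; exact: is_deriveD. Qed.

Lemma is_derive1B f g x (df dg : R) : is_derive x 1 f df -> is_derive x 1 g dg ->
  is_derive x 1 (fun y => f y - g y) (df - dg).
Proof. by move=> hf hg; exact: is_deriveB. Qed.

Lemma is_derive1M f g x (df dg : R) : is_derive x 1 f df -> is_derive x 1 g dg ->
  is_derive x 1 (fun y => f y * g y) (df * g x + f x * dg).
Proof.
move=> hf hg; apply: (is_derive_eq (is_deriveM hf hg)).
by rewrite addrC /GRing.scale /= mulrC.
Qed.

Lemma is_derive1Z c f x (df : R) : is_derive x 1 f df ->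
  is_derive x 1 (fun y => c * f y) (c * df).
Proof.
move=> hf; apply: (is_derive_eq (is_derive1M (is_derive_cst c x 1) hf)).
by rewrite mul0r add0r.
Qed.

Lemma is_derive1_affine c d x : is_derive x 1 (fun y : R => c * y + d) c.
Proof.
apply: (is_derive_eq (is_derive1D (is_derive1Z c (is_derive_id x 1)) (is_derive_cst d x 1))).
by rewrite addr0 mulr1.
Qed.

Lemma is_derive1_shift f x d (df : R) : is_derive (x + d) 1 f df ->
  is_derive x 1 (fun y => f (y + d)) df.
Proof.
move=> h; have h2 : is_derive x 1 (fun y : R => y + d) 1.
  by apply: (is_derive_eq (is_derive1D (is_derive_id x 1) (is_derive_cst d x 1))); rewrite addr0.
by have := @is_derive1_comp R f (fun y => y + d) x df 1 h h2; rewrite mulr1.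
Qed.

Lemma is_derive1_chain f g x (df dg : R) : is_derive (g x) 1 f df ->
  is_derive x 1 g dg -> is_derive x 1 (fun y => f (g y)) (dg * df).
Proof. by move=> hf hg; rewrite mulrC; exact: is_derive1_comp. Qed.

Lemma is_derive_continuous f x (df : R) : is_derive x 1 f df -> {for x, continuous f}.
Proof. by move=> h; apply: differentiable_continuous; apply/derivable1_diffP; case: h. Qed.

Lemma mean_value F f u v : u <= v -> (forall x, is_derive x 1 F (f x)) ->
  exists c, [/\ u <= c, c <= v & F v - F u = f c * (v - u)].
Proof.
move=> uv hF; have [|c] := @MVT_segment R F f u v uv (fun x _ => hF x).
  by apply: continuous_subspaceT => x; exact: is_derive_continuous (hF x).
by rewrite in_itv /= => /andP[uc cv] e; exists c.
Qed.

Lemma derive_ge0_le F f u v : (forall x, is_derive x 1 F (f x)) ->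
  u <= v -> (forall x, u <= x <= v -> 0 <= f x) -> F u <= F v.
Proof.
move=> hF uv f0; have [c [uc cv e]] := mean_value uv hF.
by rewrite -subr_ge0 e mulr_ge0 ?subr_ge0 // f0 // uc.
Qed.

Lemma derive_le F f G g u v : (forall x, is_derive x 1 F (f x)) ->
  (forall x, is_derive x 1 G (g x)) -> u <= v ->
  (forall x, u <= x <= v -> f x <= g x) -> F v - F u <= G v - G u.
Proof.
move=> hF hG uv fg.
have := @derive_ge0_le (fun x => G x - F x) (fun x => g x - f x) u v
  (fun x => is_derive1B (hG x) (hF x)) uv.
by move=> /(_ (fun x h => (eqbRL (subr_ge0 _ _) (fg x h)))); lra.
Qed.

Lemma derive_norm_le F f G g u v : (forall x, is_derive x 1 F (f x)) ->
  (forall x, is_derive x 1 G (g x)) -> u <= v ->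
  (forall x, u <= x <= v -> `|f x| <= g x) -> `|F v - F u| <= G v - G u.
Proof.
move=> hF hG uv fg; rewrite ler_norml; apply/andP; split.
  rewrite lerNl opprB.
  have := @derive_le (fun x => -1 * F x) (fun x => -1 * f x) G g u v
    (fun x => is_derive1Z (-1) (hF x)) hG uv.
  move=> h; rewrite (le_trans _ (h _)) // ?mulN1r ?opprK; first by lra.
  by move=> x /fg; rewrite ler_norml mulN1r lerNl => /andP[].
by apply: (derive_le hF hG uv) => x /fg; apply: le_trans; exact: ler_norm.
Qed.

Lemma derive_bounded_lipschitz F f c : (forall x, is_derive x 1 F (f x)) ->
  (forall x, `|f x| <= c) -> forall u v, `|F u - F v| <= c * `|u - v|.
Proof.
move=> hF fc u v; wlog uv : u v / u <= v.
  move=> h; have [/h//|/ltW /h] := leP u v.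
  by rewrite distrC [X in _ -> _ <= c * X]distrC.
rewrite distrC [X in c * X]distrC [X in c * X]ger0_norm ?subr_ge0 //.
have := derive_norm_le hF (is_derive1_affine c 0) uv (fun x _ => fc x); lra.
Qed.

Lemma derive_eq_cst F G f u v : (forall x, is_derive x 1 F (f x)) ->
  (forall x, is_derive x 1 G (f x)) -> F u - G u = F v - G v.
Proof.
move=> hF hG; apply/eqP; rewrite -subr_eq0 -normr_le0.
have := @derive_bounded_lipschitz (fun x => F x - G x) (fun x => f x - f x) 0
  (fun x => is_derive1B (hF x) (hG x)) _ u v.
by rewrite mul0r; apply=> x; rewrite subrr normr0.
Qed.

(* Integrating [phi] over ]0, e^x] rather than ]-oo, x] turns an exponential
   decay at -oo into boundedness. *)
Lemma exp_primitive (phi : R -> R) (c : R) :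
  (forall y, 0 < y -> {for y, continuous phi}) ->
  (forall y, 0 < y -> `|phi y| <= c) ->
  let F x := \int[lebesgue_measure]_(t in [set` `]0, expR x]%R]) phi t in
  (forall x, is_derive x 1 F (expR x * phi (expR x))) /\
  (forall x, `|F x| <= c * expR x).
Proof.
move=> cphi bphi F.
have mphi x : measurable_fun [set` `]0, x]%R] phi.
  have h : measurable_fun (`]0, +oo[ : set R) phi.
    apply: measurable_realfun.open_continuous_measurable_fun; first exact: interval_open.
    by move=> y; rewrite inE /= in_itv /= andbT => /cphi.
  apply: measurable_funS h => //.
  by apply: subset_itvl.
have iphi x : lebesgue_measure.-integrable [set` `]0, x]%R] (EFin \o phi).
  apply: measurable_bounded_integrable => //; first by rewrite /= lebesgue_measure_itv /=; case: ifP; rewrite ?ltry.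
    exact: mphi.
  exists c; split; first exact: num_real.
  move=> M cM y /=; rewrite in_itv /= => /andP[y0 _].
  exact: le_trans (bphi y y0) (ltW cM).
split=> x.
  pose G y := \int[lebesgue_measure]_(t in [set` `]0, y]%R]) phi t.
  have ex0 := expR_gt0 x.
  have [] := @continuous_FTC1 R phi (BRight 0) (expR x) (expR x + 1) _ (iphi _) _ (cphi _ ex0).
  - by rewrite ltrDl.
  - exact: ex0.
  rewrite -/G derive1E => dG eG.
  have hG : is_derive (expR x) 1 G (phi (expR x)) by split.
  by rewrite mulrC; exact: (is_derive1_comp hG (is_derive_expR x)).
apply: le_trans (le_normr_Rintegral _ (iphi _)) _ => //.
have mI : measurable [set` `]0, expR x]%R] by [].
have fI : lebesgue_measure [set` `]0, expR x]%R] = (expR x)%:E.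
  by rewrite /= lebesgue_measure_itv /= lte_fin expR_gt0 sube0.
have -> : c * expR x = \int[lebesgue_measure]_(t in [set` `]0, expR x]%R]) (cst c t).
  by rewrite /Rintegral (eq_integral (cst c%:E)) // integral_cst // [X in (_ * X)%E]fI.
apply: le_Rintegral => //.
- exact: integrable_norm.
- apply: measurable_bounded_integrable => //; first by rewrite [X in (X < _)%E]fI ltry.
  exists `|c|; split; first exact: num_real.
  by move=> M cM y _; exact: ltW.
- by move=> y /=; rewrite in_itv /= => /andP[y0 _]; exact: bphi.
Qed.

End RealDerivatives.

(** * Weighted sums along the walk with steps log p and log (1 - p) *)

Section RenewalSums.
Context {R : realType}.
Implicit Types (f g : R -> R) (x y c : R).

Definition logistic x : R := expR x / (1 + expR x).

(** The common majorant, at most e^(-|x|): it dominates every [expE k.+1] up to a constant, and its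
    sums along the walk are bounded uniformly in the starting point. *)
Definition logistic' x : R := expR x / (1 + expR x) ^+ 2.

Lemma logistic'_ge0 x : 0 <= logistic' x.
Proof. by rewrite divr_ge0 ?expR_ge0 // sqr_ge0. Qed.

Lemma is_derive_logistic x : is_derive x 1 logistic (logistic' x).
Proof.
have ex := expR_gt0 x; have ne : 1 + expR x != 0 by rewrite gt_eqF //; lra.
have h1 : is_derive x 1 (fun y => 1 + expR y) (expR x).
  by apply: (is_derive_eq (is_derive1D (is_derive_cst (1 : R) x 1) (is_derive_expR x))); rewrite add0r.
have h2 := @is_deriveV R (fun y => 1 + expR y) x (expR x) 1 ne h1.
apply: (is_derive_eq (is_derive1M (is_derive_expR x) h2)).
by rewrite /logistic' /GRing.scale /=; field.
Qed.

Lemma logistic_itv x : 0 <= logistic x <= 1.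
Proof.
have ex := expR_gt0 x; rewrite /logistic divr_ge0 /= ?ler_pdivrMr //; lra.
Qed.

Lemma logistic'_le_expR x : logistic' x <= expR x.
Proof.
have ex := expR_gt0 x; have e1 : 0 < 1 + expR x by lra.
rewrite /logistic' ler_pdivrMr ?exprn_gt0 //.
apply: ler_peMr; [exact: ltW|apply: exprn_ege1; lra].
Qed.

(** The j-th power of y / j <= e^(y / j). The constants j^j in later bounds come from here. *)
Lemma pow_le_expR j y : 0 <= y -> y ^+ j <= j%:R ^+ j * expR y.
Proof.
case: j => [|j] y0; first by rewrite !expr0 mul1r -expR0 ler_expR.
have j0 : 0 < j.+1%:R :> R by rewrite ltr0n.
rewrite -ler_pdivrMl ?exprn_gt0 // mulrC -exprVn -exprMn.
have -> : expR y = expR (y / j.+1%:R) ^+ j.+1.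
  by rewrite -expRM_natl -[_ *+ _]mulr_natl mulrCA mulfV ?mulr1 // gt_eqF.
apply: lerXn2r; rewrite ?nnegrE ?expR_ge0 ?divr_ge0 //.
by apply: le_trans (expR_ge1Dx _); rewrite lerDr.
Qed.

(** The kernel g of the renewal equation is [expE m.+1] for a tree with [m.+2] leaves. Under t = e^x
    it is the Gamma integrand t^m e^(-t), including the Jacobian. *)
Definition expE k x : R := expR (k%:R * x) * expR (- expR x).

Lemma expE_gt0 k x : 0 < expE k x.
Proof. by rewrite mulr_gt0 ?expR_gt0. Qed.

Lemma expR_natl k x : expR (k%:R * x) = expR x ^+ k.
Proof. exact: expRM_natl. Qed.

Lemma expE_le_logistic' k : exists2 c, 0 < c &
  forall x, expE k.+1 x <= c * logistic' x.
Proof.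
(* The coefficients of y^k (1 + y)^2, each multiplied by its constant from [pow_le_expR]. *)
pose c : R := k%:R ^+ k + 2 * k.+1%:R ^+ k.+1 + k.+2%:R ^+ k.+2.
have c0 : 0 < c by rewrite ltr_wpDl ?exprn_gt0 ?ltr0n // addr_ge0 ?exprn_ge0 ?mulr_ge0.
exists c => // x; have ex := expR_gt0 x; have e1 : 0 < 1 + expR x by lra.
rewrite /expE /logistic' expR_natl expRN; set y := expR x.
rewrite ler_pdivrMr ?expR_gt0 // mulrA mulrAC ler_pdivlMr ?exprn_gt0 //.
have h0 := pow_le_expR k (ltW ex); have h1 := pow_le_expR k.+1 (ltW ex).
have h2 := pow_le_expR k.+2 (ltW ex).
have -> : y ^+ k.+1 * (1 + y) ^+ 2 = (y ^+ k + 2 * y ^+ k.+1 + y ^+ k.+2) * y.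
  by rewrite !exprS; ring.
rewrite [leRHS]mulrAC ler_pM2r //; apply: le_trans (_ : _ <= k%:R ^+ k * expR y +
  2 * (k.+1%:R ^+ k.+1 * expR y) + k.+2%:R ^+ k.+2 * expR y) _; last by rewrite /c; lra.
by rewrite !lerD // ler_pM2l.
Qed.

Lemma is_derive_expE k x : is_derive x 1 (expE k) (k%:R * expE k x - expE k.+1 x).
Proof.
have h1 : is_derive x 1 (fun y : R => k%:R * y) k%:R.
  by apply: (is_derive_eq (is_derive1Z k%:R (is_derive_id x 1))); rewrite mulr1.
have h2 := @is_derive1_chain R expR (fun y => k%:R * y) x _ _ (is_derive_expR _) h1.
have h3 : is_derive x 1 (fun y : R => - expR y) (- expR x).
  exact: is_deriveN (is_derive_expR x).
have h4 := @is_derive1_chain R expR (fun y => - expR y) x _ _ (is_derive_expR _) h3.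
apply: (is_derive_eq (is_derive1M h2 h4)).
by rewrite /expE !expR_natl exprS; ring.
Qed.

Variable p : R.
Hypothesis hp : 0 < p < 1.

Let p0 : 0 < p. Proof. by case/andP: hp. Qed.
Let q0 : 0 < 1 - p. Proof. by case/andP: hp; lra. Qed.
Let lnp : ln p < 0. Proof. by rewrite ln_lt0. Qed.
Let q1 : 0 < 1 - p < 1. Proof. by case/andP: hp => h1 h2; apply/andP; split; lra. Qed.
Let lnq : ln (1 - p) < 0. Proof. by rewrite ln_lt0. Qed.

(* The sum of P(alpha) f(x + log P(alpha)) over the binary words alpha of
   length at most K. *)
Fixpoint rsum K f x : R :=
  f x + if K is K'.+1 then
          p * rsum K' f (x + ln p) + (1 - p) * rsum K' f (x + ln (1 - p))
        else 0.

Lemma rsum_lin K c f g x :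
  rsum K (fun y => c * f y + g y) x = c * rsum K f x + rsum K g x.
Proof. by elim: K x => [|K IH] x /=; rewrite ?IH; ring. Qed.

Lemma rsum_le K f g x : (forall y, y <= x -> f y <= g y) ->
  rsum K f x <= rsum K g x.
Proof.
elim: K x => [|K IH] x fg /=; first by rewrite !addr0 fg.
have la : x + ln p <= x by move: lnp; lra.
have lb : x + ln (1 - p) <= x by move: lnq; lra.
apply: lerD; first exact: fg.
by apply: lerD; (apply: ler_wpM2l; first exact: ltW); apply: IH => y hy; apply: fg;
  apply: le_trans hy _.
Qed.

Lemma rsumZ K c f x : rsum K (fun y => c * f y) x = c * rsum K f x.
Proof. by elim: K x => [|K IH] x /=; rewrite ?IH; ring. Qed.

Lemma rsum_norm_le K f g x : (forall y, y <= x -> `|f y| <= g y) ->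
  `|rsum K f x| <= rsum K g x.
Proof.
move=> fg; rewrite ler_norml; apply/andP; split.
  rewrite lerNl -mulN1r -rsumZ; apply: rsum_le => y /fg.
  by rewrite ler_norml mulN1r lerNl => /andP[].
by apply: rsum_le => y /fg; apply: le_trans; exact: ler_norm.
Qed.

(* Telescoping: [logistic] is superharmonic for the random walk. *)
Lemma rsum_logistic' K x : rsum K logistic' x <= (2 * p * (1 - p))^-1.
Proof.
(* [logistic] minus its mean after one step, so that the sums of [f0] telescope. *)
pose f0 y := logistic y - p * logistic (y + ln p) - (1 - p) * logistic (y + ln (1 - p)).
have tele : forall k y, rsum k f0 y <= logistic y.
  have l0 y : 0 <= logistic y by case/andP: (logistic_itv y).
  elim=> [|k IH] y /=.
    rewrite addr0 /f0; have := mulr_ge0 (ltW p0) (l0 (y + ln p)).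
    have := mulr_ge0 (ltW q0) (l0 (y + ln (1 - p))); lra.
  have := ler_wpM2l (ltW p0) (IH (y + ln p)).
  have := ler_wpM2l (ltW q0) (IH (y + ln (1 - p))); rewrite {3}/f0; lra.
have le y : logistic' y <= (2 * p * (1 - p))^-1 * f0 y.
  rewrite mulrC ler_pdivlMr ?mulr_gt0 //.
  rewrite /f0 /logistic /logistic' !expRD !lnK //; set z := expR y.
  have z0 : 0 < z := expR_gt0 y.
  have zp := mulr_gt0 z0 p0; have zq := mulr_gt0 z0 q0.
  have e1 : 0 < 1 + z by lra.
  have e2 : 0 < 1 + z * p by lra.
  have e3 : 0 < 1 + z * (1 - p) by lra.
  (* With z = e^y, enlarging 1 + zp and 1 + z (1 - p) to 1 + z makes each of the two fractions at
     least [logistic']; hence the factor 2 p (1 - p). *)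
  have -> : z / (1 + z) - p * (z * p / (1 + z * p)) - (1 - p) * (z * (1 - p) / (1 + z * (1 - p)))
     = p * (1 - p) * (z / ((1 + z) * (1 + z * p)) + z / ((1 + z) * (1 + z * (1 - p)))).
    by field; rewrite !gt_eqF.
  have h u : 0 < u -> u <= 1 + z -> z / (1 + z) ^+ 2 <= z / ((1 + z) * u).
    move=> u0 hu; rewrite ler_pM2l // lef_pV2 ?posrE ?mulr_gt0 ?exprn_gt0 //.
    by rewrite expr2 ler_pM2l.
  have h1 : z / (1 + z) ^+ 2 <= z / ((1 + z) * (1 + z * p)) by apply: h => //; lra.
  have h2 : z / (1 + z) ^+ 2 <= z / ((1 + z) * (1 + z * (1 - p))) by apply: h => //; lra.
  have pq : 0 < p * (1 - p) by rewrite mulr_gt0.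
  rewrite [leLHS](_ : _ = p * (1 - p) * (z / (1 + z) ^+ 2 + z / (1 + z) ^+ 2)); last by ring.
  by rewrite ler_pM2l // lerD.
apply: le_trans (_ : _ <= rsum K (fun y => (2 * p * (1 - p))^-1 * f0 y) x) _.
  exact: rsum_le.
rewrite rsumZ -[leRHS]mulr1; apply: ler_wpM2l.
  by rewrite invr_ge0 !mulr_ge0 // ltW.
by apply: le_trans (tele _ _) _; case/andP: (logistic_itv x).
Qed.

Lemma rsum_bounded K c f x : 0 <= c ->
  (forall y, y <= x -> `|f y| <= c * logistic' y) ->
  `|rsum K f x| <= c / (2 * p * (1 - p)).
Proof.
move=> c0 h; apply: le_trans (rsum_norm_le K h) _.
by rewrite rsumZ ler_wpM2l // rsum_logistic'.
Qed.

Let rho := p ^+ 2 + (1 - p) ^+ 2.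
Let rho1 : rho < 1. Proof. by have := mulr_gt0 p0 q0; rewrite /rho; lra. Qed.

(** One step multiplies the mean of e^x by p^2 + (1 - p)^2 = [rho], so the sums are dominated by a
    geometric series. *)
Lemma rsum_expR_le K c f x : 0 <= c -> (forall y, f y <= c * expR y) ->
  rsum K f x <= c / (1 - rho) * expR x.
Proof.
move=> c0 h; have r0 : 0 < 1 - rho by rewrite subr_gt0.
have rr0 : 0 <= rho by rewrite addr_ge0 // sqr_ge0.
have e : c / (1 - rho) = c + c / (1 - rho) * rho.
  by field; rewrite gt_eqF.
have T0 : 0 <= c / (1 - rho) by rewrite divr_ge0 // ltW.
elim: K x => [|K IH] x /=.
  rewrite addr0; apply: le_trans (h x) _; rewrite ler_pM2r ?expR_gt0 // e lerDl mulr_ge0 //.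
rewrite e [leRHS]mulrDl; apply: lerD; first exact: h.
have := IH (x + ln p); have := IH (x + ln (1 - p)); rewrite !expRD !lnK //.
move: (c / (1 - rho)) => T h1 h2.
rewrite -mulrA [leRHS](_ : _ = p * (T * (expR x * p)) + (1 - p) * (T * (expR x * (1 - p)))).
  by apply: lerD; rewrite ler_pM2l.
by rewrite /rho; ring.
Qed.

Lemma is_derive_rsum K f f' x : (forall y, is_derive y 1 f (f' y)) ->
  is_derive x 1 (rsum K f) (rsum K f' x).
Proof.
move=> h; elim: K x => [|K IH] x /=; apply: is_derive1D => //.
by apply: is_derive1D; apply: is_derive1Z; apply: is_derive1_shift.
Qed.

Definition renewal f x : R := limn (fun K => rsum K f x).

Section RenewalLimit.
Variables (g g' : R -> R) (c : R).
Hypotheses (g0 : forall x, 0 <= g x) (c0 : 0 <= c).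
Hypothesis g_le : forall x, g x <= c * logistic' x.
Hypothesis dg : forall x, is_derive x 1 g (g' x).
Hypothesis g'_le : forall x, `|g' x| <= c * logistic' x.

Let C := c / (2 * p * (1 - p)).

Let rsum_homo x : {homo (fun K => rsum K g x) : n m / (n <= m)%N >-> n <= m}.
Proof.
apply/nondecreasing_seqP => n; elim: n x => [|n IH] x /=.
  by rewrite lerD2l addr_ge0 // mulr_ge0 ?addr0 // ltW.
by rewrite lerD2l; apply: lerD; rewrite ler_pM2l //; exact: IH.
Qed.

Lemma rsum_cvg x : rsum K g x @[K --> \oo] --> renewal g x.
Proof.
apply: nondecreasing_is_cvgn; first exact: rsum_homo.
exists C => _ [K _ <-]; apply: le_trans (ler_norm _) _; apply: rsum_bounded => //.
by move=> y _; rewrite ger0_norm.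
Qed.

Lemma rsum_le_renewal K x : rsum K g x <= renewal g x.
Proof. by apply: nondecreasing_cvgn_le; [exact: rsum_homo|exact: rsum_cvg]. Qed.

Lemma renewal_le x M : (forall K, rsum K g x <= M) -> renewal g x <= M.
Proof.
by move=> h; apply: limr_le; [exact: rsum_cvg|exact: nearW].
Qed.

Lemma renewal_ge0 x : 0 <= renewal g x.
Proof. by apply: le_trans (rsum_le_renewal 0 x); rewrite /= addr0. Qed.

Lemma renewal_bounded x : renewal g x <= C.
Proof.
apply: renewal_le => K; apply: le_trans (ler_norm _) _; apply: rsum_bounded => //.
by move=> y _; rewrite ger0_norm.
Qed.

Lemma renewal_le_expR x : renewal g x <= c / (1 - rho) * expR x.
Proof.
apply: renewal_le => K; apply: rsum_expR_le => // y; apply: le_trans (g_le y) _.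
by rewrite ler_wpM2l // logistic'_le_expR.
Qed.

Lemma renewalE x : renewal g x =
  g x + (p * renewal g (x + ln p) + (1 - p) * renewal g (x + ln (1 - p))).
Proof.
apply: (@cvg_unique _ _ (rsum K.+1 g x @[K --> \oo])) => //.
  by have := @rsum_cvg x; rewrite -(cvg_shiftS (fun K => rsum K g x)).
rewrite /=; apply: cvgD; first exact: cvg_cst.
by apply: cvgD; apply: cvgMr; exact: rsum_cvg.
Qed.

(** The derivatives of the partial sums are bounded uniformly in K; the Lipschitz constant passes to
    the limit, with no differentiation of the limit itself. *)
Lemma renewal_lipschitz x y : `|renewal g x - renewal g y| <= C * `|x - y|.
Proof.
have h K : `|rsum K g x - rsum K g y| <= C * `|x - y|.
  apply: (derive_bounded_lipschitz (fun z => is_derive_rsum K z dg)) => z.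
  by apply: rsum_bounded.
have cv : `|rsum K g x - rsum K g y| @[K --> \oo] --> `|renewal g x - renewal g y|.
  by apply: cvg_norm; apply: cvgB; exact: rsum_cvg.
rewrite -(cvg_lim _ cv) //; apply: limr_le; last exact: nearW.
by apply/cvg_ex; exists `|renewal g x - renewal g y|.
Qed.

End RenewalLimit.

End RenewalSums.

(** * The renewal theorem *)

Section RenewalTheorem.
Context {R : realType}.
Implicit Types (x y z u v h e dl : R) (n : nat).

Definition tends (f : R -> R) (l : R) : Prop :=
  forall e : R, 0 < e -> exists x0, forall x, x0 <= x -> `|f x - l| <= e.

Lemma expR_large (M : R) : exists x0, forall x, x0 <= x -> M <= expR x.
Proof.
exists M => x Mx; apply: le_trans (expR_ge1Dx x); lra.
Qed.

Lemma expRN_small (e : R) : 0 < e -> exists x0, forall x, x0 <= x -> expR (- x) <= e.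
Proof.
move=> e0; have [x0 h] := expR_large e^-1; exists x0 => x /h.
by rewrite expRN -[X in _ -> _ <= X]invrK lef_pV2 ?posrE ?invr_gt0 ?expR_gt0.
Qed.

(** Let y -> -oo. This fixes the constant of integration between two primitives bounded by a
    multiple of e^y. *)
Lemma le_expR_eq0 (x c : R) : (forall y, `|x| <= c * expR y) -> x = 0.
Proof.
move=> h; apply/normr0_eq0/eqP; rewrite eq_le normr_ge0 andbT leNgt; apply/negP => x0.
have c0 : 0 < c.
  by have := lt_le_trans x0 (h 0); rewrite expR0 mulr1.
have [y hy] := expRN_small (divr_gt0 x0 (mulr_gt0 (ltr0n R 2) c0)).
have := hy y (lexx y); rewrite ler_pdivlMr ?mulr_gt0 // => h1.
have := h (- y); rewrite mulrC; lra.
Qed.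

Lemma logistic'_le_expRN (x : R) : logistic' x <= expR (- x).
Proof.
have ex := expR_gt0 x; have e1 : 0 < 1 + expR x by lra.
rewrite /logistic' expRN ler_pdivrMr ?exprn_gt0 // mulrC ler_pdivlMr //.
by rewrite -expr2 lerXn2r ?nnegrE ?ltW //; lra.
Qed.

Variables (p al be : R) (Z g : R -> R) (c : R).
Hypotheses (hp : 0 < p < 1) (al0 : al < 0) (be0 : be < 0) (c0 : 0 < c).
Hypothesis ZE : forall x, Z x = g x + (p * Z (x + al) + (1 - p) * Z (x + be)).
Hypothesis Z0 : forall x, 0 <= Z x.
Hypothesis Zc : forall x, Z x <= c.
Hypothesis Ze : forall x, Z x <= c * expR x.
Hypothesis Zlip : forall x y, `|Z x - Z y| <= c * `|x - y|.
Hypothesis g0 : forall x, 0 <= g x.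
Hypothesis g_le : forall x, g x <= c * logistic' x.

Let p0 : 0 < p. Proof. by case/andP: hp. Qed.
Let q0 : 0 < 1 - p. Proof. by case/andP: hp => _; rewrite subr_gt0. Qed.

Let Zcont x : {for x, continuous Z}.
Proof.
apply/cvgrPdist_le => e e0; apply/nbhs_ballP; exists (e / c); first exact: divr_gt0.
move=> y; rewrite /ball /= => xy; apply: le_trans (Zlip x y) _.
by rewrite mulrC -ler_pdivlMr // ltW.
Qed.

Let Zln y : 0 < y -> {for y, continuous (fun t => Z (ln t))}.
Proof. by move=> y0; apply: continuous_comp; [exact: continuous_ln|exact: Zcont]. Qed.

Let Zln_le y : 0 < y -> Z (ln y) / y <= c.
Proof. by move=> y0; rewrite ler_pdivrMr // -{2}(lnK y0). Qed.

Let Zsqr_primitive : exists Q : R -> R, forall x, is_derive x 1 Q (Z x ^+ 2).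
Proof.
pose phi t := Z (ln t) * Z (ln t) * t^-1.
have [] := @exp_primitive R phi (c * c).
- move=> y y0; apply: cvgM; first by apply: cvgM; exact: Zln.
  by apply: cvgV; [rewrite gt_eqF|exact: cvg_id].
- move=> y y0; rewrite /phi -mulrA normrM (ger0_norm (Z0 _)).
  have zy : 0 <= Z (ln y) / y by rewrite divr_ge0 // ltW.
  by rewrite (ger0_norm zy) ler_pM // Zln_le.
move=> h _; eexists => x; apply: (is_derive_eq (h x)).
by rewrite /phi expRK; field; rewrite gt_eqF ?expR_gt0.
Qed.

Let Z_primitive : exists Q : R -> R, (forall x, is_derive x 1 Q (Z x)) /\
  forall x, `|Q x| <= c * expR x.
Proof.
pose phi t := Z (ln t) * t^-1.
have [] := @exp_primitive R phi c.
- move=> y y0; apply: cvgM; first exact: Zln.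
  by apply: cvgV; [rewrite gt_eqF|exact: cvg_id].
- move=> y y0; rewrite /phi.
  have zy : 0 <= Z (ln y) / y by rewrite divr_ge0 // ltW.
  by rewrite (ger0_norm zy) Zln_le.
move=> h hb; eexists; split; last exact: hb.
move=> x; apply: (is_derive_eq (h x)).
by rewrite /phi expRK; field; rewrite gt_eqF ?expR_gt0.
Qed.

Let D x := Z (x + al) - Z (x + be).

(* The variance identity for the random step makes
   p int_{x-a}^x Z^2 + q int_{x-b}^x Z^2 decrease at rate pq D^2, up to an
   integrable term, so D is square integrable; being Lipschitz it tends to 0. *)
Lemma renewal_step_cvg0 : tends D 0.
Proof.
have [al0' be0' c0' p0' q0'] : [/\ al < 0, be < 0, 0 < c, 0 < p & 0 < 1 - p] by [].
have [Q hQ] := Zsqr_primitive.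
pose En x := p * (Q x - Q (x + al)) + (1 - p) * (Q x - Q (x + be)).
have Qmono u v : u <= v -> Q u <= Q v.
  by move=> uv; apply: (derive_ge0_le hQ uv) => x _; exact: sqr_ge0.
have En0 x : 0 <= En x.
  have m1 : Q (x + al) <= Q x by apply: Qmono; lra.
  have m2 : Q (x + be) <= Q x by apply: Qmono; lra.
  by apply: addr_ge0; (apply: mulr_ge0; first exact: ltW); rewrite subr_ge0.
(* The source contributes 2 Z g <= 2 c^2 [logistic'] to the derivative of the energy; subtracting
   its primitive leaves a nonincreasing function. *)
pose L x := En x - 2 * c * c * logistic x.
have dL x : is_derive x 1 L
    (p * (Z x ^+ 2 - Z (x + al) ^+ 2) + (1 - p) * (Z x ^+ 2 - Z (x + be) ^+ 2)
     - 2 * c * c * logistic' x).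
  apply: is_derive1B; last by apply: is_derive1Z; exact: is_derive_logistic.
  by apply: is_derive1D; apply: is_derive1Z; apply: is_derive1B => //;
    exact: is_derive1_shift.
have dL_le x : p * (Z x ^+ 2 - Z (x + al) ^+ 2) + (1 - p) * (Z x ^+ 2 - Z (x + be) ^+ 2)
     - 2 * c * c * logistic' x <= - (p * (1 - p) * D x ^+ 2).
  have h1 : Z x * g x <= c * (c * logistic' x) by rewrite ler_pM.
  have h2 := sqr_ge0 (g x).
  have e : p * (Z x ^+ 2 - Z (x + al) ^+ 2) + (1 - p) * (Z x ^+ 2 - Z (x + be) ^+ 2) =
     2 * (Z x * g x) - g x ^+ 2 - p * (1 - p) * D x ^+ 2.
    by rewrite /D ZE; ring.
  rewrite e; lra.
have Llow x : - (2 * c * c) <= L x.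
  have /andP[_ l1] := logistic_itv x; have cc : 0 <= 2 * c * c by rewrite !mulr_ge0 // ltW.
  have := ler_wpM2l cc l1; have := En0 x; rewrite /L; lra.
have pq : 0 < p * (1 - p) by rewrite mulr_gt0.
have Lmono u v : u <= v -> L v <= L u.
  move=> uv; have := derive_le dL (is_derive1_affine 0 0) uv; rewrite !mul0r subrr subr_le0.
  by apply=> x _; apply: le_trans (dL_le x) _; rewrite oppr_le0 mulr_ge0 ?sqr_ge0 // ltW.
move=> e e0; apply: contrapT => /forallNP nb.
(* D is 2c-Lipschitz, so once |D| exceeds e it stays above e / 2 over a length e / (4c); [eta] is
   the resulting drop of L. *)
pose dl := e / (4 * c); have dl0 : 0 < dl by rewrite divr_gt0 // mulr_gt0.
pose eta := p * (1 - p) * (e / 2) ^+ 2 * dl.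
have e20 : 0 < e / 2 by rewrite divr_gt0.
have eta0 : 0 < eta by rewrite mulr_gt0 // mulr_gt0 // exprn_gt0.
have Dlip x y : `|D x - D y| <= 2 * c * `|x - y|.
  have sh u : x + u - (y + u) = x - y by ring.
  have h1 := Zlip (x + al) (y + al); have h2 := Zlip (x + be) (y + be).
  rewrite !sh in h1 h2.
  rewrite /D (_ : _ - _ = (Z (x + al) - Z (y + al)) - (Z (x + be) - Z (y + be))); last by ring.
  apply: le_trans (ler_normB _ _) _; lra.
have drop x : exists y, L y <= L x - eta.
  have /existsNP[y /not_implyP[xy /negP]] := nb x.
  rewrite subr0 -ltNge => De; exists (y + dl).
  have big z : y <= z <= y + dl -> (e / 2) ^+ 2 <= D z ^+ 2.
    move=> /andP[yz zy]; rewrite -[leRHS]real_normK ?num_real // lerXn2r ?nnegrE //.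
      by rewrite divr_ge0 // ltW.
    have h := Dlip z y; rewrite (ger0_norm (eqbRL (subr_ge0 _ _) yz)) in h.
    have h3 : 2 * c * (z - y) <= e / 2.
      have zdl : z - y <= dl by lra.
      have := ler_wpM2l (ltW (mulr_gt0 (ltr0n R 2) c0)) zdl.
      by rewrite /dl (_ : 2 * c * (e / (4 * c)) = e / 2) //; field; rewrite gt_eqF.
    have := ler_normB (D z) (D z - D y).
    rewrite [X in `|X| <= _](_ : _ = D y); last by ring.
    lra.
  have yd : y <= y + dl by rewrite lerDl ltW.
  have := derive_le dL (is_derive1_affine (- (p * (1 - p) * (e / 2) ^+ 2)) 0) yd.
  have bd z : y <= z <= y + dl -> p * (Z z ^+ 2 - Z (z + al) ^+ 2) +
     (1 - p) * (Z z ^+ 2 - Z (z + be) ^+ 2) - 2 * c * c * logistic' z <=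
     - (p * (1 - p) * (e / 2) ^+ 2).
    by move=> /big h; apply: le_trans (dL_le z) _; rewrite lerN2 ler_pM2l.
  move=> /(_ bd); have := Lmono _ _ xy; rewrite /eta; lra.
have many n : exists y, L y <= L 0 - n%:R * eta.
  elim: n => [|n [y hy]]; first by exists 0; rewrite mul0r subr0.
  by have [z hz] := drop y; exists z; rewrite -natr1; lra.
(* Enough drops to push L below its lower bound -2 c^2. *)
pose n := Num.trunc ((L 0 + 2 * c * c) / eta).
have [y hy] := many n.+1.
have : (L 0 + 2 * c * c) / eta < n.+1%:R by exact: truncnS_gt.
rewrite ltr_pdivrMr // => h; have := Llow y; lra.
Qed.

Definition slowly (h : R) : Prop := tends (fun x => Z x - Z (x + h)) 0.

Lemma slowly0 : slowly 0.
Proof. by move=> e e0; exists 0 => x _; rewrite addr0 !subrr normr0 ltW. Qed.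

Lemma slowlyN h : slowly h -> slowly (- h).
Proof.
have [al0' be0' c0' p0' q0'] : [/\ al < 0, be < 0, 0 < c, 0 < p & 0 < 1 - p] by [].
move=> hs e /hs [x0 hx]; exists (x0 + h) => x xx.
have := hx (x - h); rewrite subrK !subr0 distrC; apply; lra.
Qed.

Lemma slowlyD h k : slowly h -> slowly k -> slowly (h + k).
Proof.
have [al0' be0' c0' p0' q0'] : [/\ al < 0, be < 0, 0 < c, 0 < p & 0 < 1 - p] by [].
move=> hh hk e e0; have e2 : 0 < e / 2 by rewrite divr_gt0.
have [x0 h0] := hh _ e2; have [x1 h1] := hk _ e2.
exists (Num.max x0 (x1 - h)) => x; rewrite ge_max => /andP[a1 a2].
have b1 : `|Z x - Z (x + h) - 0| <= e / 2 by apply: h0.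
have b2 : `|Z (x + h) - Z (x + h + k) - 0| <= e / 2 by apply: h1; lra.
rewrite !subr0 in b1 b2 *; have := ler_normD (Z x - Z (x + h)) (Z (x + h) - Z (x + h + k)).
rewrite addrA subrK -addrA => h2.
rewrite -addrA in b2; lra.
Qed.

Lemma slowlyMn h n : slowly h -> slowly (h *+ n).
Proof.
by move=> hh; elim: n => [|n IH]; [exact: slowly0|rewrite mulrS; exact: slowlyD].
Qed.

(** By the renewal equation Z(x) - Z(x + al) = g(x) - (1 - p) D(x), and both terms tend to 0; adding
    D(x) gives the other step. *)
Lemma slowly_steps : slowly al /\ slowly be.
Proof.
have [al0' be0' c0' p0' q0'] : [/\ al < 0, be < 0, 0 < c, 0 < p & 0 < 1 - p] by [].
have sal : slowly al.
  move=> e e0; have e2 : 0 < e / 2 by rewrite divr_gt0.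
  have [x0 h0] := renewal_step_cvg0 e2.
  have [x1 h1] := expRN_small (divr_gt0 e2 c0).
  exists (Num.max x0 x1) => x; rewrite ge_max => /andP[/h0 a1 /h1 a2].
  rewrite !subr0 in a1 *.
  have -> : Z x - Z (x + al) = g x - (1 - p) * D x by rewrite /D ZE; ring.
  apply: le_trans (ler_normB _ _) _; rewrite (ger0_norm (g0 x)) normrM (ger0_norm (ltW q0)).
  have h2 : g x <= e / 2.
    apply: le_trans (g_le x) _; rewrite mulrC -ler_pdivlMr //.
    exact: le_trans (logistic'_le_expRN x) a2.
  have h3 : (1 - p) * `|D x| <= `|D x| by apply: ler_piMl => //; case/andP: hp; lra.
  lra.
split=> // e e0; have e2 : 0 < e / 2 by rewrite divr_gt0.
have [x0 h0] := renewal_step_cvg0 e2; have [x1 h1] := sal _ e2.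
exists (Num.max x0 x1) => x; rewrite ge_max => /andP[/h0 a1 /h1 a2].
rewrite !subr0 in a1 a2 *; have := ler_normD (Z x - Z (x + al)) (D x).
by rewrite /D addrA subrK -/(D x); lra.
Qed.

(** A small h is applied at most J times, where J h > |A|, at total cost e / 2. The remainder is
    shorter than h < e / (2c), and the Lipschitz bound covers it with the other e / 2. *)
Lemma slowly_uniform (A : R) :
  (forall dl, 0 < dl -> exists h, [/\ slowly h, 0 < h & h < dl]) ->
  forall e, 0 < e -> exists x0, forall x y, x0 <= x -> x - A <= y <= x ->
    `|Z x - Z y| <= e.
Proof.
have [al0' be0' c0' p0' q0'] : [/\ al < 0, be < 0, 0 < c, 0 < p & 0 < 1 - p] by [].
move=> dense e e0.
have [h [sh h0 hlt]] := dense (e / (2 * c)) (divr_gt0 e0 (mulr_gt0 (ltr0n R 2) c0)).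
pose J := (Num.trunc (`|A| / h)).+1.
have J0 : 0 < J%:R :> R by rewrite ltr0n.
have eJ : 0 < e / (2 * J%:R) by rewrite divr_gt0 // mulr_gt0.
have [x1 h1] := slowlyN sh eJ.
have steps j x : (j <= J)%N -> x1 + J%:R * h <= x ->
    `|Z x - Z (x - j%:R * h)| <= j%:R * (e / (2 * J%:R)).
  move=> + xx; elim: j => [|j IH] jJ; first by rewrite !mul0r subr0 subrr normr0.
  have := IH (ltnW jJ) => h2.
  have jJ' : j%:R * h <= J%:R * h by rewrite ler_pM2r // ler_nat ltnW.
  have h3 : `|Z (x - j%:R * h) - Z (x - j%:R * h + - h) - 0| <= e / (2 * J%:R).
    by apply: h1; lra.
  rewrite subr0 in h3.
  have := ler_normD (Z x - Z (x - j%:R * h)) (Z (x - j%:R * h) - Z (x - j%:R * h + - h)).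
  rewrite addrA subrK -natr1 mulrDl [in X in _ -> _ <= X]mulrDl !mul1r.
  by rewrite [in X in _ -> `|_ - Z X| <= _]opprD addrA; lra.
exists (x1 + J%:R * h) => x y xx /andP[yA yx].
have yx0 : 0 <= (x - y) / h by rewrite divr_ge0 ?subr_ge0 // ltW.
pose j := Num.trunc ((x - y) / h).
have /andP[j1 j2] : j%:R <= (x - y) / h < j.+1%:R by exact: truncn_itv.
rewrite ler_pdivlMr // in j1; rewrite ltr_pdivrMr // -natr1 in j2.
have jJ : (j <= J)%N.
  rewrite -(ler_nat R) -(ler_pM2r h0); apply: le_trans j1 _.
  have : `|A| / h < J%:R by exact: truncnS_gt.
  by rewrite ltr_pdivrMr // => h3; have := ler_norm A; lra.
have a1 := steps j x jJ xx.
have a2 : j%:R * (e / (2 * J%:R)) <= e / 2.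
  rewrite (_ : e / (2 * J%:R) = (e / 2) / J%:R); last by field; rewrite gt_eqF.
  rewrite mulrCA ler_piMr //; first by rewrite divr_ge0 // ltW.
  by rewrite ler_pdivrMr // mul1r ler_nat.
have a3 := Zlip (x - j%:R * h) y.
have a4 : c * `|x - j%:R * h - y| <= e / 2.
  rewrite ger0_norm; last by lra.
  rewrite ltr_pdivlMr ?mulr_gt0 // in hlt.
  have : c * (x - j%:R * h - y) <= c * h by rewrite ler_pM2l //; lra.
  lra.
have := ler_normD (Z x - Z (x - j%:R * h)) (Z (x - j%:R * h) - Z y).
rewrite addrA subrK; lra.
Qed.

Let H := - (p * al) - (1 - p) * be.

(** With Q a primitive of Z, the function M(x) = p (Q(x) - Q(x + al)) + (1 - p) (Q(x) - Q(x + be))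
    is a primitive of g by the renewal equation, and equals G because both decay at -oo. As Z varies
    slowly, the increments of Q are nearly Z(x) times the step lengths, so M is close to H Z. *)
Lemma renewal_nonarithmetic (G : R -> R) (l : R) :
  (forall dl, 0 < dl -> exists h, [/\ slowly h, 0 < h & h < dl]) ->
  (forall x, is_derive x 1 G (g x)) -> (forall x, `|G x| <= c * expR x) ->
  tends G l -> tends (fun x => H * Z x) l.
Proof.
have [al0' be0' c0' p0' q0'] : [/\ al < 0, be < 0, 0 < c, 0 < p & 0 < 1 - p] by [].
move=> dense hG Ge Gl; have [Q [hQ Qe]] := Z_primitive.
pose M x := p * (Q x - Q (x + al)) + (1 - p) * (Q x - Q (x + be)).
have dM x : is_derive x 1 M (g x).
  have -> : g x = p * (Z x - Z (x + al)) + (1 - p) * (Z x - Z (x + be)).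
    by rewrite [in RHS]ZE; ring.
  by apply: is_derive1D; apply: is_derive1Z; apply: is_derive1B => //;
    exact: is_derive1_shift.
have MG x : M x = G x.
  apply/eqP; rewrite -subr_eq0; apply/eqP; apply: (@le_expR_eq0 _ (3 * c)) => y.
  rewrite (derive_eq_cst x y dM hG).
  have sm u : u <= 0 -> `|Q (y + u)| <= c * expR y.
    move=> u0; apply: le_trans (Qe _) _; rewrite ler_pM2l // ler_expR; lra.
  move: (Qe y) (sm al (ltW al0)) (sm be (ltW be0)) (Ge y).
  rewrite !ler_norml => /andP[a1 a2] /andP[a3 a4] /andP[a5 a6] /andP[a7 a8].
  have b3 := ler_wpM2l (ltW p0) a3; have b4 := ler_wpM2l (ltW p0) a4.
  have b5 := ler_wpM2l (ltW q0) a5; have b6 := ler_wpM2l (ltW q0) a6.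
  rewrite /M; lra.
have pal : 0 < p * - al by rewrite mulr_gt0 // oppr_gt0.
have qbe : 0 < (1 - p) * - be by rewrite mulr_gt0 // oppr_gt0.
have H0 : 0 < H by rewrite /H; lra.
move=> e e0; have e2 : 0 < e / 2 by rewrite divr_gt0.
have [x0 h0] := slowly_uniform (Num.max (- al) (- be)) dense (divr_gt0 e2 H0).
have [x1 h1] := Gl _ e2; exists (Num.max x0 x1) => x.
rewrite ge_max => /andP[xx0 /h1]; rewrite -MG => a1.
have incr u : u < 0 -> - u <= Num.max (- al) (- be) ->
    exists2 z, Q x - Q (x + u) = Z z * - u & `|Z x - Z z| <= e / 2 / H.
  move=> u0 um; have xu : x + u <= x by lra.
  have [z [z1 z2 z3]] := mean_value xu hQ; exists z.
    by rewrite z3; congr (_ * _); ring.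
  by apply: h0 => //; apply/andP; split=> //; lra.
have [|c1 e1 d1] := incr al al0; first by rewrite le_max lexx.
have [|c2 e2' d2] := incr be be0; first by rewrite le_max lexx orbT.
have key : `|H * Z x - M x| <= e / 2.
  rewrite /M e1 e2' (_ : _ - _ = p * - al * (Z x - Z c1) + (1 - p) * - be * (Z x - Z c2)).
    apply: le_trans (ler_normD _ _) _.
    have nal : `|- al| = - al by rewrite gtr0_norm // oppr_gt0.
    have nbe : `|- be| = - be by rewrite gtr0_norm // oppr_gt0.
    rewrite !normrM (gtr0_norm p0) (gtr0_norm q0) nal nbe.
    have b1 := ler_wpM2l (ltW pal) d1; have b2 := ler_wpM2l (ltW qbe) d2.
    have b3 : p * - al * (e / 2 / H) + (1 - p) * - be * (e / 2 / H) = e / 2.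
      have EH : p * - al + (1 - p) * - be = H by rewrite /H; ring.
      by rewrite -mulrDl EH mulrC divfK // gt_eqF.
    lra.
  by rewrite /H; ring.
have := ler_normD (H * Z x - M x) (M x - l); rewrite addrA subrK; lra.
Qed.

Lemma tendsD (f1 f2 : R -> R) l1 l2 : tends f1 l1 -> tends f2 l2 ->
  tends (fun x => f1 x + f2 x) (l1 + l2).
Proof.
move=> t1 t2 e e0; have e2 : 0 < e / 2 by rewrite divr_gt0.
have [x1 h1] := t1 _ e2; have [x2 h2] := t2 _ e2.
exists (Num.max x1 x2) => x; rewrite ge_max => /andP[/h1 a1 /h2 a2].
rewrite opprD addrACA; apply: le_trans (ler_normD _ _) _; lra.
Qed.

Lemma tendsZ (f : R -> R) (l k : R) : tends f l -> tends (fun x => k * f x) (k * l).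
Proof.
move=> t e e0; have k0 : 0 < `|k| + 1 by rewrite ltr_wpDl.
have [x1 h1] := t _ (divr_gt0 e0 k0); exists x1 => x /h1.
rewrite -mulrBr normrM ler_pdivlMr // => h; apply: le_trans h.
by rewrite mulrC ler_wpM2l // lerDl.
Qed.

Lemma tends_sum0 (F : nat -> R -> R) n : (forall k, tends (F k) 0) ->
  tends (fun x => \sum_(k < n) F k x) 0.
Proof.
move=> t; elim: n => [|n IH].
  by move=> e e0; exists 0 => x _; rewrite big_ord0 subrr normr0 ltW.
have := tendsD IH (t n); rewrite addr0 => h e /h [x0 hx].
by exists x0 => x /hx; rewrite big_ord_recr.
Qed.

(** Lattice analogue of [renewal_nonarithmetic]: the sum [W n] of n consecutive lattice values of Z
    replaces the increment of a primitive. M = p W A + (1 - p) W B satisfies M(x) - M(x - d) = g(x),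
    so it is the one-sided lattice sum of g, while [W n] is nearly n Z. *)
Lemma renewal_arithmetic (d : R) (A B : nat) : 0 < d ->
  al = - (A%:R * d) -> be = - (B%:R * d) -> slowly (- d) ->
  exists M : R -> R,
    (forall x, (fun n => \sum_(k < n) g (x - k%:R * d)) @ \oo --> M x) /\
    tends (fun x => d * M x - H * Z x) 0.
Proof.
move=> d0 eA eB sd; pose W n x := \sum_(k < n) Z (x - k%:R * d).
have tel n x : W n x - W n (x - d) = Z x - Z (x - n%:R * d).
  rewrite /W; elim: n => [|n IH]; first by rewrite !big_ord0 mul0r !subr0 subrr.
  rewrite !big_ord_recr /= opprD addrACA IH (_ : x - d - n%:R * d = x - n.+1%:R * d).
    by rewrite addrA subrK.
  by rewrite -natr1; ring.
pose M x := p * W A x + (1 - p) * W B x.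
have stepM x : M x = g x + M (x - d).
  have a1 := tel A x; have a2 := tel B x; rewrite -eA in a1; rewrite -eB in a2.
  have -> : g x = p * (Z x - Z (x + al)) + (1 - p) * (Z x - Z (x + be)).
    by rewrite [in RHS]ZE; ring.
  by rewrite -a1 -a2 /M; ring.
have sumM n x : \sum_(k < n) g (x - k%:R * d) = M x - M (x - n%:R * d).
  elim: n => [|n IH]; first by rewrite big_ord0 mul0r subr0 subrr.
  rewrite big_ord_recr /= IH [M (x - n%:R * d)]stepM.
  by rewrite (_ : x - n%:R * d - d = x - n.+1%:R * d); [ring|rewrite -natr1; ring].
have We n x : 0 <= W n x <= n%:R * (c * expR x).
  rewrite /W; elim: n => [|n /andP[IH1 IH2]]; first by rewrite big_ord0 mul0r lexx.
  rewrite big_ord_recr /= -natr1 mulrDl mul1r addr_ge0 //=; apply: lerD => //.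
  apply: le_trans (Ze _) _; rewrite ler_pM2l // ler_expR gerBl mulr_ge0 //; exact: ltW.
exists M; split=> [x|].
  pose C := (A%:R + B%:R) * c * expR x.
  have Mn n : `|M (x - n%:R * d)| <= C * expR (- d) ^+ n.
    have /andP[a1 a2] := We A (x - n%:R * d); have /andP[a3 a4] := We B (x - n%:R * d).
    have -> : C * expR (- d) ^+ n = (A%:R + B%:R) * (c * expR (x - n%:R * d)).
      by rewrite expRD -expRM_natl mulrN /C; ring.
    rewrite /M ger0_norm ?addr_ge0 ?mulr_ge0 ?(ltW p0) ?(ltW q0) //.
    have p1 : p <= 1 by case/andP: hp => _ /ltW. have q1 : 1 - p <= 1 by rewrite gerBl ltW.
    rewrite [leRHS]mulrDl; apply: lerD; [apply: le_trans a2|apply: le_trans a4]; exact: ler_piMl.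
  apply/cvgnP => e e0.
  have cv : (fun n => C * expR (- d) ^+ n) @ \oo --> (0 : R).
    rewrite -[X in _ --> X](mulr0 C); apply: cvgMr; apply: cvg_expr.
    by rewrite ger0_norm ?expR_ge0 // -expR0 ltr_expR oppr_lt0.
  have [N hN] := (cvgnP _ _).1 cv e e0; exists N => n /hN.
  rewrite sumM (_ : _ - _ - _ = - M (x - n%:R * d)); last by ring.
  rewrite normrN subr0 => h; apply: le_lt_trans h.
  exact: le_trans (Mn n) (ler_norm _).
have sk k : tends (fun x => Z (x - k%:R * d) - Z x) 0.
  move=> e e0; have [x0 h] := slowlyMn k sd e0; exists x0 => x /h.
  by rewrite !subr0 distrC (_ : - d *+ k = - (k%:R * d)) // -[LHS]mulr_natl mulrN.
have tW n : tends (fun x => W n x - n%:R * Z x) 0.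
  have h := tends_sum0 n sk; move=> e /h [x0 hx]; exists x0 => x /hx.
  by rewrite sumrB sumr_const card_ord (mulr_natl (Z x)).
have := tendsD (tendsZ (d * p) (tW A)) (tendsZ (d * (1 - p)) (tW B)).
rewrite !mulr0 addr0 => h e /h [x0 hx]; exists x0 => x /hx.
rewrite [X in `|X - 0| <= _ -> _](_ : _ = d * M x - H * Z x) //.
by rewrite /M /H eA eB; ring.
Qed.

End RenewalTheorem.

(** * Subgroups of the real line *)

Section DiscreteSubgroups.
Context {R : realType}.
Implicit Types (x y : R).

(** Without small positive elements, S has a least positive element h; Euclidean division makes
    every element an integer multiple of h, so u / v would be rational. *)
Lemma subgroup_dense (S : set R) (u v : R) : S 0 ->
  (forall x y, S x -> S y -> S (x - y)) -> S u -> S v -> v != 0 ->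
  (~ exists r : rat, u / v = ratr r) ->
  forall dl, 0 < dl -> exists h, [/\ S h, 0 < h & h < dl].
Proof.
move=> S0 SB Su Sv v0 irr dl dl0; apply: contrapT => no.
have SN x : S x -> S (- x) by move=> Sx; rewrite -sub0r; exact: SB.
have SD x y : S x -> S y -> S (x + y).
  by move=> Sx Sy; rewrite -[y]opprK; apply: SB => //; exact: SN.
have SM x (n : nat) : S x -> S (x *+ n).
  by move=> Sx; elim: n => [|n IH]; rewrite ?mulr0n // mulrS; exact: SD.
have SZ x (z : int) : S x -> S (z%:~R * x).
  move=> Sx; rewrite mulrzl; case: z => n; first exact: SM.
  by rewrite NegzE mulrNz; apply: SN; exact: SM.
have big x : S x -> 0 < x -> dl <= x.
  by move=> Sx x0; rewrite leNgt; apply/negP => h; apply: no; exists x.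
pose A := [set x | S x /\ 0 < x].
have A0 : A !=set0.
  have [vp|vn] := ltP 0 v; first by exists v.
  by exists (- v); split; [exact: SN|rewrite oppr_gt0 lt_neqAle v0].
have lb : has_lbound A by exists 0 => x [_ /ltW].
have infA : has_inf A by [].
(* Distinct elements of S differ by at least dl, so an element within dl of the infimum attains
   it. *)
have [h [Sh h0] hlt] := inf_adherent dl0 infA.
have hmin x : S x -> 0 < x -> h <= x.
  move=> Sx x0; rewrite leNgt; apply/negP => xh.
  have := big (h - x) (SB _ _ Sh Sx); rewrite subr_gt0 => /(_ xh).
  have : inf A <= x by apply: ge_inf.
  lra.
have mult x : S x -> x / h = (Num.floor (x / h))%:~R.
  move=> Sx; set z := Num.floor _.
  have /andP[z1 z2] : z%:~R <= x / h < (z + 1)%:~R by exact: floor_itv.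
  rewrite ler_pdivlMr // in z1; rewrite ltr_pdivrMr // intrD in z2.
  have Sr : S (x - z%:~R * h) by apply: SB => //; exact: SZ.
  have [r0|r0] := ltP 0 (x - z%:~R * h); first by have := hmin _ Sr r0; lra.
  by apply: (mulIf (lt0r_neq0 h0)); rewrite divfK ?gt_eqF //; lra.
apply: irr; exists ((Num.floor (u / h))%:~R / (Num.floor (v / h))%:~R).
rewrite fmorph_div /= !ratr_int -(mult u Su) -(mult v Sv).
by field; rewrite v0 gt_eqF.
Qed.

End DiscreteSubgroups.

(** * The mean number of copies of a tree *)

Section MeanOccurrences.
Context {R : realType}.
Implicit Types (x y e : R) (f : R -> R) (n K N : nat).

Variable p : R.
Hypothesis hp : 0 < p < 1.

Let p0 : 0 < p. Proof. by case/andP: hp. Qed.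
Let q0 : 0 < 1 - p. Proof. by case/andP: hp => _; rewrite subr_gt0. Qed.
Let p01 : 0 <= p <= 1. Proof. by case/andP: hp => /ltW -> /ltW ->. Qed.
Let rho := p ^+ 2 + (1 - p) ^+ 2.
Let rho01 : 0 <= rho < 1.
Proof. have := mulr_gt0 p0 q0; rewrite /rho addr_ge0 ?sqr_ge0 //=; lra. Qed.

(* The sum of r (K - |alpha|) f(x P(alpha)) over the binary words alpha of
   length at most K. *)
Fixpoint treesum (r : nat -> R) K f x : R :=
  f x * r K + if K is K'.+1 then
    treesum r K' f (x * (1 - p)) + treesum r K' f (x * p) else 0.

Definition binpmf n m x : R := 'C(n, m)%:R * x ^+ m * (1 - x) ^+ (n - m).

(** A node of probability x can be a copy only if it receives exactly [nleaves t] strings;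
    [Ethin_supp] then factors its contribution, and [Ethin_brw] passes to the children. *)
Lemma Ethin_occK t n K x :
  Ethin p n x K (fun S => (occK t K S)%:R) =
  treesum (fun K => Estrs p (nleaves t) K (fun S => (okK t K S)%:R)) K
    (binpmf n (nleaves t)) x.
Proof.
have ok k y : Ethin p n y k (fun S => (okK t k S)%:R) =
    binpmf n (nleaves t) y * Estrs p (nleaves t) k (fun S => (okK t k S)%:R).
  by apply: Ethin_supp => S hS; rewrite /okK (negbTE hS).
elim: K x => [|K IH] x.
  by rewrite [RHS]/= addr0 -ok; apply: eq_Ethin => S _; rewrite /= addn0.
have -> : Ethin p n x K.+1 (fun S => (occK t K.+1 S)%:R) =
    Ethin p n x K.+1 (fun S => (okK t K.+1 S)%:R + ((occK t K (brw false S))%:R +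
      (occK t K (brw true S))%:R)).
  by apply: eq_Ethin => S _; rewrite /= !natrD.
rewrite !EthinD ok (Ethin_brw p n x K false (fun S => (occK t K S)%:R)).
by rewrite (Ethin_brw p n x K true (fun S => (occK t K S)%:R)) !IH.
Qed.

(** A word of length j contributes an error of order P(alpha)^2 rho^(K - j), and the P(alpha)^2 of
    length j sum to rho^j. This makes K + 1 terms of order rho^K; the rate (1 + rho) / 2 absorbs
    their number. *)
Lemma treesum_approx (r : nat -> R) (c F B : R) K f x :
  (forall y, 0 <= y <= 1 -> 0 <= f y <= F * y ^+ 2) -> 0 <= F -> 0 <= B ->
  (forall K, `|r K - c| <= B * rho ^+ K) -> 0 <= x <= 1 ->
  `|treesum r K f x - c * treesum (fun=> 1) K f x| <=
  2 * F * B / (1 - rho) * x ^+ 2 * ((1 + rho) / 2) ^+ K.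
Proof.
move=> fF F0 B0 hr; have /andP[rr0 rr1] := rho01.
set A := 2 * F * B / (1 - rho); set rho1 := (1 + rho) / 2.
have r1 : 0 < 1 - rho by rewrite subr_gt0.
have FB : 0 <= F * B by rewrite mulr_ge0.
have A_FB : F * B <= A.
  rewrite /A ler_pdivlMr //; have := mulr_ge0 FB rr0; lra.
have A0 : 0 <= A by apply: le_trans A_FB.
have one k y : 0 <= y <= 1 -> `|f y * r k - c * (f y * 1)| <= F * B * y ^+ 2 * rho ^+ k.
  move=> y01; rewrite mulr1 [c * _]mulrC -mulrBr normrM.
  have /andP[f0 f1] := fF y y01; rewrite (ger0_norm f0).
  rewrite (_ : F * B * y ^+ 2 * rho ^+ k = (F * y ^+ 2) * (B * rho ^+ k)); last by ring.
  by apply: ler_pM.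
elim: K x => [|K IH] x x01 /=.
  rewrite !addr0; apply: le_trans (one 0%N x x01) _.
  by rewrite !expr0 !mulr1 ler_wpM2r ?sqr_ge0.
have x0 : 0 <= x by case/andP: x01.
have sub u : 0 < u -> u < 1 -> 0 <= x * u <= 1.
  move=> u0 u1; case/andP: x01 => _ x1; rewrite mulr_ge0 ?(ltW u0) //=.
  by rewrite -[leRHS]mul1r ler_pM // ltW.
have p1 : p < 1 by case/andP: hp.
have q1 : 1 - p < 1 by rewrite gtrBl.
set T := treesum r K f; set T1 := treesum (fun=> 1) K f.
rewrite (_ : _ - _ = (f x * r K.+1 - c * (f x * 1)) +
  ((T (x * (1 - p)) - c * T1 (x * (1 - p))) + (T (x * p) - c * T1 (x * p)))); last by ring.
apply: le_trans (ler_normD _ _) _; apply: le_trans (lerD (lexx _) (ler_normD _ _)) _.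
have h1 := one K.+1 x x01; have h2 := IH _ (sub _ q0 q1); have h3 := IH _ (sub _ p0 p1).
apply: le_trans (lerD h1 (lerD h2 h3)) _.
have rr : rho ^+ K.+1 <= rho1 ^+ K.
  have le1 : rho <= rho1 by rewrite /rho1; lra.
  apply: le_trans (_ : rho ^+ K <= _); last by rewrite lerXn2r // nnegrE // (le_trans rr0).
  by rewrite exprS ler_piMl ?exprn_ge0 // ltW.
have rK0 : 0 <= rho1 ^+ K by rewrite exprn_ge0 // /rho1; lra.
have AE : A * (rho1 - rho) = F * B.
  by rewrite /A /rho1; field; rewrite gt_eqF.
have h : F * B * x ^+ 2 * rho ^+ K.+1 <= F * B * x ^+ 2 * rho1 ^+ K.
  by apply: ler_wpM2l => //; rewrite mulr_ge0 ?sqr_ge0.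
apply: le_trans (lerD h (lexx _)) _.
have fin (u v : R) : u * (v - rho) * x ^+ 2 * v ^+ K +
    (u * (x * (1 - p)) ^+ 2 * v ^+ K + u * (x * p) ^+ 2 * v ^+ K) =
    u * x ^+ 2 * (v * v ^+ K) by rewrite /rho; ring.
by rewrite -AE [rho1 ^+ K.+1]exprS fin.
Qed.

(** Taking the node probability e^x / N out of each summand leaves the weights P(alpha) of the walk,
    with x + log P(alpha) as its position. *)
Lemma treesum_rsum f K N x : (0 < N)%N ->
  treesum (fun=> 1) K f (expR x / N%:R) =
  expR x / N%:R * rsum p K (fun y => f (expR y / N%:R) * (N%:R / expR y)) x.
Proof.
move=> N0; have N0' : N%:R != 0 :> R by rewrite pnatr_eq0 -lt0n.
elim: K x => [|K IH] x /=.
  by rewrite !addr0 mulr1; field; rewrite N0' gt_eqF ?expR_gt0.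
have e u : 0 < u -> expR x / N%:R * u = expR (x + ln u) / N%:R.
  by move=> u0; rewrite expRD lnK // mulrAC.
rewrite (e _ q0) (e _ p0) !IH !expRD !lnK //.
by field; rewrite N0' gt_eqF ?expR_gt0.
Qed.

(** With u = y / N, the upper bound is 1 - u <= e^(-u); the lower one is (1 - u) e^u >= 1 - u^2
    together with Bernoulli's inequality for (1 - u^2)^N. *)
Lemma exp_approx N y : (0 < N)%N -> 0 <= y <= N%:R ->
  `|(1 - y / N%:R) ^+ N - expR (- y)| <= y ^+ 2 * expR (- y) / N%:R.
Proof.
move=> N0 /andP[y0 yN]; have N0' : 0 < N%:R :> R by rewrite ltr0n.
set u := y / N%:R.
have u0 : 0 <= u by rewrite divr_ge0.
have u1 : u <= 1 by rewrite ler_pdivrMr // mul1r.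
have yE : y = N%:R * u by rewrite mulrC divfK // gt_eqF.
have le1 : (1 - u) ^+ N <= expR (- y).
  have -> : expR (- y) = expR (- u) ^+ N by rewrite -expRM_natl mulrN -yE.
  rewrite lerXn2r ?nnegrE ?subr_ge0 ?expR_ge0 //.
  exact: expR_ge1Dx.
have bern k : 1 - k%:R * u ^+ 2 <= (1 - u ^+ 2) ^+ k.
  have v0 : 0 <= u ^+ 2 <= 1 by rewrite sqr_ge0 expr_le1.
  elim: k => [|k IH]; first by rewrite mul0r subr0 expr0.
  case/andP: v0 => v0 v1; have w0 : 0 <= 1 - u ^+ 2 by lra.
  rewrite [leRHS]exprS -natr1; apply: le_trans (ler_wpM2l w0 IH).
  have : 0 <= k%:R * u ^+ 2 * u ^+ 2 by rewrite !mulr_ge0.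
  lra.
have ge1 : expR (- y) * (1 - N%:R * u ^+ 2) <= (1 - u) ^+ N.
  have eN : expR y = expR u ^+ N by rewrite -expRM_natl -yE.
  rewrite expRN mulrC ler_pdivrMr ?expR_gt0 // eN -exprMn.
  apply: le_trans (bern N) _; rewrite lerXn2r ?nnegrE //.
  - by rewrite subr_ge0 expr_le1.
  - by rewrite mulr_ge0 ?subr_ge0 ?expR_ge0.
  - have -> : 1 - u ^+ 2 = (1 - u) * (1 + u) by ring.
    by rewrite ler_wpM2l ?subr_ge0 // expR_ge1Dx.
have e : y ^+ 2 * expR (- y) / N%:R = expR (- y) * (N%:R * u ^+ 2).
  by rewrite /u; field; rewrite gt_eqF.
rewrite e ler_norml; apply/andP; split; first by lra.
have : 0 <= expR (- y) * (N%:R * u ^+ 2).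
  by rewrite mulr_ge0 ?expR_ge0 // mulr_ge0 ?sqr_ge0 ?ltW.
lra.
Qed.

Section Asymptotics.
Variable m : nat.

(* Words are counted against N = n - m so that the exponent of 1 - y / N is N. *)
Let phi N x : R := expR x ^+ m.+1 * (1 - expR x / N%:R) ^+ N.

Lemma rsum_binpmf N K : (0 < N)%N ->
  treesum (fun=> 1) K (binpmf (N + m.+2) m.+2) 1 =
  'C(N + m.+2, m.+2)%:R / N%:R ^+ m.+1 * rsum p K (phi N) (ln N%:R).
Proof.
move=> N0; have N0' : N%:R != 0 :> R by rewrite pnatr_eq0 -lt0n.
have eN : expR (ln N%:R) = N%:R :> R by rewrite lnK // posrE ltr0n.
transitivity (treesum (fun=> 1) K (binpmf (N + m.+2) m.+2) (expR (ln N%:R) / N%:R)).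
  by rewrite eN divff.
rewrite treesum_rsum // {1}eN divff // mul1r -rsumZ.
have E y : binpmf (N + m.+2) m.+2 (expR y / N%:R) * (N%:R / expR y) =
   'C(N + m.+2, m.+2)%:R / N%:R ^+ m.+1 * phi N y.
  rewrite /binpmf /phi addnK expr_div_n !exprS; field.
  by rewrite N0' expf_neq0 // gt_eqF ?expR_gt0.
elim: K (ln N%:R) => [|K IH] x /=; rewrite E ?IH //.
Qed.

(** The error of [exp_approx] times e^((m + 1) y) is [expE m.+3] divided by N, hence summable along
    the walk. The walk only descends from log N, so e^y <= N holds at every point it visits. *)
Lemma rsum_phi : exists2 c, 0 < c & forall N K, (0 < N)%N ->
  `|rsum p K (phi N) (ln N%:R) - rsum p K (expE m.+1) (ln N%:R)| <= c / N%:R.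
Proof.
have [c c0 hc] := @expE_le_logistic' R m.+2.
have D0 : 0 < 2 * p * (1 - p) by rewrite !mulr_gt0.
exists (c / (2 * p * (1 - p))); first by rewrite divr_gt0.
move=> N K N0; have N0' : 0 < N%:R :> R by rewrite ltr0n.
rewrite -(mulN1r (rsum _ _ (expE _) _)) addrC -rsum_lin mulrAC.
apply: rsum_bounded => //; first by rewrite divr_ge0 // ltW.
move=> y yN.
have yN' : 0 <= expR y <= N%:R.
  by rewrite expR_ge0 /= -[leRHS]lnK ?posrE // ler_expR.
have h := exp_approx N0 yN'.
have -> : -1 * expE m.+1 y + phi N y =
    expR y ^+ m.+1 * ((1 - expR y / N%:R) ^+ N - expR (- expR y)).
  by rewrite /phi /expE expR_natl; ring.
rewrite normrM (ger0_norm (exprn_ge0 _ (expR_ge0 _))).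
apply: le_trans (ler_wpM2l (exprn_ge0 _ (expR_ge0 _)) h) _.
have := hc y; rewrite /expE expR_natl => h2.
rewrite [leLHS](_ : _ = expR y ^+ m.+3 * expR (- expR y) / N%:R); last first.
  by rewrite !exprS; ring.
by rewrite ler_pdivrMr // [leRHS]mulrAC divfK ?gt_eqF.
Qed.

End Asymptotics.

End MeanOccurrences.

(** * Asymptotics of the mean *)

Section MeanAsymptotics.
Context {R : realType}.
Implicit Types (x y e : R) (n K N : nat).

Lemma ffact_bounds N m : (N ^ m <= (N + m) ^_ m <= (N + m) ^ m)%N.
Proof.
have up n k : (n ^_ k <= n ^ k)%N.
  elim: k n => [|k IH] n; first by rewrite ffactn0 expn0.
  rewrite ffactnS expnS leq_mul2l; apply/orP; right.
  by apply: leq_trans (IH _) _; case: k {IH} => // k; rewrite leq_exp2r // leq_pred.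
rewrite up andbT; elim: m => [|m IH]; first by rewrite expn0 ffactn0.
by rewrite addnS ffactnS expnS /= leq_mul // -addnS leq_addr.
Qed.

Lemma binomial_ratio_cvg m :
  (fun N => 'C(N.+1 + m, m)%:R / N.+1%:R ^+ m : R) @ \oo --> ((m`!)%:R^-1 : R).
Proof.
have f0 : 0 < (m`!)%:R :> R by rewrite ltr0n fact_gt0.
apply: (@squeeze_cvgr _ _ _ _ (fun=> (m`!)%:R^-1) (fun N => (1 + m%:R * harmonic N) ^+ m / (m`!)%:R)).
- apply: nearW => N.
  have N0 : 0 < N.+1%:R ^+ m :> R by rewrite exprn_gt0 // ltr0n.
  have /andP[h1 h2] := ffact_bounds N.+1 m.
  rewrite -(ler_nat R) -bin_ffact natrM natrX in h1.
  rewrite -(ler_nat R) -bin_ffact natrM natrX in h2.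
  apply/andP; split.
    by rewrite ler_pdivlMr // mulrC ler_pdivrMr.
  rewrite ler_pdivlMr // mulrAC ler_pdivrMr //; apply: le_trans h2 _.
  rewrite -exprMn /harmonic /= mulrDl mul1r divfK ?pnatr_eq0 // natrD.
  by rewrite (_ : N.+1%:R + m%:R = N.+1%:R + m%:R / N.+1%:R * N.+1%:R) // divfK ?pnatr_eq0.
- exact: cvg_cst.
- rewrite -[X in _ --> X]mul1r; apply: cvgMl.
  rewrite -[X in _ --> X](expr1n _ m).
  have h : (fun N => 1 + m%:R * harmonic N : R) @ \oo --> (1 : R); last first.
    exact: (cvg_comp _ _ h (@exprn_continuous R m 1)).
  rewrite -[X in _ --> X]addr0; apply: cvgD; first exact: cvg_cst.
  by rewrite -[X in _ --> X](mulr0 m%:R); apply: cvgMr; exact: cvg_harmonic.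
Qed.

(** The binomial coefficient over N^(m + 1) is of order N / (m + 2)!, and the number of nodes is of
    order 2N. *)
Lemma node_ratio_cvg m :
  (fun N => 'C(N.+1 + m.+2, m.+2)%:R / N.+1%:R ^+ m.+1 /
     (2 * (N.+1 + m.+2)%:R - 1) : R) @ \oo --> ((2 * (m.+2`!)%:R)^-1 : R).
Proof.
have -> : (fun N => 'C(N.+1 + m.+2, m.+2)%:R / N.+1%:R ^+ m.+1 /
     (2 * (N.+1 + m.+2)%:R - 1) : R) =
  (fun N => ('C(N.+1 + m.+2, m.+2)%:R / N.+1%:R ^+ m.+2) *
      (2 + (2 * m.+2%:R - 1) * harmonic N)^-1).
  apply/funext => N; rewrite /harmonic /= natrD [_ ^+ m.+2]exprS.
  have N0 : 0 < N.+1%:R :> R by rewrite ltr0n.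
  have m2 : 1 < m.+2%:R :> R by rewrite ltr1n.
  have d0 : 2 * (N.+1%:R + m.+2%:R) - 1 != 0 :> R by rewrite gt_eqF //; lra.
  have e : 2 + (2 * m.+2%:R - 1) / N.+1%:R = (2 * (N.+1%:R + m.+2%:R) - 1) / N.+1%:R :> R.
    by field; rewrite gt_eqF.
  have gen (C u v w : R) : u != 0 -> v != 0 -> w != 0 ->
      C / v / w = C / (u * v) * (w / u)^-1.
    by move=> u0 v0 w0; field; rewrite u0 v0 w0.
  by rewrite e; apply: gen; rewrite // ?expf_neq0 ?gt_eqF.
rewrite invfM [X in _ --> X]mulrC; apply: cvgM; first exact: binomial_ratio_cvg.
apply: cvgV => //; rewrite -[X in _ --> X]addr0; apply: cvgD; first exact: cvg_cst.
rewrite -[X in _ --> X](mulr0 (2 * m.+2%:R - 1)); apply: cvgMr; exact: cvg_harmonic.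
Qed.

Variable p : R.
Hypothesis hp : 0 < p < 1.

Let p0 : 0 < p. Proof. by case/andP: hp. Qed.
Let q0 : 0 < 1 - p. Proof. by case/andP: hp => _; rewrite subr_gt0. Qed.
Let p01 : 0 <= p <= 1. Proof. by case/andP: hp => /ltW -> /ltW ->. Qed.
Let rho := p ^+ 2 + (1 - p) ^+ 2.

Lemma binpmf_bound n m y : 0 <= y <= 1 ->
  0 <= binpmf n m.+2 y <= 'C(n, m.+2)%:R * y ^+ 2.
Proof.
case/andP => y0 y1; have z0 : 0 <= 1 - y by rewrite subr_ge0.
rewrite /binpmf; apply/andP; split; first by apply: mulr_ge0; [apply: mulr_ge0 => //|]; exact: exprn_ge0.
rewrite -mulrA; apply: ler_wpM2l => //.
rewrite -[leRHS]mulr1; apply: ler_pM; rewrite ?exprn_ge0 //.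
  by rewrite -addn2 exprD ler_piMl ?exprn_ge0 // exprn_ile1.
by apply: exprn_ile1 => //; rewrite gerBl.
Qed.

Variable m : nat.

Let Z := renewal p (@expE R m.+1).

(** Gathers in a single constant the bounds that the renewal theorem asks of Z and g. *)
Lemma renewal_expE : exists c : R, [/\ 0 < c,
  forall x, expE m.+1 x <= c * logistic' x,
  forall x, Z x <= c, forall x, Z x <= c * expR x &
  forall x y, `|Z x - Z y| <= c * `|x - y| ].
Proof.
have [c1 c10 h1] := @expE_le_logistic' R m.
have [c2 c20 h2] := @expE_le_logistic' R m.+1.
pose g' x := m.+1%:R * expE m.+1 x - expE m.+2 x : R.
pose c := m.+1%:R * c1 + c2.
have g0 x : 0 <= expE m.+1 x :> R by rewrite ltW // expE_gt0.
have c1c : c1 <= c by rewrite /c ler_wpDr ?(ltW c20) // ler_peMl ?(ltW c10) // ler1n.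
have c0 : 0 < c by apply: lt_le_trans c1c.
have hg x : expE m.+1 x <= c * logistic' x.
  by apply: le_trans (h1 x) _; rewrite ler_wpM2r // logistic'_ge0.
have hg' x : `|g' x| <= c * logistic' x.
  apply: le_trans (ler_normB _ _) _; rewrite /c mulrDl.
  rewrite normrM ger0_norm // (ger0_norm (g0 x)) (ger0_norm (ltW (expE_gt0 _ _))).
  by apply: lerD; rewrite // -mulrA ler_wpM2l.
have dg x : is_derive x 1 (expE m.+1) (g' x) := is_derive_expE m.+1 x.
pose D := 2 * p * (1 - p); have D0 : 0 < D by rewrite !mulr_gt0.
have r0 : 0 < 1 - rho.
  by have := mulr_gt0 p0 q0; rewrite /rho; lra.
pose C := c + c / D + c / (1 - rho).
have cD : 0 < c / D by rewrite divr_gt0. have cr : 0 < c / (1 - rho) by rewrite divr_gt0.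
exists C; split.
- by rewrite /C; lra.
- move=> x; apply: le_trans (hg x) _; rewrite ler_wpM2r ?logistic'_ge0 // /C; lra.
- move=> x; apply: le_trans (renewal_bounded hp g0 (ltW c0) hg x) _; rewrite -/D /C; lra.
- move=> x; apply: le_trans (renewal_le_expR hp g0 (ltW c0) hg x) _.
  by rewrite ler_pM2r ?expR_gt0 // -/rho /C; lra.
- move=> x y; apply: le_trans (renewal_lipschitz hp g0 (ltW c0) hg dg hg' x y) _.
  by rewrite ler_wpM2r // -/D /C; lra.
Qed.

Lemma rsum_expE_cvg x : rsum p K (expE m.+1) x @[K --> \oo] --> Z x.
Proof.
have [c [c0 hg _ _ _]] := renewal_expE.
have g0 y : 0 <= expE m.+1 y :> R by rewrite ltW // expE_gt0.
exact: (rsum_cvg hp g0 (ltW c0) hg).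
Qed.

Lemma renewal_expE_eq x : Z x = expE m.+1 x +
  (p * Z (x + ln p) + (1 - p) * Z (x + ln (1 - p))).
Proof.
have [c [c0 hg _ _ _]] := renewal_expE.
have g0 y : 0 <= expE m.+1 y :> R by rewrite ltW // expE_gt0.
exact: (renewalE hp g0 (ltW c0) hg).
Qed.

Lemma renewal_expE_ge0 x : 0 <= Z x.
Proof.
have [c [c0 hg _ _ _]] := renewal_expE.
have g0 y : 0 <= expE m.+1 y :> R by rewrite ltW // expE_gt0.
exact: (renewal_ge0 hp g0 (ltW c0) hg).
Qed.

Variables (t : btree) (pit : R).
Hypothesis tm : nleaves t = m.+2.
Hypothesis pit0 : 0 <= pit.
Hypothesis hpit : forall K,
  `|pit - Estrs p m.+2 K (fun S => (okK t K S)%:R)| <= m.+2%:R ^+ 2 * rho ^+ K.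

Let theta N : R := 'C(N.+1 + m.+2, m.+2)%:R / N.+1%:R ^+ m.+1 /
     (2 * (N.+1 + m.+2)%:R - 1).

(** The constant c does not depend on N, whereas K0 does: for each N, K is taken large enough to
    bring the truncation error below dl. *)
Lemma mean_occK_approx : exists2 c : R, 0 < c & forall N dl, 0 < dl ->
  exists K0, forall K, (K0 <= K)%N ->
  `|Estrs p (N.+1 + m.+2) K (fun S => (occK t K S)%:R) / (2 * (N.+1 + m.+2)%:R - 1)
    - pit * theta N * Z (ln (N.+1 + m.+2)%:R)| <=
  pit * theta N * (c / N.+1%:R) + dl.
Proof.
have [c1 [c10 _ _ _ Zlip]] := renewal_expE.
have [c2 c20 hphi] := rsum_phi hp m.
pose c := c1 * m.+2%:R + c2; have c0 : 0 < c by rewrite ltr_wpDl // mulr_ge0 // ltW.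
exists c => // N dl dl0; set n := (N.+1 + m.+2)%N.
have N0 : 0 < N.+1%:R :> R by rewrite ltr0n.
have n1 : 1 <= n%:R :> R by rewrite ler1n.
have D1 : 1 <= 2 * n%:R - 1 :> R by lra.
have D0 : 0 < 2 * n%:R - 1 :> R by lra.
pose F : R := 'C(n, m.+2)%:R; pose A := 2 * F * m.+2%:R ^+ 2 / (1 - rho).
pose rho1 := (1 + rho) / 2.
have r01 : 0 <= rho < 1.
  by have := mulr_gt0 p0 q0; rewrite /rho addr_ge0 ?sqr_ge0 //=; lra.
have th0 : 0 <= theta N by rewrite /theta !divr_ge0 ?exprn_ge0 // ltW.
have dl2 : 0 < dl / 2 by rewrite divr_gt0.
pose w := pit * theta N + 1; have w0 : 0 < w by rewrite ltr_wpDl // mulr_ge0.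
have c1v : (fun K => A * rho1 ^+ K) @ \oo --> (0 : R).
  rewrite -[X in _ --> X](mulr0 A); apply: cvgMr; apply: cvg_expr.
  by rewrite ger0_norm /rho1; case/andP: r01; lra.
have [K1 h1] := (cvgnP _ _).1 c1v _ dl2.
have [K2 h2] := (cvgnP _ _).1 (@rsum_expE_cvg (ln N.+1%:R)) _ (divr_gt0 dl2 w0).
exists (maxn K1 K2) => K; rewrite geq_max => /andP[/h1 {}h1 /h2 {}h2].
rewrite -Ethin1 Ethin_occK tm; set r := fun K => Estrs p m.+2 K _.
have hr k : `|r k - pit| <= m.+2%:R ^+ 2 * rho ^+ k by rewrite distrC; exact: hpit.
have bF y : 0 <= y <= 1 -> 0 <= binpmf n m.+2 y <= F * y ^+ 2 by exact: binpmf_bound.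
have F0 : 0 <= F by rewrite /F.
have B0 : 0 <= m.+2%:R ^+ 2 :> R by rewrite sqr_ge0.
have := treesum_approx hp K bF F0 B0 hr (_ : 0 <= 1 <= 1); rewrite ler01 lexx => /(_ isT).
rewrite expr1n mulr1 -/rho -/A -/rho1 rsum_binpmf //.
set T := treesum _ _ _ _ 1; set kap := _ / _ ^+ m.+1; set S := rsum _ _ _ _ => hT.
have hS := hphi N.+1 K isT; rewrite -/S in hS.
set S' := rsum _ _ _ _ in hS h2.
have hln : `|Z (ln N.+1%:R) - Z (ln n%:R)| <= c1 * m.+2%:R / N.+1%:R.
  apply: le_trans (Zlip _ _) _; rewrite -mulrA ler_pM2l // distrC.
  have e : n%:R = N.+1%:R * (1 + m.+2%:R / N.+1%:R) :> R.
    by rewrite /n natrD mulrDr mulr1 mulrC divfK // gt_eqF.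
  have u0 : 0 < m.+2%:R / N.+1%:R :> R by rewrite divr_gt0.
  have u1 : 0 < 1 + m.+2%:R / N.+1%:R :> R by rewrite addr_gt0.
  rewrite e lnM ?posrE //.
  rewrite addrAC subrr add0r ger0_norm; last by rewrite ln_ge0 // lerDl ltW.
  by apply: le_ln1Dx; apply: lt_trans u0; rewrite ltrN10.
have tE : theta N = kap / (2 * n%:R - 1) by [].
(* The successive errors: truncated tree probabilities against [pit], binomial against Poisson
   weights, finite K against the limit Z, and log N against log n. *)
rewrite (_ : _ - _ = (T - pit * (kap * S)) / (2 * n%:R - 1) + pit * theta N *
   ((S - S') + (S' - Z (ln N.+1%:R)) + (Z (ln N.+1%:R) - Z (ln n%:R)))); last first.
  by rewrite tE; field; rewrite gt_eqF.
apply: le_trans (ler_normD _ _) _; rewrite addrC.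
have e1 : `|(T - pit * (kap * S)) / (2 * n%:R - 1)| <= dl / 2.
  rewrite normf_div (ger0_norm (ltW D0)) ler_pdivrMr //.
  apply: le_trans hT _; apply: le_trans (ler_norm _) _; rewrite subr0 in h1.
  by apply: le_trans (ltW h1) _; rewrite ler_peMr // ltW.
have pt0 : 0 <= pit * theta N by rewrite mulr_ge0.
have e2 : `|pit * theta N * (S - S' + (S' - Z (ln N.+1%:R)) + (Z (ln N.+1%:R) - Z (ln n%:R)))|
    <= pit * theta N * (c / N.+1%:R) + dl / 2.
  rewrite normrM (ger0_norm pt0).
  have e3 : pit * theta N * (dl / 2 / w) <= dl / 2.
    by rewrite mulrC mulrAC ler_pdivrMr // ler_pM2l // /w lerDl.
  apply: le_trans (_ : _ <= pit * theta N * (c / N.+1%:R + dl / 2 / w)) _; last by rewrite mulrDr lerD2l.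
  apply: ler_wpM2l => //; apply: le_trans (ler_normD _ _) _.
  apply: le_trans (lerD (ler_normD _ _) (lexx _)) _.
  rewrite (_ : c / N.+1%:R = c1 * m.+2%:R / N.+1%:R + c2 / N.+1%:R); last by rewrite /c mulrDl.
  by apply: le_trans (lerD (lerD hS (ltW h2)) hln) _; rewrite addrC addrA.
by apply: le_trans (lerD e2 e1) _; rewrite -addrA -splitr.
Qed.

Lemma mean_occK_asymptotics (L : R -> R) (H : R) : 0 < H ->
  tends (fun x => H * Z x - L x) 0 ->
  forall e, 0 < e -> exists n0, forall n, (n0 <= n)%N -> exists K0, forall K, (K0 <= K)%N ->
  `|Estrs p n K (fun S => (occK t K S)%:R) / (2 * n%:R - 1) -
     pit / (2 * (m.+2`!)%:R * H) * L (ln n%:R)| <= e.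
Proof.
have shift (A n : nat) : (A + m.+3 <= n)%N ->
    exists N, n = (N.+1 + m.+2)%N /\ (A <= N)%N.
  by move=> h; exists (n - m.+3)%N; split; lia.
move=> H0 hL e e0; have [c c0 hc] := mean_occK_approx.
have [c1 [c10 _ Zc _ _]] := renewal_expE.
pose th0 : R := (2 * (m.+2`!)%:R)^-1.
have f0 : 0 < 2 * (m.+2`!)%:R :> R by rewrite mulr_gt0 // ltr0n fact_gt0.
have th00 : 0 < th0 by rewrite invr_gt0.
have e4 : 0 < e / 4 by rewrite divr_gt0.
pose w := pit * c1 + 1; have w0 : 0 < w by rewrite ltr_wpDl // mulr_ge0 // ltW.
have cv1 : (fun N => pit * theta N * (c / N.+1%:R)) @ \oo --> (0 : R).
  rewrite -[X in _ --> X](mulr0 (pit * th0)); apply: cvgM.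
    by apply: cvgMr; exact: node_ratio_cvg.
  rewrite -[X in _ --> X](mulr0 c); apply: cvgMr; exact: cvg_harmonic.
have [N1 h1] := (cvgnP _ _).1 cv1 _ e4.
have [N2 h2] := (cvgnP _ _).1 (@node_ratio_cvg m) _ (divr_gt0 e4 w0).
pose v := pit * th0 / H + 1.
have v0 : 0 < v by rewrite ltr_wpDl // !mulr_ge0 // ?invr_ge0 ltW.
have [x0 h3] := hL _ (divr_gt0 e4 v0).
have [y0 h4] := @expR_large R (expR x0).
pose N3 := Num.trunc (expR x0).
exists (maxn (maxn N1 N2) N3 + m.+3)%N => n hn.
have [N [nE]] := shift _ _ hn; rewrite !geq_max => /andP[/andP[NN1 NN2] NN3].
have [K0 hK] := hc N _ e4; exists K0 => K /hK {}hK; rewrite nE.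
have {}h1 := h1 _ NN1; have {}h2 := h2 _ NN2; rewrite subr0 in h1.
set n' := (N.+1 + m.+2)%N in hK *; set E := _ / _ in hK *.
have xn : x0 <= ln n'%:R.
  rewrite -ler_expR lnK ?posrE ?ltr0n //; apply/ltW.
  have : expR x0 < N3.+1%:R by exact: truncnS_gt.
  move=> h; apply: lt_le_trans h _; rewrite ler_nat.
  by rewrite (leq_trans _ (leq_addr _ _)) // ltnS.
have {}h3 := h3 _ xn; rewrite subr0 in h3.
have Z0 := renewal_expE_ge0 (ln n'%:R).
set z := Z (ln n'%:R) in hK h3 Z0 *; set l := L _ in h3 *.
have zc : z <= c1 by exact: Zc.
have b1 : `|pit * (theta N - th0) * z| <= e / 4.
  rewrite !normrM (ger0_norm pit0) (ger0_norm Z0) mulrAC.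
  apply: le_trans (_ : _ <= w * `|theta N - th0|) _.
    apply: ler_wpM2r => //; have := ler_wpM2l pit0 zc; rewrite /w; lra.
  by rewrite mulrC -ler_pdivlMr // ltW.
have b2 : `|pit * th0 / H * (H * z - l)| <= e / 4.
  have v1 : 0 <= pit * th0 / H by rewrite !mulr_ge0 // ?invr_ge0 ltW.
  rewrite normrM (ger0_norm v1); apply: le_trans (_ : _ <= v * `|H * z - l|) _.
    by apply: ler_wpM2r => //; rewrite /v lerDl.
  by rewrite mulrC -ler_pdivlMr.
(* The errors come from [mean_occK_approx], from the limit of [theta], and from replacing H Z by L;
   the weights [w] and [v] were chosen to keep the last two below e / 4. *)
rewrite (_ : E - _ = (E - pit * theta N * z) + pit * (theta N - th0) * z +
   pit * th0 / H * (H * z - l)); last first.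
  by rewrite /th0; field; rewrite !gt_eqF // ltr0n fact_gt0.
apply: le_trans (ler_normD _ _) _; apply: le_trans (lerD (ler_normD _ _) (lexx _)) _.
apply: le_trans (lerD (lerD hK b1) b2) _.
move: (pit * theta N * (c / N.+1%:R)) h1 => s; rewrite ltr_norml => /andP[]; lra.
Qed.

End MeanAsymptotics.

(** * Fourier series of the periodized Gamma density *)

Section GammaPrimitive.
Context {R : realType}.
Implicit Types (x y w ph : R).

Lemma integral_exp_tail (C a : R) : 0 <= C ->
  lebesgue_measure.-integrable (`[a, +oo[ : set R) (EFin \o (fun t => C * expR (- (t / 2)))) /\
  \int[lebesgue_measure]_(t in (`[a, +oo[ : set R)) (C * expR (- (t / 2))) =
    2 * C * expR (- (a / 2)).
Proof.
move=> C0; pose F (t : R) := - (2 * C) * expR (- (t / 2)).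
have dF x : is_derive x 1 F (C * expR (- (x / 2))).
  have h : is_derive x 1 (fun t : R => - (t / 2)) (- 2^-1).
    have := is_derive1_affine (- 2^-1) 0 x.
    by under eq_fun do rewrite addr0 mulNr mulrC.
  apply: (is_derive_eq (is_derive1Z _ (@is_derive1_chain R expR _ x _ _ (is_derive_expR _) h))).
  by field.
have cF x : {for x, continuous F} by exact: is_derive_continuous (dF x).
have cf x : {for x, continuous (fun t : R => C * expR (- (t / 2)))}.
  have e : (fun t : R => C * expR (- (t / 2))) = (fun t => - 2^-1 * F t).
    by apply/funext => t; rewrite /F; field.
  by rewrite e; exact: is_derive_continuous (is_derive1Z _ (dF x)).
have FE : (\int[lebesgue_measure]_(t in (`[a, +oo[ : set R)) (C * expR (- (t / 2)))%:E =
   0%:E - (F a)%:E)%E.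
  apply: (@ge0_continuous_FTC2y R (fun t => C * expR (- (t / 2))) F a 0).
  - by move=> x _; rewrite mulr_ge0 // expR_ge0.
  - by apply: continuous_subspaceT => x; exact: cf.
  - apply/cvgrPdist_le => e e0.
    have C1 : 0 < 2 * C + 1 by rewrite ltr_wpDl // mulr_ge0.
    have [x0 hx0] := expRN_small (divr_gt0 e0 C1).
    exists (2 * x0); split; first exact: num_real.
    move=> x x0x; rewrite sub0r normrN /F normrM normrN.
    rewrite (ger0_norm (expR_ge0 _)) ger0_norm ?mulr_ge0 //.
    have h := hx0 (x / 2); have xx : x0 <= x / 2 by rewrite ler_pdivlMr // mulrC ltW.
    have {}h := h xx; rewrite ler_pdivlMr // in h; apply: le_trans h.
    by rewrite mulrC ler_wpM2l ?expR_ge0 // lerDl.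
  - by move=> x _; case: (dF x).
  - apply: cvg_at_right_filter; exact: cF.
  - by move=> x _; rewrite derive1E; case: (dF x).
split; last by rewrite /Rintegral FE /= sub0r /F mulNr opprK.
apply/integrableP; split.
  apply/measurable_realfun.measurable_EFinP; apply: measurable_funTS.
  by apply: measurable_realfun.continuous_measurable_fun => x; exact: cf.
rewrite [X in (X < _)%E](_ : _ = 0%:E - (F a)%:E)%E; first by rewrite sub0e -EFinN ltry.
rewrite -FE; apply: eq_integral => t _ /=.
by rewrite ger0_norm // mulr_ge0 ?expR_ge0.
Qed.

(** The real part of e^(i ph) t^(m + iw) e^(-t). The phase allows one real function to give both the
    real part (0) and the imaginary part (-pi / 2) of Gamma(m + 1 + iw). *)
Definition gamma_integrand m w ph (t : R) : R :=
  t ^+ m * expR (- t) * cos (w * ln t + ph).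

Definition gamma_integral m w ph : R :=
  \int[lebesgue_measure]_(t in (`]0, +oo[ : set R)) gamma_integrand m w ph t.

Lemma gamma_integrand_cont m w ph t : 0 < t ->
  {for t, continuous (gamma_integrand m w ph)}.
Proof.
move=> t0; apply: cvgM; first apply: cvgM.
- exact: exprn_continuous.
- apply: (cvg_comp _ _ (_ : - x @[x --> t] --> - t)); last exact: continuous_expR.
  by apply: cvgN; exact: cvg_id.
- apply: (cvg_comp _ _ (_ : w * ln x + ph @[x --> t] --> w * ln t + ph)).
    by apply: cvgD; [apply: cvgMr; exact: continuous_ln|exact: cvg_cst].
  exact: continuous_cos.
Qed.

Lemma gamma_integrand_le m w ph t : 0 <= t ->
  `|gamma_integrand m w ph t| <= t ^+ m * expR (- t).
Proof.
move=> t0; rewrite /gamma_integrand normrM ger0_norm; last first.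
  by rewrite mulr_ge0 ?expR_ge0 // exprn_ge0.
rewrite ler_piMr //; first by rewrite mulr_ge0 ?expR_ge0 // exprn_ge0.
by rewrite ler_norml cos_geN1 cos_le1.
Qed.

Lemma gamma_integrand_exp m w ph t : 0 <= t ->
  `|gamma_integrand m w ph t| <= (2 ^+ m * m%:R ^+ m) * expR (- (t / 2)).
Proof.
move=> t0; apply: le_trans (gamma_integrand_le m w ph t0) _.
have t2 : 0 <= t / 2 by rewrite divr_ge0.
have h := pow_le_expR m t2.
rewrite (_ : expR (- t) = expR (- (t / 2)) * expR (- (t / 2))); last first.
  by rewrite -expRD -opprD -splitr.
rewrite mulrA ler_wpM2r ?expR_ge0 // expRN ler_pdivrMr ?expR_gt0 //.
rewrite -mulrA -ler_pdivrMl ?exprn_gt0 // mulrC -exprVn -exprMn //.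
Qed.

Lemma integrable_gamma m w ph :
  lebesgue_measure.-integrable (`]0, +oo[ : set R) (EFin \o gamma_integrand m w ph).
Proof.
pose C : R := 2 ^+ m * m%:R ^+ m; have C0 : 0 <= C by rewrite mulr_ge0 ?exprn_ge0.
have i2 : lebesgue_measure.-integrable (`]0, +oo[ : set R) (EFin \o (fun t => C * expR (- (t / 2)))).
  apply: (integrableS _ _ _ (integral_exp_tail 0 C0).1) => //.
  by move=> t /=; rewrite !in_itv /= !andbT => /ltW.
apply: (le_integrable _ _ _ i2) => //.
- apply/measurable_realfun.measurable_EFinP; apply: measurable_realfun.open_continuous_measurable_fun.
    exact: interval_open.
  by move=> y; rewrite inE /= in_itv /= andbT => /gamma_integrand_cont; apply.
- move=> t /=; rewrite in_itv /= andbT => t0; rewrite lee_fin.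
  rewrite [leRHS]ger0_norm ?mulr_ge0 ?expR_ge0 //.
  exact: gamma_integrand_exp (ltW t0).
Qed.

(** The substitution t = e^x, carried out on primitives: the integral over ]0, e^x] is a primitive
    in x that vanishes at -oo and tends to the full integral at +oo. *)
Lemma gamma_primitive m w ph : exists F : R -> R,
  [/\ forall x, is_derive x 1 F (expE m.+1 x * cos (w * x + ph)),
      forall x, `|F x| <= m%:R ^+ m * expR x &
      tends F (gamma_integral m w ph)].
Proof.
pose f := gamma_integrand m w ph.
have [|dF eF] := @exp_primitive R f (m%:R ^+ m) (@gamma_integrand_cont m w ph).
  move=> t t0; apply: le_trans (gamma_integrand_le m w ph (ltW t0)) _.
  by rewrite expRN ler_pdivrMr ?expR_gt0 // pow_le_expR // ltW.
eexists; split; [|exact: eF|].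
  move=> x; apply: (is_derive_eq (dF x)).
  by rewrite /f /gamma_integrand expRK /expE expR_natl exprS; ring.
pose C : R := 2 ^+ m * m%:R ^+ m; have C0 : 0 <= C by rewrite mulr_ge0 ?exprn_ge0.
move=> e e0; have C1 : 0 < 2 * C + 1 by rewrite ltr_wpDl // mulr_ge0.
have [x0 hx0] := expRN_small (divr_gt0 e0 C1).
have [x1 hx1] := @expR_large R (2 * x0).
exists x1 => x /hx1 xx; rewrite distrC /gamma_integral.
have ex0 := expR_gt0 x.
have iE : lebesgue_measure.-integrable (`]expR x, +oo[ : set R) (EFin \o f).
  apply: (integrableS _ _ _ (integrable_gamma m w ph)) => //.
  by move=> t /=; rewrite !in_itv /= !andbT; exact: lt_trans.
rewrite Rintegral_itvB //; last 2 first.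
- exact: integrable_gamma.
- by rewrite bnd_simp ltW.
apply: le_trans (le_normr_Rintegral _ iE) _ => //.
have [iT eT] := integral_exp_tail (expR x) C0.
have iT' : lebesgue_measure.-integrable (`]expR x, +oo[ : set R)
    (EFin \o (fun t => C * expR (- (t / 2)))).
  by apply: (integrableS _ _ _ iT) => //; move=> t /=; rewrite !in_itv /= !andbT => /ltW.
apply: le_trans (_ : _ <= \int[lebesgue_measure]_(t in (`]expR x, +oo[ : set R))
   (C * expR (- (t / 2)))) _.
  apply: le_Rintegral => //; first exact: integrable_norm.
  move=> t /=; rewrite in_itv /= andbT => xt.
  by apply: gamma_integrand_exp; apply: ltW; exact: lt_trans xt.
rewrite Rintegral_itv_obnd_cbnd // eT.
have h : x0 <= expR x / 2 by rewrite ler_pdivlMr // mulrC.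
have {}h := hx0 _ h; rewrite ler_pdivlMr // in h; apply: le_trans h.
by rewrite mulrC ler_wpM2l ?expR_ge0 // lerDl.
Qed.

End GammaPrimitive.

(** * Values and decay of the Gamma integrals *)

Section GammaPeriodization.
Context {R : realType}.
Implicit Types (x y w ph : R) (h : R -> R) (m n N k : nat).

Lemma tends_unique (f : R -> R) (l l' : R) : tends f l -> tends f l' -> l = l'.
Proof.
move=> h h'; apply/eqP; rewrite -subr_eq0 -normr_le0 leNgt; apply/negP => e0.
have e3 : 0 < `|l - l'| / 3 by rewrite divr_gt0.
have [x0 hx0] := h _ e3; have [x1 hx1] := h' _ e3.
pose x := Num.max x0 x1.
have a0 : `|f x - l| <= `|l - l'| / 3 by apply: hx0; rewrite /x le_max lexx.
have a1 : `|f x - l'| <= `|l - l'| / 3 by apply: hx1; rewrite /x le_max lexx orbT.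
have := ler_normB (f x - l') (f x - l); rewrite (_ : _ - _ - _ = l - l'); last by ring.
lra.
Qed.

Lemma primitive_limit_unique (F G f : R -> R) (c l l' : R) :
  (forall x, is_derive x 1 F (f x)) -> (forall x, is_derive x 1 G (f x)) ->
  (forall x, `|F x| <= c * expR x) -> (forall x, `|G x| <= c * expR x) ->
  tends F l -> tends G l' -> l = l'.
Proof.
move=> dF dG eF eG tF tG; apply: tends_unique tF _.
have FG x : F x = G x.
  apply/eqP; rewrite -subr_eq0; apply/eqP; apply: (@le_expR_eq0 _ _ (2 * c)) => y.
  rewrite (derive_eq_cst x y dF dG); apply: le_trans (ler_normB _ _) _.
  by have := eF y; have := eG y; lra.
by move=> e /tG [x0 hx]; exists x0 => x /hx; rewrite FG.
Qed.

Lemma expE_tends0 k : tends (@expE R k.+1) 0.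
Proof.
have [c c0 hc] := @expE_le_logistic' R k.
move=> e e0; have [x0 h] := expRN_small (divr_gt0 e0 c0).
exists x0 => x /h hx; rewrite subr0 gtr0_norm ?expE_gt0 //.
apply: le_trans (hc x) _; rewrite mulrC -ler_pdivlMr //.
exact: le_trans (logistic'_le_expRN x) hx.
Qed.

Lemma expE_le_expR k x : expE k.+1 x <= k%:R ^+ k * expR x.
Proof.
rewrite /expE expR_natl exprS mulrAC -mulrA [leRHS]mulrC ler_pM2l ?expR_gt0 //.
by rewrite mulrC expRN ler_pdivrMr ?expR_gt0 // pow_le_expR // expR_ge0.
Qed.

(** The functional equation of Gamma; [expE m.+1] is the boundary term of the integration by parts
    and vanishes at both ends. *)
Lemma gamma_integral_recl m :
  gamma_integral m.+1 0 0 = m.+1%:R * gamma_integral m 0 0 :> R.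
Proof.
have [F [dF eF tF]] := @gamma_primitive R m.+1 0 0.
have [G [dG eG tG]] := @gamma_primitive R m 0 0.
have c1 x : cos (0 * x + 0) = 1 :> R by rewrite mul0r addr0 cos0.
pose c : R := m.+1%:R ^+ m.+1 + m%:R ^+ m + m.+1%:R * m%:R ^+ m.
have cc0 : 0 <= m%:R ^+ m :> R by exact: exprn_ge0.
have cc1 : 0 <= m.+1%:R ^+ m.+1 :> R by exact: exprn_ge0.
have cc2 : 0 <= m.+1%:R * m%:R ^+ m :> R by rewrite mulr_ge0.
apply: (@primitive_limit_unique (fun x => F x + expE m.+1 x) (fun x => m.+1%:R * G x)
   (fun x => m.+1%:R * expE m.+1 x) c).
- move=> x; apply: (is_derive_eq (is_derive1D (dF x) (is_derive_expE m.+1 x))).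
  by rewrite c1; ring.
- by move=> x; apply: (is_derive_eq (is_derive1Z _ (dG x))); rewrite c1 mulr1.
- move=> x; apply: le_trans (ler_normD _ _) _.
  rewrite (ger0_norm (ltW (expE_gt0 _ _))) /c !mulrDl -addrA.
  apply: lerD; first exact: eF.
  by rewrite -[leLHS]addr0 lerD ?expE_le_expR // mulr_ge0 ?expR_ge0.
- move=> x; rewrite normrM ger0_norm // /c !mulrDl -[leLHS]add0r.
  apply: lerD; first by rewrite addr_ge0 // mulr_ge0 ?expR_ge0.
  by rewrite -mulrA ler_wpM2l.
- by have := tendsD tF (@expE_tends0 m); rewrite addr0.
- exact: tendsZ tG.
Qed.

Lemma gamma_integral_fact m : gamma_integral m 0 0 = (m`!)%:R :> R.
Proof.
elim: m => [|m IH]; last by rewrite gamma_integral_recl IH -natrM factS.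
have [F [dF eF tF]] := @gamma_primitive R 0 0 0.
apply: (@primitive_limit_unique F (fun x => 1 - expR (- expR x)) (fun x => expE 1 x) 1) tF _.
- by move=> x; apply: (is_derive_eq (dF x)); rewrite mul0r addr0 cos0 mulr1.
- move=> x; have h3 := is_deriveN (is_derive_expR x).
  have h4 := @is_derive1_chain R expR _ x _ _ (is_derive_expR _) h3.
  apply: (is_derive_eq (is_derive1B (is_derive_cst (1 : R) x 1) h4)).
  by rewrite /expE mul1r; ring.
- by move=> x; have := eF x; rewrite expr0.
- move=> x; have h := expR_ge1Dx (- expR x); rewrite mul1r ger0_norm; first by lra.
  by rewrite subr_ge0 -expR0 ler_expR oppr_le0 expR_ge0.
- move=> e e0; have [x0 h] := expRN_small e0; have [x1 h1] := @expR_large R x0.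
  exists x1 => x /h1 /h hx.
  by rewrite addrAC subrr add0r normrN ger0_norm ?expR_ge0.
Qed.

Let dcosw w ph x : is_derive x 1 (fun t : R => cos (w * t + ph)) (w * - sin (w * x + ph)).
Proof. exact: is_derive1_chain (is_derive_cos _) (is_derive1_affine w ph x). Qed.

Let dsinw w ph x : is_derive x 1 (fun t : R => sin (w * t + ph)) (w * cos (w * x + ph)).
Proof. exact: is_derive1_chain (is_derive_sin _) (is_derive1_affine w ph x). Qed.

(** Two integrations by parts in x = log t. The remaining integrand is at most c / w^2 times
    [logistic'], whose primitive increases by at most 1. *)
Lemma gamma_integral_decay m : exists2 c : R, 0 < c &
  forall w ph, w != 0 -> `|gamma_integral m w ph| <= c / w ^+ 2.
Proof.
have [c1 c10 h1] := @expE_le_logistic' R m.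
have [c2 c20 h2] := @expE_le_logistic' R m.+1.
have [c3 c30 h3] := @expE_le_logistic' R m.+2.
pose g1 x := m.+1%:R * expE m.+1 x - expE m.+2 x : R.
pose g2 x := m.+1%:R * g1 x - (m.+2%:R * expE m.+2 x - expE m.+3 x) : R.
have dg1 x : is_derive x 1 g1 (g2 x).
  apply: is_derive1B; last exact: is_derive_expE.
  by apply: is_derive1Z; exact: is_derive_expE.
pose d1 := m.+1%:R * c1 + c2.
pose c := m.+1%:R * d1 + (m.+2%:R * c2 + c3).
have hg1 x : `|g1 x| <= d1 * logistic' x.
  apply: le_trans (ler_normB _ _) _; rewrite normrM ger0_norm // !gtr0_norm ?expE_gt0 //.
  by rewrite [leRHS]mulrDl -[_ * _ * logistic' x]mulrA lerD // ler_wpM2l.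
have hg2 x : `|g2 x| <= c * logistic' x.
  apply: le_trans (ler_normB _ _) _; rewrite normrM (ger0_norm (ler0n _ _)).
  rewrite /c [leRHS]mulrDl -[m.+1%:R * d1 * _]mulrA.
  apply: lerD; first by rewrite ler_wpM2l.
  apply: le_trans (ler_normB _ _) _; rewrite normrM ger0_norm // !gtr0_norm ?expE_gt0 //.
  by rewrite [leRHS]mulrDl -[_ * _ * logistic' x]mulrA lerD // ler_wpM2l.
have d10 : 0 < d1 by rewrite ltr_wpDl // mulr_ge0 // ltW.
have c0 : 0 < c by rewrite ltr_wpDl ?mulr_ge0 ?(ltW d10) // ltr_wpDl // mulr_ge0 // ltW.
exists c => // w ph w0; have w20 : 0 < w ^+ 2 by rewrite exprn_even_gt0.
have [F [dF eF tF]] := @gamma_primitive R m w ph.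
(* The boundary terms of the two integrations by parts. *)
pose K x := w^-1 * (expE m.+1 x * sin (w * x + ph)) + (w ^+ 2)^-1 * (g1 x * cos (w * x + ph)).
have dFK x : is_derive x 1 (fun y => F y - K y)
    (- ((w ^+ 2)^-1 * (g2 x * cos (w * x + ph)))).
  have hs := is_derive1M (is_derive_expE m.+1 x) (dsinw w ph x).
  have hc := is_derive1M (dg1 x) (dcosw w ph x).
  apply: (is_derive_eq (is_derive1B (dF x) (is_derive1D (is_derive1Z _ hs) (is_derive1Z _ hc)))).
  by rewrite -/(g1 x); field.
have bd x : `|- ((w ^+ 2)^-1 * (g2 x * cos (w * x + ph)))| <= c / w ^+ 2 * logistic' x.
  rewrite normrN normrM gtr0_norm ?invr_gt0 // [leLHS]mulrC [leRHS]mulrAC ler_pM2r ?invr_gt0 //.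
  apply: le_trans (hg2 x); rewrite normrM ler_piMr // ler_norml cos_geN1 cos_le1 //.
have incr u v : u <= v -> `|(F v - K v) - (F u - K u)| <= c / w ^+ 2.
  move=> uv; apply: le_trans (derive_norm_le dFK
    (fun x => is_derive1Z (c / w ^+ 2) (is_derive_logistic x)) uv (fun x _ => bd x)) _.
  rewrite -mulrBr ler_piMr ?divr_ge0 ?(ltW c0) ?(ltW w20) //.
  have /andP[a1 a2] := logistic_itv u; have /andP[a3 a4] := logistic_itv v; lra.
pose kk := c1 / `|w| + d1 / w ^+ 2.
have aw : 0 < `|w| by rewrite normr_gt0.
have kk0 : 0 < kk by rewrite /kk addr_gt0 ?divr_gt0.
have Kle x : `|K x| <= kk * logistic' x.
  apply: le_trans (ler_normD _ _) _; rewrite /kk [leRHS]mulrDl; apply: lerD.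
    rewrite normrM normfV [leLHS]mulrC [leRHS]mulrAC ler_pM2r ?invr_gt0 //.
    apply: le_trans (h1 x); rewrite normrM gtr0_norm ?expE_gt0 //.
    by rewrite ler_piMr ?(ltW (expE_gt0 _ _)) // ler_norml sin_geN1 sin_le1.
  rewrite normrM gtr0_norm ?invr_gt0 // [leLHS]mulrC [leRHS]mulrAC ler_pM2r ?invr_gt0 //.
  by apply: le_trans (hg1 x); rewrite normrM ler_piMr // ler_norml cos_geN1 cos_le1.
rewrite leNgt; apply/negP => hlt.
(* A fifth of the supposed excess: four quantities at the ends -v and v are made at most e, which
   contradicts the bound on the increment. *)
pose e := (`|gamma_integral m w ph| - c / w ^+ 2) / 5.
have e0 : 0 < e by rewrite divr_gt0 // subr_gt0.
have [x0 hx0] := tF _ e0; have [x1 hx1] := expRN_small (divr_gt0 e0 kk0).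
pose kF : R := m%:R ^+ m + 1; have kF0 : 0 < kF by rewrite ltr_wpDl // exprn_ge0.
have [x2 hx2] := expRN_small (divr_gt0 e0 kF0).
pose v := Num.max x0 (Num.max x1 (Num.max x2 0)).
have [v0 v1 v2 v3] : [/\ x0 <= v, x1 <= v, x2 <= v & 0 <= v].
  by split; rewrite /v !le_max lexx ?orbT.
have b0 := hx0 _ v0.
have b1 : `|K v| <= e.
  apply: le_trans (Kle v) _; rewrite mulrC -ler_pdivlMr //.
  exact: le_trans (logistic'_le_expRN v) (hx1 _ v1).
have b2 : `|K (- v)| <= e.
  apply: le_trans (Kle (- v)) _; rewrite mulrC -ler_pdivlMr //.
  apply: le_trans (logistic'_le_expR _) (hx1 _ v1).
have b3 : `|F (- v)| <= e.
  apply: le_trans (eF _) _; have := hx2 _ v2; rewrite ler_pdivlMr // => h.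
  apply: le_trans h; rewrite mulrC ler_wpM2l ?expR_ge0 // lerDl //.
have vv : - v <= v by lra.
have b4 := incr _ _ vv.
have b5 : `|gamma_integral m w ph| <= `|F v - gamma_integral m w ph| +
    (`|F v - K v - (F (- v) - K (- v))| + (`|K v| + (`|F (- v)| + `|K (- v)|))).
  set I := gamma_integral m w ph.
  rewrite {1}(_ : I = - (F v - I) + ((F v - K v - (F (- v) - K (- v))) +
     (K v + (F (- v) - K (- v))))); last by ring.
  apply: le_trans (ler_normD _ _) _; rewrite normrN lerD2l.
  apply: le_trans (ler_normD _ _) _; rewrite lerD2l.
  by apply: le_trans (ler_normD _ _) _; rewrite lerD2l; exact: ler_normB.
by move: b0 b1 b2 b3 b4 b5; rewrite /e; lra.
Qed.

End GammaPeriodization.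

(** * The Fejer kernel *)

Section FejerKernel.
Context {R : realType}.
Implicit Types (x y u v w t : R) (n N k : nat).

(** Jordan's inequality with 2 in place of pi / 2. The mean value theorem gives sin(t/2) >= (t/2)
    cos(t/2), hence sin t >= (t/2)(1 + cos t) >= t/2. *)
Lemma jordan_sin t : `|t| <= pi / 2 -> `|t| <= 2 * `|sin t|.
Proof.
wlog t0 : t / 0 <= t.
  move=> h; have [/h//|/ltW tn] := leP 0 t.
  have := h (- t); rewrite sinN !normrN; apply; lra.
rewrite (ger0_norm t0) => t1.
have p2 := @pi_ge2 R.
have t2 : 0 <= t / 2 by rewrite divr_ge0.
have [c [c0 c1 e]] := mean_value t2 (@is_derive_sin R).
have cos_t : 0 <= cos t by apply: cos_ge0_pihalf; apply/andP; split=> //; lra.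
have cos_t2 : 0 < cos (t / 2) by apply: cos_gt0_pihalf; apply/andP; split; lra.
have cc : cos (t / 2) <= cos c.
  have [->//|ne] := eqVneq c (t / 2).
  apply: ltW; rewrite ltr_cos ?in_itv /= ?lt_neqAle ?ne ?c1 //; apply/andP; split; lra.
have st : sin t = 2 * (sin (t / 2) * cos (t / 2)).
  by rewrite {1}(_ : t = (t / 2) *+ 2) ?sin_mulr2n ?mulr2n -?splitr //; ring.
have ct : cos t = 2 * cos (t / 2) ^+ 2 - 1.
  by rewrite {1}(_ : t = (t / 2) *+ 2) ?cos_mulr2n ?mulr2n -?splitr //; ring.
rewrite subr0 sin0 subr0 in e.
have h1 : cos (t / 2) ^+ 2 <= cos c * cos (t / 2) by rewrite expr2 ler_pM2r.
have h2 : t / 2 * cos (t / 2) ^+ 2 <= sin (t / 2) * cos (t / 2).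
  by rewrite e [cos c * (t / 2)]mulrC -[leRHS]mulrA; apply: ler_wpM2l.
have h3 : t / 2 * (1 + cos t) = 2 * (t / 2 * cos (t / 2) ^+ 2) by rewrite ct; ring.
have h4 : 0 <= t * cos t by rewrite mulr_ge0.
have := ler_norm (sin t); lra.
Qed.

Definition dirichlet n t : R := 1 + 2 * \sum_(k < n) cos (k.+1%:R * t).

Definition fejer N t : R := N%:R^-1 * \sum_(n < N) dirichlet n t.

Lemma dirichlet_sin n t :
  dirichlet n t * sin (t / 2) = sin (n%:R * t + t / 2).
Proof.
rewrite /dirichlet; elim: n => [|n IH].
  by rewrite big_ord0 mulr0 addr0 mul1r mul0r add0r.
rewrite big_ord_recr /= mulrDr addrA mulrDl IH.
have -> : n%:R * t + t / 2 = n.+1%:R * t - t / 2 by rewrite -[n.+1%:R]natr1; field.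
by rewrite sinB sinD; ring.
Qed.

(** By [dirichlet_sin] the terms are sin(nt + t/2) sin(t/2), and each is the difference of sin^2((n
    + 1) t/2) and sin^2(n t/2). *)
Lemma fejer_sin N t : (0 < N)%N ->
  N%:R * (fejer N t * sin (t / 2) ^+ 2) = sin (N%:R * (t / 2)) ^+ 2.
Proof.
move=> N0; rewrite /fejer -[N%:R^-1 * _ * _]mulrA mulVKf ?pnatr_eq0 -?lt0n //.
elim: {N0} N => [|N IH]; first by rewrite big_ord0 !mul0r sin0 expr0n.
have dl : dirichlet N t * sin (t / 2) ^+ 2 = sin (N%:R * t + t / 2) * sin (t / 2).
  by rewrite -dirichlet_sin expr2 mulrA.
rewrite big_ord_recr /= mulrDl IH dl -[N.+1%:R]natr1.
rewrite [(_ + 1) * _]mulrDl mul1r !sinD [N%:R * t](_ : _ = (N%:R * (t / 2)) *+ 2); last first.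
  by rewrite mulr2n; field.
rewrite sin_mulr2n cos_mulr2n !mulr2n.
have e1 := cos2Dsin2 (N%:R * (t / 2)); have e2 := cos2Dsin2 (t / 2).
set C := cos (N%:R * (t / 2)) in e1 *; set S := sin (N%:R * (t / 2)) in e1 *.
set c := cos (t / 2) in e2 *; set s := sin (t / 2) in e2 *.
have hS : S ^+ 2 = 1 - C ^+ 2 by rewrite -e1; ring.
have hc : c ^+ 2 = 1 - s ^+ 2 by rewrite -e2; ring.
rewrite [RHS](_ : _ = S ^+ 2 * c ^+ 2 + 2 * (S * c * (C * s)) + C ^+ 2 * s ^+ 2); last by ring.
by rewrite hc !expr2 -!expr2 hS; ring.
Qed.

Lemma fejer_ge0 N t : (0 < N)%N -> `|t| <= pi -> 0 <= fejer N t.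
Proof.
move=> N0 tpi; have N0' : 0 < N%:R :> R by rewrite ltr0n.
have [->|t0] := eqVneq t 0.
  rewrite /fejer mulr_ge0 ?invr_ge0 // sumr_ge0 // => n _.
  rewrite /dirichlet addr_ge0 // mulr_ge0 // sumr_ge0 // => k _.
  by rewrite mulr0 cos0.
have s0 : 0 < sin (t / 2) ^+ 2.
  rewrite exprn_even_gt0 //= -normr_gt0.
  have : `|t / 2| <= pi / 2 by rewrite normrM (ger0_norm (_ : 0 <= 2^-1)) ?invr_ge0 // ler_pM2r ?invr_gt0.
  move=> /jordan_sin h.
  have : 0 < `|t / 2| by rewrite normr_gt0 mulf_neq0 // invr_eq0.
  lra.
rewrite -(pmulr_lge0 _ s0) -(pmulr_rge0 _ N0') fejer_sin //; exact: sqr_ge0.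
Qed.

Lemma fejer_periodic N n t : fejer N (t + (pi *+ 2) *+ n) = fejer N t.
Proof.
have := periodicn (@cosD2pi R); move: (pi *+ 2) => T per.
rewrite /fejer /dirichlet; congr (_ * _); apply: eq_bigr => i _; congr (1 + 2 * _).
by apply: eq_bigr => k _; rewrite mulrDr (mulr_natl (T *+ n)) -mulrnA per.
Qed.

Lemma fejerN N t : fejer N (- t) = fejer N t.
Proof.
rewrite /fejer /dirichlet; congr (_ * _); apply: eq_bigr => i _; congr (1 + 2 * _).
by apply: eq_bigr => k _; rewrite mulrN cosN.
Qed.

(** Term by term integration: over the period d every sine vanishes, and only the constant 1 of each
    Dirichlet kernel contributes. *)
Lemma fejer_primitive N w d : (0 < N)%N -> w != 0 -> w * d = pi *+ 2 ->
  exists F : R -> R, (forall t, is_derive t 1 F (fejer N (w * t))) /\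
    F (d / 2) - F (- (d / 2)) = d.
Proof.
move=> N0 w0 wd.
pose D n t : R := t + 2 * \sum_(k < n) (k.+1%:R * w)^-1 * sin (k.+1%:R * w * t + 0).
have dD n t : is_derive t 1 (D n) (dirichlet n (w * t)).
  suff h : is_derive t 1 (fun x : R => \sum_(k < n) (k.+1%:R * w)^-1 * sin (k.+1%:R * w * x + 0))
      (\sum_(k < n) cos (k.+1%:R * (w * t))).
    exact: (is_derive1D (is_derive_id t 1) (is_derive1Z 2 h)).
  elim: n => [|n IH].
    have -> : (fun x : R => \sum_(k < 0) (k.+1%:R * w)^-1 * sin (k.+1%:R * w * x + 0)) = cst 0.
      by apply/funext => x; rewrite big_ord0.
    by rewrite big_ord0; exact: is_derive_cst.
  rewrite big_ord_recr /=.
  have -> : (fun x : R => \sum_(k < n.+1) (k.+1%:R * w)^-1 * sin (k.+1%:R * w * x + 0)) =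
    (fun x => \sum_(k < n) (k.+1%:R * w)^-1 * sin (k.+1%:R * w * x + 0) +
      (n.+1%:R * w)^-1 * sin (n.+1%:R * w * x + 0)).
    by apply/funext => x; rewrite big_ord_recr.
  apply: is_derive1D => //.
  apply: (is_derive_eq (is_derive1Z _ (is_derive1_chain (is_derive_sin _)
     (is_derive1_affine (n.+1%:R * w) 0 t)))).
  by rewrite addr0 mulKf ?mulf_neq0 ?pnatr_eq0 // mulrA.
have sD n : D n (d / 2) - D n (- (d / 2)) = d.
  have s0 k : sin (k.+1%:R * w * (d / 2) + 0) = 0.
    have -> : k.+1%:R * w * (d / 2) + 0 = 0 + pi *+ k.+1.
      rewrite addr0 add0r (_ : k.+1%:R * w * (d / 2) = k.+1%:R * ((w * d) / 2)); last by ring.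
      have p2 (u : R) : (u *+ 2) / 2 = u by rewrite mulr2n; field.
      by rewrite wd p2 (mulr_natl pi).
    by rewrite (alternatingn (@sinDpi R)) sin0 mulr0.
  have s1 k : sin (k.+1%:R * w * - (d / 2) + 0) = 0.
    by rewrite addr0 mulrN sinN -[_ * _]addr0 s0 oppr0.
  rewrite /D !big1 ?mulr0 ?addr0; last 2 first.
  - by move=> k _; rewrite s1 mulr0.
  - by move=> k _; rewrite s0 mulr0.
  by rewrite opprK -splitr.
exists (fun t => N%:R^-1 * \sum_(n < N) D n t); split.
  move=> t; apply: is_derive1Z; move: {N0} N; elim=> [|N IH].
    have -> : (fun x : R => \sum_(n < 0) D n x) = cst 0.
      by apply/funext => x; rewrite big_ord0.
    by rewrite big_ord0; exact: is_derive_cst.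
  rewrite big_ord_recr /=.
  have -> : (fun x : R => \sum_(n < N.+1) D n x) = (fun x => \sum_(n < N) D n x + D N x).
    by apply/funext => x; rewrite big_ord_recr.
  exact: is_derive1D.
rewrite -mulrBr -sumrB (eq_bigr (fun=> d)) // sumr_const card_ord -[d *+ N]mulr_natl.
by rewrite mulKf // pnatr_eq0 -lt0n.
Qed.

End FejerKernel.

(** Comparison with a telescoping sum: the partial sums of 1 / k^2 up to k = n are at most 2 - 1 /
    n. *)
Lemma inv_sq_series_cvg {R : realType} (u : nat -> R) (c : R) :
  (forall k, `|u k| <= c / k.+1%:R ^+ 2) -> cvgn (series u).
Proof.
move=> uc; have c0 : 0 <= c by apply: le_trans (normr_ge0 (u 0%N)) _; have := uc 0%N; rewrite expr1n divr1.
apply: normed_cvg; set v := fun n => `|u n|; rewrite -/(series v); apply: nondecreasing_is_cvgn.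
  by apply/nondecreasing_seqP => n /=; rewrite seriesSr lerDl.
exists (2 * c) => _ [n _ <-] /=.
apply: (le_trans (_ : _ <= series v n.+1)).
  by rewrite [leRHS]seriesSr lerDl normr_ge0.
suff : series v n.+1 <= c * (2 - n.+1%:R^-1).
  move=> /le_trans; apply; rewrite mulrC ler_wpM2r // gerBl invr_ge0 //.
elim: n => [|n IH].
  rewrite seriesEnat /= big_nat1 invr1 (_ : 2 - 1 = 1); last by ring.
  by have := uc 0%N; rewrite expr1n divr1 mulr1.
rewrite seriesSr; apply: le_trans (lerD IH (uc n.+1)) _.
rewrite -mulrDr ler_wpM2l // -addrA lerD2l.
rewrite -[n.+2%:R]natr1; have : 0 < n.+1%:R :> R by [].
move: (n.+1%:R : R) => s s0; have s1 : 0 < s + 1 by rewrite addr_gt0.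
rewrite -subr_ge0 (_ : _ - _ = (s * (s + 1) ^+ 2)^-1); last by field; rewrite !gt_eqF.
by rewrite invr_ge0 mulr_ge0 // ?exprn_ge0 // ltW.
Qed.

Lemma geometric_sum_le {R : realType} (r : R) n : 0 <= r < 1 ->
  \sum_(k < n) r ^+ k <= (1 - r)^-1.
Proof.
case/andP=> r0 r1; have s0 : 0 < 1 - r by rewrite subr_gt0.
rewrite -(ler_pM2l s0) mulfV ?gt_eqF // -opprB mulNr -subrX1 opprB gerBl.
exact: exprn_ge0.
Qed.

Lemma cvgn_norm_le {R : realType} (u : nat -> R) (l B : R) :
  u @ \oo --> l -> (forall n, `|u n| <= B) -> `|l| <= B.
Proof.
move=> /cvgnP ul uB; apply/ler_addgt0Pr => e /ul[n /(_ n (leqnn n))].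
have := uB n; have := ler_normB (u n) (u n - l); rewrite opprB addrC subrK; lra.
Qed.

Lemma tends_cvgn {R : realType} (F : R -> R) (l a d : R) : 0 < d -> tends F l ->
  (fun n : nat => F (a + n%:R * d)) @ \oo --> l.
Proof.
move=> d0 Fl; apply/cvgnP => e e0.
have [x0 h] := Fl _ (divr_gt0 e0 (ltr0n R 2)).
have := archi_boundP (normr_ge0 ((x0 - a) / d)); set N := Num.bound _ => hN.
exists N => n Nn; apply: le_lt_trans (h _ _) _; last first.
  by rewrite ltr_pdivrMr // ltr_pMr // ltr1n.
rewrite addrC -lerBlDr -ler_pdivrMr //; apply: le_trans (ler_norm _) _.
by apply: le_trans (ltW hN) _; rewrite ler_nat.
Qed.

(** * Poisson summation *)

Section PoissonSummation.
Context {R : realType}.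
Implicit Types (x y u v w : R) (h : R -> R) (n N k : nat).

Variables (m : nat) (d x : R).
Hypothesis d0 : 0 < d.

(* [I] is the integral of [expE m.+1 * h] over the real line, seen through a
   primitive. *)
Definition expE_integral h (I : R) : Prop := exists F c,
  [/\ forall u, is_derive u 1 F (expE m.+1 u * h u), 0 <= c,
      forall u, `|F u| <= c * expR u & tends F I].

Lemma expE_integral_ext h h' I : h =1 h' -> expE_integral h I -> expE_integral h' I.
Proof. by move=> /funext ->. Qed.

Lemma expE_integralD h h' I I' : expE_integral h I -> expE_integral h' I' ->
  expE_integral (fun u => h u + h' u) (I + I').
Proof.
move=> [F [c [dF c0 eF tF]]] [F' [c' [dF' c0' eF' tF']]].
exists (fun u => F u + F' u), (c + c'); split.
- by move=> u; rewrite mulrDr; exact: is_derive1D.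
- exact: addr_ge0.
- by move=> u; rewrite mulrDl; apply: le_trans (ler_normD _ _) _; exact: lerD.
- exact: tendsD.
Qed.

Lemma expE_integralZ a h I : expE_integral h I ->
  expE_integral (fun u => a * h u) (a * I).
Proof.
move=> [F [c [dF c0 eF tF]]]; exists (fun u => a * F u), (`|a| * c); split.
- by move=> u; rewrite mulrCA; exact: is_derive1Z.
- exact: mulr_ge0.
- by move=> u; rewrite normrM -mulrA ler_wpM2l.
- exact: tendsZ.
Qed.

Lemma expE_integral0 : expE_integral (fun=> 0) 0.
Proof.
exists (cst 0), 0; split => //.
- by move=> u; rewrite mulr0; exact: is_derive_cst.
- by move=> u; rewrite normr0 mul0r.
- by move=> e e0; exists 0 => u _; rewrite subrr normr0 ltW.
Qed.

Lemma expE_integral_sum n (h : nat -> R -> R) (I : nat -> R) :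
  (forall k, expE_integral (h k) (I k)) ->
  expE_integral (fun u => \sum_(k < n) h k u) (\sum_(k < n) I k).
Proof.
move=> hI; elim: n => [|n IH].
  rewrite big_ord0; apply: expE_integral_ext expE_integral0 => u.
  by rewrite big_ord0.
rewrite big_ord_recr; apply: expE_integral_ext (expE_integralD IH (hI n)) => u.
by rewrite big_ord_recr.
Qed.

Lemma expE_integral_cos w ph :
  expE_integral (fun u => cos (w * u + ph)) (gamma_integral m w ph).
Proof.
have [F [dF eF tF]] := @gamma_primitive R m w ph.
by exists F, (m%:R ^+ m); split=> //; exact: exprn_ge0.
Qed.

Let om : R := pi *+ 2 / d.

(** The integral of g(u) cos(k om (x - u)) over u: frequency and phase of the Gamma integral are
    chosen to produce this cosine. *)
Definition fourier_term k : R := gamma_integral m (- (k%:R * om)) (k%:R * om * x).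

Definition fourier_sum n : R :=
  gamma_integral m 0 0 + 2 * \sum_(k < n) fourier_term k.+1.

(** The Cesaro mean of the Fourier partial sums is the integral of g against the Fejer kernel
    centred at x. *)
Lemma expE_integral_fejer N : expE_integral (fun u => fejer N (om * (x - u)))
  (N%:R^-1 * \sum_(n < N) fourier_sum n).
Proof.
apply: expE_integralZ; apply: (expE_integral_sum N (h := fun n u => dirichlet n (om * (x - u)))).
move=> n; apply: expE_integralD.
  apply: expE_integral_ext (expE_integral_cos 0 0) => u.
  by rewrite mul0r addr0 cos0.
apply: expE_integralZ.
apply: (expE_integral_sum n (h := fun k u => cos (k.+1%:R * (om * (x - u))))
  (I := fun k => fourier_term k.+1)) => k.
apply: expE_integral_ext (expE_integral_cos _ _) => u.
by congr cos; ring.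
Qed.

Let omd : om * d = pi *+ 2. Proof. by rewrite /om divfK // gt_eqF. Qed.
Let om0 : om != 0.
Proof. by rewrite /om mulf_neq0 ?invr_eq0 ?gt_eqF // pmulrn_lgt0 // pi_gt0. Qed.

Lemma logistic'_le_norm y : logistic' y <= expR (- `|y|).
Proof.
have [y0|y0] := leP 0 y; first by rewrite ger0_norm // logistic'_le_expRN.
by rewrite ltr0_norm // opprK logistic'_le_expR.
Qed.

Section Cell.
Variables (c : R) (N : nat) (Phi : R -> R) (dl : R).
Hypotheses (c0 : 0 < c) (N0 : (0 < N)%N) (dl0 : 0 < dl).
Hypothesis dPhi : forall u, is_derive u 1 Phi (expE m.+1 u * fejer N (om * (x - u))).
Hypothesis dexpE_le : forall u,
  `|m.+1%:R * expE m.+1 u - expE m.+2 u| <= c * logistic' u.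

Let eps := d * (dl * d + d / (N%:R * dl)).

(* The kernel concentrates at the lattice points: on a cell of the lattice
   |w| K(w) <= d |s| K(w) <= d (dl + s^2 / dl) K(w) with s = sin(om w / 2), and
   s^2 K <= 1 / N. *)
Lemma cell_estimate y : (forall w, fejer N (om * (x - (y + w))) = fejer N (om * w)) ->
  `|Phi (y + d / 2) - Phi (y - d / 2) - d * expE m.+1 y| <=
  c * expR (d / 2) * expR (- `|y|) * eps.
Proof.
move=> per; have [d0' c0' dl0'] : [/\ 0 < d, 0 < c & 0 < dl] by [].
have N0' : 0 < N%:R :> R by rewrite ltr0n.
have [kap [dkap ekap]] := @fejer_primitive R N om d N0 om0 omd.
move EL : (c * expR (d / 2) * expR (- `|y|)) => L.
have L0 : 0 <= L by rewrite -EL !mulr_ge0 ?expR_ge0 // ltW.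
have dG w : is_derive w 1 (fun w => Phi (w + y) - expE m.+1 y * kap w)
    ((expE m.+1 (y + w) - expE m.+1 y) * fejer N (om * w)).
  have h1 : is_derive w 1 (fun w => Phi (w + y)) (expE m.+1 (y + w) * fejer N (om * w)).
    by apply: is_derive1_shift; rewrite -per [w + y]addrC; exact: dPhi.
  by apply: (is_derive_eq (is_derive1B h1 (is_derive1Z _ (dkap w)))); ring.
have dB w : is_derive w 1 (fun w => (L * d) * (dl * kap w + (N%:R * dl)^-1 * w))
    ((L * d) * (dl * fejer N (om * w) + (N%:R * dl)^-1)).
  have h1 := is_derive1Z dl (dkap w).
  have h2 := is_derive1Z (N%:R * dl)^-1 (is_derive_id w 1).
  by apply: (is_derive_eq (is_derive1Z (L * d) (is_derive1D h1 h2))); rewrite mulr1.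
have dd : - (d / 2) <= d / 2 by lra.
have bd w : - (d / 2) <= w <= d / 2 ->
   `|(expE m.+1 (y + w) - expE m.+1 y) * fejer N (om * w)| <=
   (L * d) * (dl * fejer N (om * w) + (N%:R * dl)^-1).
  move=> /andP[w1 w2]; have wd : `|w| <= d / 2 by rewrite ler_norml w1 w2.
  have omw : om * w / 2 = pi * (w / d).
    by rewrite /om (_ : pi *+ 2 = 2 * pi :> R) ?mulr_natl //; field; rewrite gt_eqF.
  have wd1 : `|w / d| <= 2^-1.
    by rewrite normrM normfV (gtr0_norm d0') ler_pdivrMr // mulrC.
  have pi0 := @pi_gt0 R; have pi2 := @pi_ge2 R.
  have K0 : 0 <= fejer N (om * w).
    apply: fejer_ge0 => //; rewrite (_ : om * w = pi * (2 * (w / d))); last first.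
      by rewrite mulrCA -omw; field.
    rewrite normrM (gtr0_norm pi0) ler_piMr ?(ltW pi0) // normrM ger0_norm //; lra.
  pose s := sin (om * w / 2).
  have ws : `|w| <= d * `|s|.
    have h : `|om * w / 2| <= pi / 2.
      by rewrite omw normrM (gtr0_norm pi0) ler_pM2l.
    have := jordan_sin h; rewrite -/s omw normrM (gtr0_norm pi0) => h2.
    have h3 : 2 * `|w / d| <= pi * `|w / d| by rewrite ler_wpM2r.
    rewrite -ler_pdivrMl // mulrC -{1}(gtr0_norm d0') -normfV -normrM; lra.
  (* On a half cell |z| >= |y| - d/2, so the decay e^(-|z|) of the derivative costs at most the
     factor e^(d/2) contained in L. *)
  have incr : `|expE m.+1 (y + w) - expE m.+1 y| <= L * `|w|.
    have key z : `|z - y| <= d / 2 -> `|m.+1%:R * expE m.+1 z - expE m.+2 z| <= L.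
      move=> zy; apply: le_trans (dexpE_le z) _; rewrite -EL -mulrA ler_pM2l //.
      apply: le_trans (logistic'_le_norm z) _; rewrite -expRD ler_expR.
      by have := ler_normB z (z - y); rewrite opprB addrC subrK; lra.
    have dg := @is_derive_expE R m.+1.
    have [w0|w0] := leP 0 w.
      have [z [z1 z2 ->]] := mean_value (ltac:(by rewrite lerDl) : y <= y + w) dg.
      rewrite addrAC subrr add0r normrM ler_wpM2r //; apply: key.
      rewrite ler_distl (le_trans _ z1) ?(le_trans z2) ?lerD2l // gerBl.
      by rewrite (le_trans w0).
    have [z [z1 z2 e]] := mean_value (ltac:(by rewrite gerDl ltW) : y + w <= y) dg.
    rewrite distrC e (_ : y - (y + w) = - w); last by ring.
    rewrite normrM normrN ler_wpM2r //; apply: key.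
    rewrite ler_distl (le_trans _ z1) ?lerD2l //= (le_trans z2) // lerDl.
    by rewrite divr_ge0 // ltW.
  have NK : fejer N (om * w) * s ^+ 2 <= N%:R^-1.
    rewrite -(ler_pM2l N0') fejer_sin // mulfV ?gt_eqF //.
  have sd : `|s| <= dl + s ^+ 2 / dl.
    rewrite -lerBlDl ler_pdivlMr // -[s ^+ 2]real_normK ?num_real //.
    have := sqr_ge0 (`|s| - dl); have := mulr_ge0 (normr_ge0 s) (ltW dl0); lra.
  rewrite normrM (ger0_norm K0); apply: le_trans (ler_wpM2r K0 incr) _.
  rewrite -[leLHS]mulrA -[leRHS]mulrA; apply: ler_wpM2l => //.
  apply: le_trans (ler_wpM2r K0 ws) _; rewrite -mulrA ler_pM2l //.
  apply: le_trans (ler_wpM2r K0 sd) _; rewrite mulrDl lerD2l.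
  rewrite mulrAC ler_pdivrMr // mulrC.
  by rewrite invfM -[leRHS]mulrA mulVf ?mulr1 // gt_eqF.
have := derive_norm_le dG dB dd bd.
rewrite /eps [d / 2 + y]addrC [- (d / 2) + y]addrC.
have -> : Phi (y + d / 2) - expE m.+1 y * kap (d / 2) -
  (Phi (y - d / 2) - expE m.+1 y * kap (- (d / 2))) =
  Phi (y + d / 2) - Phi (y - d / 2) - (kap (d / 2) - kap (- (d / 2))) * expE m.+1 y by ring.
rewrite ekap => h; apply: le_trans h _.
rewrite -mulrBr -mulrA ler_wpM2l // ler_pM2l //.
have -> : dl * kap (d / 2) + (N%:R * dl)^-1 * (d / 2) -
  (dl * kap (- (d / 2)) + (N%:R * dl)^-1 * - (d / 2)) =
  dl * (kap (d / 2) - kap (- (d / 2))) + (d / 2 + d / 2) / (N%:R * dl) by ring.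
by rewrite ekap -splitr.
Qed.

End Cell.

(** The point k on the right is paired with k + 1 on the left, so that each lattice point, x itself
    included, is met exactly once. *)
Definition lattice_term k : R := expE m.+1 (x + k%:R * d) + expE m.+1 (x - k.+1%:R * d).

Let lattice := lattice_term.

Let geo k : R := expR `|x| * expR (- d) ^+ k.

Let geo_sum n : \sum_(k < n) geo k <= expR `|x| / (1 - expR (- d)).
Proof.
rewrite -mulr_sumr ler_pM2l ?expR_gt0 //; apply: geometric_sum_le.
by rewrite expR_ge0 expR_lt1 oppr_lt0.
Qed.

Let norm_lattice k (y : R) : k%:R * d - `|x| <= `|y| -> expR (- `|y|) <= geo k.
Proof.
move=> h; rewrite /geo -expRM_natl -expRD ler_expR; lra.
Qed.

Let norm_right k : k%:R * d - `|x| <= `|x + k%:R * d|.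
Proof.
have := ler_normB (x + k%:R * d) x; rewrite addrAC subrr add0r.
by have := ler_norm (k%:R * d); lra.
Qed.

Let norm_left k : k%:R * d - `|x| <= `|x - k.+1%:R * d|.
Proof.
have -> : k.+1%:R * d = k%:R * d + d by rewrite -[k.+1%:R]natr1 mulrDl mul1r.
have := ler_normB x (x - (k%:R * d + d)); rewrite opprB addrC subrK.
by have := ler_norm (k%:R * d + d); have d0' := d0; lra.
Qed.

Lemma lattice_cvg : cvgn (series lattice).
Proof.
have [c c0 hc] := @expE_le_logistic' R m.
apply: nondecreasing_is_cvgn.
  apply/nondecreasing_seqP => n; rewrite seriesSr lerDl.
  by rewrite ltW // addr_gt0 // expE_gt0.
exists (2 * c * (expR `|x| / (1 - expR (- d)))) => _ [n _ <-].
rewrite seriesEord /=; apply: le_trans (_ : 2 * c * \sum_(k < n) geo k <= _); last first.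
  by rewrite ler_pM2l ?mulr_gt0.
rewrite mulr_sumr; apply: ler_sum => k _; rewrite -mulrA mulr_natl mulr2n.
apply: lerD; apply: le_trans (hc _) _; rewrite ler_pM2l //;
  apply: le_trans (logistic'_le_norm _) _; exact: norm_lattice.
Qed.

(** The 2n cells of length d around lattice points tile the interval from [b n] to [a n], and the
    errors of [cell_estimate] decay like e^(-|y|), so they sum geometrically. As n -> oo the
    primitive tends to the full integral on the right and to 0 on the left. *)
Lemma fejer_lattice_estimate : exists2 B : R, 0 < B & forall N (dl : R), (0 < N)%N -> 0 < dl ->
  `|N%:R^-1 * \sum_(n < N) fourier_sum n - d * limn (series lattice)| <=
  B * (dl + (N%:R * dl)^-1).
Proof.
have d0' := d0.
have [c1 c10 h1] := @expE_le_logistic' R m.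
have [c2 c20 h2] := @expE_le_logistic' R m.+1.
pose c := m.+1%:R * c1 + c2.
have c0 : 0 < c by rewrite addr_gt0 // mulr_gt0.
have dexpE u : `|m.+1%:R * expE m.+1 u - expE m.+2 u| <= c * logistic' u.
  apply: le_trans (ler_normB _ _) _.
  have g1 : 0 < m.+1%:R * expE m.+1 u by rewrite mulr_gt0 // expE_gt0.
  rewrite (gtr0_norm g1) (gtr0_norm (expE_gt0 _ _)) /c.
  rewrite mulrDl -mulrA lerD //.
  by rewrite ler_pM2l.
have r1 : 0 < 1 - expR (- d) by rewrite subr_gt0 expR_lt1 oppr_lt0.
pose S := expR `|x| / (1 - expR (- d)).
pose C := c * expR (d / 2).
have S0 : 0 < S by rewrite divr_gt0 ?expR_gt0.
have C0 : 0 < C by rewrite mulr_gt0 ?expR_gt0.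
exists (C * (2 * S) * (d * d)); first exact: mulr_gt0 (mulr_gt0 C0 (mulr_gt0 (ltr0n R 2) S0)) (mulr_gt0 d0 d0).
move=> N dl N0 dl0; have N0' : 0 < N%:R :> R by rewrite ltr0n.
have [F [cF [dF cF0 eF tF]]] := expE_integral_fejer N.
set I := _ * _ in tF *; pose eps := d * (dl * d + d / (N%:R * dl)).
have eps0 : 0 < eps.
  by apply: mulr_gt0 => //; apply: addr_gt0; rewrite ?divr_gt0 ?mulr_gt0.
pose a n := x - d / 2 + n%:R * d; pose b n := x - d / 2 - n%:R * d.
have per_right k w : fejer N (om * (x - (x + k%:R * d + w))) = fejer N (om * w).
  rewrite -fejerN -[RHS](fejer_periodic _ k); congr fejer.
  by rewrite -omd -mulr_natl; ring.
have per_left k w : fejer N (om * (x - (x - k.+1%:R * d + w))) = fejer N (om * w).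
  rewrite -[RHS]fejerN -[RHS](fejer_periodic _ k.+1); congr fejer.
  by rewrite -omd -mulr_natl; ring.
have bd (k : nat) (z : R) : k%:R * d - `|x| <= `|z| -> C * expR (- `|z|) * eps <= C * eps * geo k.
  by move=> h; have {}h := norm_lattice h; rewrite mulrAC ler_wpM2l // ltW // mulr_gt0.
have cells n : `|F (a n) - F (b n) - d * series lattice n| <=
    C * eps * (2 * \sum_(k < n) geo k).
  elim: n => [|n IH].
    rewrite /a /b seriesEord /= !big_ord0 mul0r addr0 subr0 subrr mulr0 subr0 normr0.
    by rewrite !mulr0.
  have hr := cell_estimate c0 N0 dl0 dF dexpE (per_right n).
  have hl := cell_estimate c0 N0 dl0 dF dexpE (per_left n).
  have er : x + n%:R * d + d / 2 = a n.+1 by rewrite /a -[n.+1%:R]natr1; field.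
  have er' : x + n%:R * d - d / 2 = a n by rewrite /a; ring.
  have el : x - n.+1%:R * d + d / 2 = b n by rewrite /b -[n.+1%:R]natr1; field.
  have el' : x - n.+1%:R * d - d / 2 = b n.+1 by rewrite /b; ring.
  rewrite er er' in hr; rewrite el el' in hl.
  rewrite seriesSr big_ord_recr /= /lattice /lattice_term.
  have -> : F (a n.+1) - F (b n.+1) - d * (series lattice n +
      (expE m.+1 (x + n%:R * d) + expE m.+1 (x - n.+1%:R * d))) =
     (F (a n) - F (b n) - d * series lattice n) +
     ((F (a n.+1) - F (a n) - d * expE m.+1 (x + n%:R * d)) +
      (F (b n) - F (b n.+1) - d * expE m.+1 (x - n.+1%:R * d))) by ring.
  apply: le_trans (ler_normD _ _) _; rewrite [2 * _]mulrDr mulrDr; apply: lerD => //.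
  apply: le_trans (ler_normD _ _) _; rewrite [2 * geo n]mulr_natl mulr2n [leRHS]mulrDr.
  apply: lerD; first exact: le_trans hr (bd _ _ (norm_right n)).
  exact: le_trans hl (bd _ _ (norm_left n)).
have -> : C * (2 * S) * (d * d) * (dl + (N%:R * dl)^-1) = C * eps * (2 * S).
  by rewrite /eps; ring.
have ta : (fun n => F (a n)) @ \oo --> I by exact: tends_cvgn.
have tb : (fun n => F (b n)) @ \oo --> (0 : R).
  have -> : (fun n => F (b n)) = (fun n => F (- (- (x - d / 2) + n%:R * d))).
    by apply/funext => n; rewrite opprD opprK.
  apply: (tends_cvgn (F := fun u => F (- u))) => // e e0.
  have cF1 : 0 < cF + 1 by rewrite ltr_wpDl.
  have [u0 h] := expRN_small (divr_gt0 e0 cF1).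
  exists u0 => u /h; rewrite subr0 ler_pdivlMr // mulrC => h'.
  apply: le_trans (eF _) _; apply: le_trans h'; rewrite ler_pM2r ?expR_gt0 //.
  by rewrite lerDl.
have cv : (fun n => F (a n) - F (b n) - d * series lattice n) @ \oo -->
    I - 0 - d * limn (series lattice).
  apply: cvgB; first exact: cvgB.
  by apply: cvgMr; exact: lattice_cvg.
rewrite -[I]subr0; apply: (cvgn_norm_le cv) => n.
exact: le_trans (cells n) (ler_wpM2l (ltW (mulr_gt0 C0 eps0))
  (ler_wpM2l (ler0n R 2) (geo_sum n))).
Qed.

Lemma gamma_series_cvg (ph : nat -> R) :
  cvgn (series (fun k => gamma_integral m (- (k.+1%:R * om)) (ph k))).
Proof.
have [c c0 hc] := @gamma_integral_decay R m.
apply: (inv_sq_series_cvg (c := c / om ^+ 2)) => k.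
apply: le_trans (hc _ _ _) _; first by rewrite oppr_eq0 mulf_neq0 ?pnatr_eq0.
by rewrite sqrrN exprMn invfM mulrCA [leRHS]mulrC.
Qed.

(** The Fourier series converges because its terms decay like 1 / k^2, so its Cesaro means have the
    same limit; [fejer_lattice_estimate] identifies it as the lattice sum. *)
Theorem poisson_summation :
  gamma_integral m 0 0 + 2 * limn (series (fun k => fourier_term k.+1)) =
  d * limn (series lattice).
Proof.
set A := LHS; have [B B0 hB] := fejer_lattice_estimate.
have cA : fourier_sum @ \oo --> A.
  apply: cvgD; first exact: cvg_cst.
  have cf : cvgn (series (fun k => fourier_term k.+1)) by exact: gamma_series_cvg.
  by apply: cvgMr; move: cf; rewrite seriesEord.
have /cvgnP cm := cesaro cA.
apply/eqP; rewrite -subr_eq0 -normr_le0; apply/ler_addgt0Pr => e e0; rewrite add0r.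
(* This makes B (dl + dl) = e / 2; then 1 / (N + 1) < dl^2 brings the second error term below dl,
   and the Cesaro mean accounts for e / 4. *)
pose dl := e / (4 * B); have dl0 : 0 < dl by rewrite divr_gt0 ?mulr_gt0.
have e4 : 0 < e / 4 by rewrite divr_gt0.
have [N0 h] := cm _ e4.
have /cvgnP hh := @cvg_harmonic R.
have [N1 h1] := hh _ (mulr_gt0 dl0 dl0).
pose N := maxn N0 N1.
have {}h := h N (leq_maxl _ _); have {}h1 := h1 N (leq_maxr _ _).
have := hB N.+1 dl isT dl0.
rewrite /arithmetic_mean seriesEord /= in h.
move: h; set M := _ * \sum_(_ < _) _ => h hM.
rewrite subr0 /= ger0_norm ?invr_ge0 // in h1.
have h2 : (N.+1%:R * dl)^-1 <= dl.
  by rewrite invfM ler_pdivrMr // ltW.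
have h3 : B * (dl + (N.+1%:R * dl)^-1) <= e / 2.
  apply: le_trans (_ : B * (dl + dl) <= _); first by rewrite ler_pM2l // lerD2l.
  by rewrite /dl; have -> : B * (e / (4 * B) + e / (4 * B)) = e / 2 by field; rewrite gt_eqF.
have := ler_normB (M - d * limn (series lattice)) (M - A).
rewrite (_ : _ - _ - (M - A) = A - d * limn (series lattice)); last by ring.
move=> /le_trans; apply; apply: le_trans (lerD (le_trans hM h3) (ltW h)) _.
lra.
Qed.

End PoissonSummation.

(** * The function psi as a real Fourier series *)

Section PsiE.
Context {R : realType}.
Implicit Types (m n k : nat) (w x y ph c : R).

Lemma gamma_integralD m w x y : gamma_integral m w (x + y) =
  cos y * gamma_integral m w x - sin y * gamma_integral m w (x - pi / 2).
Proof.
have iZ a ph : lebesgue_measure.-integrable (`]0, +oo[ : set R)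
    (EFin \o (fun t => a * gamma_integrand m w ph t)).
  rewrite (_ : EFin \o _ = fun t => (a%:E * (EFin \o gamma_integrand m w ph) t)%E) //.
  by apply: integrableZl; [exact: measurable_itv|exact: integrable_gamma].
rewrite /gamma_integral -!RintegralZl //; try exact: integrable_gamma.
rewrite -RintegralB //; apply: eq_Rintegral => t _; rewrite /gamma_integrand.
rewrite addrA cosD [cos (_ + (_ - _))](_ : _ = sin (w * ln t + x)); first by ring.
by rewrite addrA cosBpihalf.
Qed.

Lemma gamma_integralN m w ph : gamma_integral m (- w) (- ph) = gamma_integral m w ph.
Proof.
by apply: eq_Rintegral => t _; rewrite /gamma_integrand mulNr -opprD cosN.
Qed.

Lemma gamma_integralDpi m w ph : gamma_integral m w (ph + pi) = - gamma_integral m w ph.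
Proof. by rewrite gamma_integralD cospi sinpi mul0r subr0 mulN1r. Qed.

(** The phase -pi / 2 turns the cosine into the sine of the imaginary part. *)
Lemma cGammaE m w : cGamma ((m.+1%:R)%:C + w%:C * 'i) =
  gamma_integral m w 0 +i* gamma_integral m w (- (pi / 2)).
Proof.
rewrite /cGamma; have -> : (m.+1%:R)%:C + w%:C * 'i - 1 = m%:R +i* w :> R[i].
  by apply/eqP; rewrite eq_complex /= -natr1; apply/andP; split; apply/eqP; ring.
congr (_ +i* _); apply: eq_Rintegral => t; rewrite inE /= in_itv /= andbT => t0;
  rewrite /gamma_integrand powR_mulrn ?(ltW t0) //.
  by rewrite addr0; ring.
by rewrite cosBpihalf; ring.
Qed.

(** Multiplication by e^(iy) shifts the phase of the Gamma integral by y. With m + 2 leaves the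
    argument is m + 1 - iw, which corresponds to the exponent m of [gamma_integral]. *)
Lemma fE_cexpi c m w y : fE c m.+2 (- 1 - w%:C * 'i) * cexpi y =
  (c / (m.+2`!)%:R)%:C * (gamma_integral m (- w) y +i* gamma_integral m (- w) (y - pi / 2)).
Proof.
have -> : fE c m.+2 (- 1 - w%:C * 'i) = (c / (m.+2`!)%:R)%:C * cGamma ((m.+1%:R)%:C + (- w)%:C * 'i).
  rewrite /fE mulrAC -[(m.+2`!)%:R](rmorph_nat (real_complex R)) -fmorphV -rmorphM.
  congr (_ * cGamma _); rewrite -[m.+2%:R](rmorph_nat (real_complex R)) -natr1 rmorphD rmorph1.
  by rewrite rmorphN mulNr; ring.
rewrite cGammaE -mulrA; congr (_ * _).
have -> : gamma_integral m (- w) y = cos y * gamma_integral m (- w) 0 -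
    sin y * gamma_integral m (- w) (- (pi / 2)).
  by rewrite -[y in LHS]add0r gamma_integralD sub0r.
have -> : gamma_integral m (- w) (y - pi / 2) = sin y * gamma_integral m (- w) 0 +
    cos y * gamma_integral m (- w) (- (pi / 2)).
  by rewrite -[y - _]add0r gamma_integralD sub0r cosBpihalf sinBpihalf mulNr opprK.
by apply/eqP; rewrite eq_complex /=; apply/andP; split; apply/eqP; ring.
Qed.

Lemma cseriesZ a (u v : nat -> R) : cvgn (series u) -> cvgn (series v) ->
  cseries (fun n => a%:C * (u n +i* v n)) =
  a%:C * (limn (series u) +i* limn (series v)).
Proof.
move=> cu cv.
have h (w : nat -> R) : cvgn (series w) -> limn (series (fun n => a * w n)) = a * limn (series w).
  move=> cw; apply/cvg_lim => //.
  have -> : series (fun n => a * w n) = (fun n => a * series w n).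
    by apply/funext => n; rewrite /= !seriesEord /= mulr_sumr.
  exact: cvgMr.
rewrite /cseries /=.
have -> : (fun n => a * u n - 0 * v n) = (fun n => a * u n).
  by apply/funext => n; rewrite mul0r subr0.
have -> : (fun n => a * v n + 0 * u n) = (fun n => a * v n).
  by apply/funext => n; rewrite mul0r addr0.
rewrite !h //; apply/eqP; rewrite eq_complex /=; apply/andP.
by split; apply/eqP; ring.
Qed.

Lemma gamma_integral_quarter m : gamma_integral m 0 (- (pi / 2)) = 0 :> R.
Proof.
have h1 := gamma_integralN m 0 (pi / 2); rewrite oppr0 in h1.
have h2 := gamma_integralDpi m 0 (- (pi / 2)).
rewrite (_ : - (pi / 2) + pi = pi / 2) in h2; last by field.
by rewrite -h1 in h2; move: h2; move: (gamma_integral _ _ _) => a; lra.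
Qed.

(** The terms k and -k are complex conjugates, so the imaginary parts of the two half-series cancel
    and the real parts double. *)
Lemma fourier_csumZ c m (d x : R) : 0 < d ->
  csumZ (fun k : int => fE c m.+2 (- 1 - (2 * pi * k%:~R / d)%:C * 'i) *
                    cexpi (2 * pi * k%:~R * x / d)) =
  (c / (m.+2`!)%:R * (gamma_integral m 0 0 +
     2 * limn (series (fun k => fourier_term m d x k.+1))))%:C.
Proof.
move=> d0; set a := c / _.
pose om : R := pi *+ 2 / d.
have pi2 : 2 * pi = pi *+ 2 :> R by rewrite mulr_natl.
pose u k := fourier_term m d x k.+1.
pose v k := gamma_integral m (- (k.+1%:R * om)) (k.+1%:R * om * x - pi / 2).
have cu : cvgn (series u) by exact: gamma_series_cvg.
have cv : cvgn (series v) by exact: gamma_series_cvg.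
have cvN : cvgn (series (- v)) by rewrite is_cvg_seriesN.
pose T (w : R) := a%:C * (gamma_integral m (- (w * om)) (w * om * x) +i*
  gamma_integral m (- (w * om)) (w * om * x - pi / 2)).
have -> : (fun k : int => fE c m.+2 (- 1 - (2 * pi * k%:~R / d)%:C * 'i) *
      cexpi (2 * pi * k%:~R * x / d)) = (fun k : int => T k%:~R).
  apply/funext => k; rewrite fE_cexpi -/a /T pi2.
  have -> : pi *+ 2 * k%:~R / d = k%:~R * om by rewrite /om; ring.
  by have -> : pi *+ 2 * k%:~R * x / d = k%:~R * om * x by rewrite /om; ring.
rewrite /csumZ.
have -> : (fun n : nat => T (Posz n.+1)%:~R) = (fun n => a%:C * (u n +i* v n)) by [].
have -> : (fun n : nat => T (- Posz n.+1)%:~R) = (fun n => a%:C * (u n +i* (- v) n)).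
  apply/funext => n; rewrite /T mulrNz -pmulrn !mulNr gamma_integralN.
  rewrite -opprD gamma_integralN.
  have -> : n.+1%:R * om * x + pi / 2 = n.+1%:R * om * x - pi / 2 + pi by field.
  by rewrite gamma_integralDpi.
rewrite !cseriesZ // lim_seriesN // mulr0z /T !mul0r oppr0 sub0r gamma_integral_quarter.
by apply/eqP; rewrite eq_complex /=; apply/andP; split; apply/eqP; ring.
Qed.

End PsiE.

(** * The renewal limit in the aperiodic and periodic cases *)

Section RenewalLimit.
Context {R : realType}.
Variables (p : R) (m : nat).
Hypothesis hp : 0 < p < 1.

Let Z : R -> R := renewal p (expE m.+1).

Let lnp0 : ln p < 0. Proof. by rewrite ln_lt0. Qed.
Let lnq0 : ln (1 - p) < 0.
Proof. by case/andP: hp => p0 p1; rewrite ln_lt0 // subr_gt0 p1 /= gtrBl. Qed.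

Let g0 x : 0 <= expE m.+1 x :> R. Proof. by rewrite ltW // expE_gt0. Qed.

Let ZE x : Z x = expE m.+1 x + (p * Z (x + ln p) + (1 - p) * Z (x + ln (1 - p))).
Proof. exact: renewal_expE_eq. Qed.

Let Z0 x : 0 <= Z x. Proof. exact: renewal_expE_ge0. Qed.

Lemma entropyE : - (p * ln p) - (1 - p) * ln (1 - p) = entropy p.
Proof. by rewrite /entropy mulNr. Qed.

Lemma entropy_gt0 : 0 < entropy p.
Proof.
case/andP: hp => p0 p1; rewrite -entropyE addr_gt0 // oppr_gt0 nmulr_llt0 //.
by rewrite subr_gt0.
Qed.

Lemma slowly_lnp : slowly Z (ln p) /\ slowly Z (ln (1 - p)).
Proof.
have [c [c0 hg hc he hl]] := renewal_expE hp m.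
exact: (slowly_steps hp lnp0 lnq0 c0 ZE Z0 hc he hl g0 hg).
Qed.

Lemma renewal_irrational : ~ log_ratio_rational p ->
  tends (fun x => entropy p * Z x) (m`!)%:R.
Proof.
move=> irr; rewrite -entropyE.
have [c [c0 hg hc he hl]] := renewal_expE hp m.
have [F [dF eF tF]] := @gamma_primitive R m 0 0.
pose c' : R := c + m%:R ^+ m.
have c'c : c <= c' by rewrite lerDl exprn_ge0.
have c'0 : 0 < c' by apply: lt_le_trans c0 c'c.
have [s1 s2] := slowly_lnp.
have cc (y : R) : 0 <= y -> c * y <= c' * y by move=> y0; rewrite ler_wpM2r.
rewrite -gamma_integral_fact.
apply: (@renewal_nonarithmetic R p (ln p) (ln (1 - p)) Z (expE m.+1) c' hp lnp0 lnq0 c'0 ZE Z0 _ _ F).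
- by move=> x; apply: le_trans (he x) (cc _ _); exact: expR_ge0.
- by move=> x y; apply: le_trans (hl x y) (cc _ _).
- apply: (subgroup_dense (u := ln p) (v := ln (1 - p))) => //.
  + exact: slowly0.
  + move=> x y sx sy.
    exact: (slowlyD hp lnp0 lnq0 c0 sx (slowlyN hp lnp0 lnq0 c0 sy)).
  + by rewrite lt_eqF.
- by move=> x; apply: (is_derive_eq (dF x)); rewrite mul0r addr0 cos0 mulr1.
- move=> x; apply: le_trans (eF x) _; rewrite ler_wpM2r ?expR_ge0 //.
  by rewrite lerDr ltW.
- exact: tF.
Qed.

(** [renewal_arithmetic] yields the one-sided sum over lattice points to the left of x, whereas
    Poisson summation needs the two-sided sum; for large x the points to the right contribute only
    O(e^(-x)). *)
Lemma renewal_rational (r : rat) : ln p / ln (1 - p) = ratr r ->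
  let d := - ln p / (numq r)%:~R in
  0 < d /\ tends (fun x => entropy p * Z x -
    d * limn (series (lattice_term m d x))) 0.
Proof.
move=> er d.
have r0 : 0 < r by rewrite -(ltr0q R) -er nmulr_lgt0 // invr_lt0.
have nr0 : 0 < numq r by rewrite numq_gt0.
pose A := `|numq r|%N; pose B := `|denq r|%N.
have eA : (numq r)%:~R = A%:R :> R by rewrite /A -{1}(gtz0_abs nr0).
have eB : (denq r)%:~R = B%:R :> R by rewrite /B -{1}(gtz0_abs (denq_gt0 r)).
have A0 : 0 < A%:R :> R by rewrite -eA ltr0z.
have B0 : 0 < B%:R :> R by rewrite -eB ltr0z denq_gt0.
have d0 : 0 < d by rewrite /d eA divr_gt0 // oppr_gt0.
have elp : ln p = - (A%:R * d) by rewrite /d eA; field; rewrite gt_eqF.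
have elq : ln (1 - p) = - (B%:R * d).
  have : ln p = ratr r * ln (1 - p) by rewrite -er divfK // lt_eqF.
  rewrite /ratr eA eB elp => e.
  have -> : ln (1 - p) = A%:R / B%:R * ln (1 - p) * (B%:R / A%:R) by field; rewrite !gt_eqF.
  by rewrite -e; field; rewrite gt_eqF.
split=> //.
have [c [c0 hg hc he hl]] := renewal_expE hp m.
have sd : slowly Z (- d).
  have [s1 s2] := slowly_lnp.
  have B0' : (0 < B)%N by rewrite -(ltr0n R).
  have A0' : (0 < A)%N by rewrite -(ltr0n R).
  (* A Bezout relation writes -d as an integer combination of ln p = -A d and ln (1 - p) = -B d. *)
  have /coprimeP := coprime_num_den r; rewrite -/A -/B => /(_ A0')[[u v]] /= uv.
  have -> : - d = ln p *+ u + - (ln (1 - p) *+ v).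
    have uv' : u%:R * A%:R = 1 + v%:R * B%:R :> R.
      by rewrite -natrM (_ : (u * A = 1 + v * B)%N) ?natrD ?natrM //; lia.
    rewrite -mulr_natl -[ln (1 - p) *+ v]mulr_natl elp elq.
    have -> : u%:R * - (A%:R * d) = - (u%:R * A%:R * d) by ring.
    by rewrite uv'; ring.
  apply: (slowlyD hp lnp0 lnq0 c0); first exact: (slowlyMn hp lnp0 lnq0 c0).
  exact: (slowlyN hp lnp0 lnq0 c0 (slowlyMn hp lnp0 lnq0 c0 _ s2)).
have [M [hM tM]] := renewal_arithmetic hp lnp0 lnq0 c0 ZE Z0 he d0 elp elq sd.
rewrite entropyE in tM.
have r1 : 0 < 1 - expR (- d) by rewrite subr_gt0 expR_lt1 oppr_lt0.
pose C := c * (1 + (1 - expR (- d))^-1).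
have C0 : 0 < C by rewrite mulr_gt0 // addr_gt0 // invr_gt0.
have cvL x : cvgn (series (lattice_term m d x)) by exact: lattice_cvg.
(* The two sums differ by the terms at x + k d with k > 0, which a geometric series bounds by a
   multiple of e^(-x). *)
have D x : `|limn (series (lattice_term m d x)) - M x| <= C * expR (- x).
  have hM' : (fun n => \sum_(k < n.+1) expE m.+1 (x - k%:R * d)) @ \oo --> M x.
    by have := hM x; rewrite -cvg_shiftS.
  apply: (cvgn_norm_le (cvgB (cvL x) hM')) => n.
  rewrite [X in `|X|](_ : _ = \sum_(k < n) expE m.+1 (x + k%:R * d) - expE m.+1 x); last first.
    rewrite -[LHS]/(series (lattice_term m d x) n - \sum_(k < n.+1) expE m.+1 (x - k%:R * d)).
    rewrite big_ord_recl mul0r subr0 seriesEord /= big_split /=.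
    by rewrite opprD addrCA addrK addrC.
  apply: le_trans (ler_normB _ _) _.
  rewrite !ger0_norm ?sumr_ge0 // /C mulrDr mulr1 mulrDl addrC; apply: lerD.
    by apply: le_trans (hg x) _; rewrite ler_wpM2l ?logistic'_le_expRN // ltW.
  apply: le_trans (_ : _ <= c * (\sum_(k < n) expR (- d) ^+ k) * expR (- x)) _.
    rewrite -mulrA mulr_suml mulr_sumr; apply: ler_sum => k _.
    apply: le_trans (hg _) _; rewrite ler_pM2l //.
    apply: le_trans (logistic'_le_expRN _) _.
    by rewrite -expRM_natl -expRD ler_expR; lra.
  rewrite ler_pM2r ?expR_gt0 // ler_pM2l //; apply: geometric_sum_le.
  by rewrite expR_ge0 expR_lt1 oppr_lt0.
move=> e e0; have e2 : 0 < e / 2 by rewrite divr_gt0.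
have [x0 h0] := tM _ e2.
have [x1 h1] := expRN_small (divr_gt0 e2 (mulr_gt0 d0 C0)).
exists (Num.max x0 x1) => x; rewrite ge_max => /andP[/h0 a0 /h1 a1].
rewrite !subr0 in a0 *.
have := D x; set U := limn _ => hD.
have -> : entropy p * Z x - d * U = - (d * M x - entropy p * Z x) - d * (U - M x) by ring.
apply: le_trans (ler_normB _ _) _; rewrite normrN [e in leRHS]splitr; apply: lerD => //.
rewrite normrM (gtr0_norm d0); apply: le_trans (ler_wpM2l (ltW d0) hD) _.
by rewrite mulrA mulrC -ler_pdivlMr // mulr_gt0.
Qed.

Let fE_opp1 (c : R) : fE c m.+2 (- 1) = (c / (m.+2`!)%:R * (m`!)%:R)%:C.
Proof.
have := fE_cexpi c m 0 0; rewrite mul0r subr0 /cexpi cos0 sin0 mulr1 => ->.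
rewrite oppr0 sub0r gamma_integral_quarter gamma_integral_fact.
by apply/eqP; rewrite eq_complex /=; apply/andP; split; apply/eqP; ring.
Qed.

Lemma psiE_irrational c x : ~ log_ratio_rational p ->
  psiE p c m.+2 x = (c / (m.+2`!)%:R * (m`!)%:R)%:C.
Proof. by move=> irr; rewrite /psiE; case: pselect. Qed.

(** A single real function L represents psi in both cases and is independent of the factor c, so
    that the convergence argument below makes no case distinction. *)
Lemma psiE_asymptotics : exists L : R -> R,
  (forall c x, psiE p c m.+2 x = (c / (m.+2`!)%:R * L x)%:C) /\
  tends (fun x => entropy p * Z x - L x) 0.
Proof.
rewrite /psiE; case: pselect => [h|irr]; last first.
  exists (cst (m`!)%:R); split.
    move=> c x; exact: fE_opp1.
  move=> e /(renewal_irrational irr)[x0 h]; exists x0 => x /h.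
  by rewrite subr0.
move: (svalP (cid h)); move: (sval (cid h)) => r er.
have [d0 tL] := renewal_rational er; move: d0 tL; set d := - ln p / _ => d0 tL.
exists (fun x => d * limn (series (lattice_term m d x))); split=> // c x.
by rewrite (@fourier_csumZ R c m d x d0) (@poisson_summation R m d x d0).
Qed.

End RenewalLimit.

(** * Convergence *)

Section RandomTries.
Context {R : realType} (p : R) (hp : 0 < p < 1).
Context (d : nat -> measure_display) (Omega : forall n : nat, measurableType (d n)).
Context (P : forall n : nat, probability (Omega n) R).
Variable X : forall n : nat, 'I_n -> nat -> {RV (P n) >-> bool}.
Arguments X : clear implicits.
Hypothesis hX : forall n : nat, iid_Be p (X n).

Let Ups n : Omega n -> btree := patricia (fun i j => X n i j : Omega n -> bool).

Arguments Ups : clear implicits.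

Variable V : forall n : nat, Omega n -> seq bool.
Arguments V : clear implicits.
Hypothesis hV : forall n : nat, (0 < n)%N -> uniform_node (P n) (Ups n) (V n).

Let H := entropy p.
Let F n t := fringe_event (Ups n) (V n) t.
Arguments F : clear implicits.

Lemma cprob_given_measurable n t (A : set R) :
  measurable [set w | A (cprob_given (P n) (F n t) (Ups n) w)].
Proof.
exact: (measurable_patricia (X n)
  (fun T => A (cprob (P n) (F n t) [set w' | Ups n w' = T]))).
Qed.

(** Outside the null event [coincident] the conditional probability is [freq], so concentration of
    [freq] is enough. *)
Lemma cvg_in_prob_cprob_given t (c : nat -> R) :
  (forall e eta : R, 0 < e -> 0 < eta -> exists n0, forall n, (n0 <= n)%N ->
    Pr (P n) [set w | e < `|freq R t (Ups n w) - c n|] <= eta) ->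
  cvg_in_prob P (fun n w => `|cprob_given (P n) (F n t) (Ups n) w - c n|) 0.
Proof.
move=> hc e e0.
pose A n := [set w | e < `| `|cprob_given (P n) (F n t) (Ups n) w - c n| - 0|].
have mA n : measurable (A n).
  exact: (cprob_given_measurable n t (fun x => e < `| `|x - c n| - 0|)).
have -> : (fun n => P n (A n)) = EFin \o (fun n => Pr (P n) (A n)).
  by apply/funext => n; rewrite /= PrE.
apply: cvg_EFin; first exact: nearW.
apply/cvgnP => eta eta0; have [n0 h] := hc _ _ e0 (divr_gt0 eta0 (ltr0n R 2)).
exists n0.+1 => n nn0; have n_gt0 : (0 < n)%N by lia.
rewrite subr0 ger0_norm ?Pr_ge0 //.
pose B := [set w | e < `|freq R t (Ups n w) - c n|].
have mB : measurable B by exact: (measurable_patricia (X n) (fun T => e < `|freq R t T - c n|)).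
have mC := measurable_coincident (X n).
have hA : Pr (P n) (A n) <= Pr (P n) (B `|` coincident (X n)).
  apply: le_Pr => //; first exact: measurableU.
  move=> w; rewrite /A /= subr0 normr_id => hw.
  have [co|nco] := pselect (coincident (X n) w); [by right|left].
  rewrite /B /=; have <- : cprob_given (P n) (F n t) (Ups n) w = freq R t (Ups n w).
    exact: (cprob_given_freq hp (hX n) n_gt0 (hV n_gt0) t nco).
  exact: hw.
have := PrU_le (P n) mB mC; rewrite (Pr_coincident hp (hX n)) addr0 => hU.
apply: le_lt_trans (le_trans hA (le_trans hU (h n (ltnW nn0)))) _.
by rewrite ltr_pdivrMr // ltr_pMr // ltr1n.
Qed.

(** Boundedness of c controls the factor 1 + |c n| of [Pr_fringe_approx]; K is chosen last, for each
    n, to make collisions negligible. *)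
Lemma cvg_Pr_fringe t (c : nat -> R) (B : R) :
  (exists n0, forall n, (n0 <= n)%N -> `|c n| <= B) ->
  (forall e eta : R, 0 < e -> 0 < eta -> exists n0, forall n, (n0 <= n)%N ->
    Pr (P n) [set w | e < `|freq R t (Ups n w) - c n|] <= eta) ->
  (fun n => `|Pr (P n) (F n t) - c n|) @ \oo --> (0 : R).
Proof.
move=> [n1 hB] hc; apply/cvgnP => e e0.
have B0 : 0 <= B by apply: le_trans (normr_ge0 (c n1)) (hB n1 (leqnn _)).
have e4 : 0 < e / 4 by rewrite divr_gt0.
have B1 : 0 < 1 + B by rewrite ltr_wpDr.
have eta0 : 0 < e / 4 / (1 + B) by rewrite divr_gt0.
have [n0 h] := hc _ _ e4 eta0; exists (maxn n0.+1 n1) => n.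
rewrite geq_max => /andP[nn0 nn1]; have n_gt0 : (0 < n)%N by lia.
rewrite subr0 normr_id.
have [K /(_ K (leqnn K))] := (cvgnP _ _).1 (collision_cvg0 hp (n%:R ^+ 2)) _ eta0.
rewrite subr0 => /(le_lt_trans (ler_norm _)) hK.
have := Pr_fringe_approx n_gt0 (hV n_gt0) t (c n) K (ltW e4).
have := Pr_not_separated hp (hX n) K.
set u := Pr _ (~` _) => hu; have := h n (ltnW nn0).
set v := Pr _ [set w | _] => hv; have := hB n nn1; have := Pr_ge0 (P n) (~` separated (X n) K).
move: (`|Pr _ _ - _|) => w; rewrite -/u.
have := Pr_ge0 (P n) [set w | e / 4 < `|freq R t (Ups n w) - c n|]; rewrite -/v => v0 u0 cB hw.
have hvu : v + u <= e / 4 / (1 + B) + e / 4 / (1 + B).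
  by apply: lerD => //; apply: le_trans hu (ltW hK).
have h2 : (1 + `|c n|) * (v + u) <= e / 4 + e / 4.
  apply: le_trans (_ : (1 + B) * (e / 4 / (1 + B) + e / 4 / (1 + B)) <= _).
    by apply: ler_pM; rewrite ?addr_ge0 // lerD2l.
  by rewrite -mulrDl mulrC divfK // gt_eqF.
by apply: le_lt_trans hw _; lra.
Qed.

Section Fringe.
Variables (t : btree) (m : nat) (L : R -> R).
Hypothesis tm : nleaves t = m.+2.
Hypothesis HZL : tends (fun x => H * renewal p (expE m.+1) x - L x) 0.

Let pit := pi_t (X m.+2) t.
Let c n : R := pit / (2 * (m.+2`!)%:R * H) * L (ln n%:R).

(** [Pr_freq_approx] has two error terms, each brought below eta / 2: the variance term by taking n
    large, the collision term by taking K large for that n. *)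
Lemma freq_concentration (e eta : R) : 0 < e -> 0 < eta ->
  exists n0, forall n, (n0 <= n)%N ->
    Pr (P n) [set w | e < `|freq R t (Ups n w) - c n|] <= eta.
Proof.
move=> e0 eta0; have H0 := entropy_gt0 hp.
have t1 : (1 < nleaves t)%N by rewrite tm.
have pit0 : 0 <= pit by rewrite /pit /pi_t fine_ge0.
have hpit := fun K => pi_t_approx hp (hX m.+2) K t1 tm.
have e2 : 0 < e / 2 by rewrite divr_gt0.
have [n0 h] := mean_occK_asymptotics hp tm pit0 hpit H0 HZL e2.
pose B : R := 16 / (e ^+ 2 * (eta / 2)).
have B0 : 0 < B by rewrite divr_gt0 ?mulr_gt0 ?exprn_gt0 // divr_gt0.
exists (maxn n0 (Num.bound B).+1) => n; rewrite geq_max => /andP[nn0 nB].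
have [K0 hK0] := h n nn0; have n_gt0 : (0 < n)%N by lia.
have eta2 : 0 < eta / 2 by rewrite divr_gt0.
have [K1 hK1] := (cvgnP _ _).1 (collision_cvg0 hp (n%:R ^+ 2)) _ eta2.
pose K := maxn K0 K1.
have := Pr_freq_approx hp (hX n) n_gt0 t1 e0 (hK0 K (leq_maxl _ _)).
move=> /le_trans; apply; rewrite [leRHS]splitr; apply: lerD.
  have := hK1 K (leq_maxr _ _); rewrite subr0 => /(le_lt_trans (ler_norm _)).
  exact: ltW.
have n0' : 0 < n%:R :> R by rewrite ltr0n.
rewrite ler_pdivrMr; last by rewrite mulr_gt0 // exprn_gt0.
rewrite mulrA -ler_pdivrMl; last by rewrite mulr_gt0 // exprn_gt0.
have Bn : B <= n%:R.
  apply: le_trans (ltW (archi_boundP (ltW B0))) _; rewrite ler_nat; exact: ltnW.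
by apply: le_trans Bn; rewrite /B mulrC [_ / 2 * _]mulrC.
Qed.

(** L is within 1 of H Z for large arguments, and Z is bounded. *)
Lemma limit_bounded : exists B, exists n0, forall n, (n0 <= n)%N -> `|c n| <= B.
Proof.
have [c1 [c10 _ Zc _ _]] := renewal_expE hp m.
have H0 := entropy_gt0 hp.
have [x0 h] := HZL ltr01.
exists (`|pit / (2 * (m.+2`!)%:R * H)| * (1 + H * c1)).
have [n0 hn0] : exists n0, forall n, (n0 <= n)%N -> x0 <= ln (n%:R : R).
  exists (Num.bound (expR x0)) => n hn.
  rewrite -[x0]expRK ler_ln ?posrE ?expR_gt0 //.
    by apply: le_trans (ltW (archi_boundP (expR_ge0 _))) _; rewrite ler_nat.
  apply: lt_le_trans (expR_gt0 x0) _.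
  by apply: le_trans (ltW (archi_boundP (expR_ge0 _))) _; rewrite ler_nat.
exists n0 => n /hn0 hn; rewrite normrM ler_wpM2l //.
have := h _ hn; rewrite subr0.
set Z := renewal _ _ _ => hZ; have Z0 : 0 <= Z by exact: renewal_expE_ge0.
have ZB : Z <= c1 by exact: Zc.
have := ler_normB (H * Z) (H * Z - L (ln n%:R)); rewrite opprB addrC subrK.
rewrite (ger0_norm (mulr_ge0 (ltW H0) Z0)).
move=> /le_trans; apply; rewrite addrC; apply: lerD => //.
exact: ler_wpM2l (ltW H0) _ _ ZB.
Qed.

End Fringe.

Lemma freq_bullet n K w : (0 < n)%N -> separated (X n) K w ->
  freq R bullet (Ups n w) = n%:R / (2 * n%:R - 1).
Proof.
move=> n0 u; rewrite /freq (nnodes_patricia n0 u) occ_bullet ?compress_full //.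
by rewrite (nleaves_patricia n0 u).
Qed.

Lemma cprob_given_bullet n w : (0 < n)%N -> ~ coincident (X n) w ->
  cprob_given (P n) (F n bullet) (Ups n) w = n%:R / (2 * n%:R - 1).
Proof.
move=> n0 nco; have -> : cprob_given (P n) (F n bullet) (Ups n) w = freq R bullet (Ups n w).
  exact: (cprob_given_freq hp (hX n) n0 (hV n0) bullet nco).
by move: nco => /contrapT[K _ u]; exact: freq_bullet u.
Qed.

(** On separated strings [freq] is constant, so [Pr_fringe_approx] applies with delta = 0, and its
    remaining error vanishes as K -> oo. *)
Lemma Pr_fringe_bullet n : (0 < n)%N -> Pr (P n) (F n bullet) = n%:R / (2 * n%:R - 1).
Proof.
move=> n0; set c := _ / _.
apply/eqP; rewrite -subr_eq0 -normr_le0.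
have := collision_cvg0 hp ((1 + `|c|) * 2 * n%:R ^+ 2) => /cvg0_le; apply => K.
apply: le_trans (Pr_fringe_approx n0 (hV n0) bullet c K (lexx 0)) _.
rewrite add0r -[leRHS]mulrA -[leRHS]mulrA ler_wpM2l ?addr_ge0 // [leRHS]mulr_natl mulr2n.
have h := Pr_not_separated hp (hX n) K.
apply: lerD => //; apply: le_trans h; apply: le_Pr.
- exact: (measurable_patricia (X n) (fun T => 0 < `|freq R bullet T - c|)).
- by apply: measurableC; exact: measurable_separated.
- by move=> w /= hw u; move: hw; rewrite (freq_bullet n0 u) subrr normr0 ltxx.
Qed.

End RandomTries.

Lemma cvg_in_prob_ext {R : realType} (d : nat -> measure_display)
    (Omega : forall n, measurableType (d n)) (P : forall n, probability (Omega n) R)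
    (Y Y' : forall n, Omega n -> R) (c c' : R) :
  (forall n w, `|Y n w - c| = `|Y' n w - c'|) ->
  cvg_in_prob P Y c -> cvg_in_prob P Y' c'.
Proof.
move=> YY' h e /h; under eq_fun => n do under eq_set => w do rewrite YY'.
by [].
Qed.

Lemma cmod_real {R : realType} (x y : R) : cmod (x%:C - y%:C) = `|x - y|.
Proof. by rewrite /cmod /= oppr0 addr0 expr0n addr0 sqrtr_sqr. Qed.

Lemma half_cvg {R : realType} : (fun n : nat => n%:R / (2 * n%:R - 1) : R) @ \oo --> (2^-1 : R).
Proof.
apply/cvgnP => e e0.
have /cvgnP hh := @cvg_harmonic R; have [N h] := hh _ e0.
exists N.+1 => -[//|n] /h; rewrite subr0 /= ger0_norm ?invr_ge0 // => hn.
apply: le_lt_trans hn; have : 1 <= n.+1%:R :> R by rewrite ler1n.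
move: (n.+1%:R : R) => s s1.
have -> : s / (2 * s - 1) - 2^-1 = (2 * (2 * s - 1))^-1 by field; rewrite gt_eqF //; lra.
rewrite ger0_norm ?invr_ge0 ?lef_pV2 ?posrE; lra.
Qed.

Theorem corollary3p6 (R : realType) (p : R) (hp : 0 < p < 1)
  (d : nat -> measure_display)
  (Omega : forall n : nat, measurableType (d n))
  (P : forall n : nat, probability (Omega n) R)
  (X : forall n : nat, 'I_n -> nat -> {RV (P n) >-> bool})
  (hX : forall n : nat, iid_Be p (X n))
  (Ups : forall n : nat, Omega n -> btree)
  (hUps : forall n : nat,
     Ups n = patricia (fun i j => X n i j : Omega n -> bool))
  (V : forall n : nat, Omega n -> seq bool)
  (hV : forall n : nat, (0 < n)%N -> uniform_node (P n) (Ups n) (V n)) :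
  (forall (t : btree) (m : nat), full t -> nleaves t = m -> (1 < m)%N ->
    let pit := pi_t (X m) t in
    let H := entropy p in
    let main (n : nat) : R[i] := (2 * H)^-1%:C * psiE p pit m (ln n%:R) in
    cvg_in_prob P (fun n w => cmod
        ((cprob_given (P n) (fringe_event (Ups n) (V n) t) (Ups n) w)%:C
         - main n)) 0 /\
    (fun n => cmod
        ((fine (P n (fringe_event (Ups n) (V n) t)))%:C - main n))
      @ \oo --> (0 : R) /\
    (~ log_ratio_rational p ->
      cvg_in_prob P (fun n w =>
          cprob_given (P n) (fringe_event (Ups n) (V n) t) (Ups n) w)
        (pit / (2 * m%:R * (m%:R - 1) * H)) /\
      (fun n => fine (P n (fringe_event (Ups n) (V n) t))) @ \oo -->
        pit / (2 * m%:R * (m%:R - 1) * H))) /\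
  (forall n : nat, (0 < n)%N ->
    {ae P n, forall w,
      cprob_given (P n) (fringe_event (Ups n) (V n) bullet) (Ups n) w
      = n%:R / (2 * n%:R - 1)} /\
    fine (P n (fringe_event (Ups n) (V n) bullet)) = n%:R / (2 * n%:R - 1)) /\
  (fun n : nat => n%:R / (2 * n%:R - 1) : R) @ \oo --> (2^-1 : R).
Proof.
have eU : Ups = fun n => patricia (fun i j => X n i j : Omega n -> bool).
  exact/functional_extensionality_dep.
move: hV; rewrite eU {hUps eU} => {}hV.
pose F n t := fringe_event (patricia (fun i j => X n i j : Omega n -> bool)) (V n) t.
split; [|split; last exact: half_cvg].
  (* With m > 1 leaves written as k + 2, the analytic lemmas apply with k in the role of their m. *)
  move=> t [|[|k]] // ft tm _ pit H; have H0 : 0 < H := entropy_gt0 hp.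
  have [L [psiL tL]] := psiE_asymptotics k hp.
  have conc := freq_concentration hp hX tm tL.
  have bounded := limit_bounded hp X t tL.
  have fact0 : (k.+2`!)%:R != 0 :> R by rewrite pnatr_eq0 -lt0n fact_gt0.
  pose c n := pit / (2 * (k.+2`!)%:R * H) * L (ln n%:R).
  have mainE n : (2 * H)^-1%:C * psiE p pit k.+2 (ln n%:R) = (c n)%:C.
    rewrite psiL -rmorphM /c; congr (_%:C); field.
    by rewrite fact0 gt_eqF.
  have cp : cvg_in_prob P (fun n w => `|cprob_given (P n) (F n t) (patricia (fun i j => X n i j : Omega n -> bool)) w - c n|) 0.
    exact: (cvg_in_prob_cprob_given hp hX hV conc).
  have cf : (fun n => `|fine (P n (F n t)) - c n|) @ \oo --> (0 : R).
    have [B hB] := bounded; exact: (cvg_Pr_fringe hp hX hV hB conc).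
  split; [|split].
  - apply: cvg_in_prob_ext cp => n w.
    by rewrite mainE cmod_real !subr0 normr_id.
  - apply/cvgnP => e /((cvgnP _ _).1 cf)[n0 h]; exists n0 => n /h.
    by rewrite mainE cmod_real.
  - move=> irr; set l := _ / _.
    (* In the aperiodic case psi has two expressions, through L and as a constant; comparing them
       evaluates c without knowing L. *)
    have cE n : c n = l.
      have := mainE n; rewrite psiE_irrational // -rmorphM => -[<-].
      have -> : l = pit / (2 * k.+2%:R * k.+1%:R * H).
        have e : k.+2%:R - 1 = k.+1%:R :> R by rewrite -natr1 addrK.
        by rewrite /l e.
      move: fact0; rewrite !factS !natrM !mulf_eq0 !negb_or => /and3P[f2 f1 f0].
      move: (k.+2%:R : R) (k.+1%:R : R) ((k`!)%:R : R) f2 f1 f0 => x y z x0 y0 z0.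
      by field; rewrite x0 y0 z0 gt_eqF.
    split.
      by apply: cvg_in_prob_ext cp => n w; rewrite cE subr0 normr_id.
    apply/cvgnP => e /((cvgnP _ _).1 cf)[n0 h]; exists n0 => n /h.
    by rewrite cE subr0 normr_id.
move=> n n0; split; last exact: (Pr_fringe_bullet hp hX hV n0).
(* The exceptional null set: off it the trie is genuine and has 2n - 1 nodes, n of them leaves. *)
exists (coincident (X n)); split.
- exact: measurable_coincident.
- by rewrite PrE ?(Pr_coincident hp (hX n)) //; exact: measurable_coincident.
- move=> w /= hw; apply: contrapT => nco; apply: hw.
  exact: (cprob_given_bullet hp hX hV n0 nco).
Qed.
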